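(* Let $P\subset\mathbb{R}^2$ be the moment polytope of a toric surface. Assume that $(\xi,u)$ is a solution to the toric HcscK system $$\begin{cases}\left(\xi^{ab}\right)_{,ab}=0\\ \left(\left(1-\xi\,D^2u\,\bar{\xi}\,D^2u\right)^{\frac{1}{2}}D^2u^{-1}\right)^{ab}_{,ab}=-C,\end{cases}$$ that $u$ satisfies Guillemin's boundary conditions, and that $\xi=(D^2u)^{-1}\,\Phi\,(D^2u)^{-1}$ for a symmetric complex matrix-valued function $\Phi\in C^\infty(P,\mathbb{C}^{2\times 2})$. Then for every convex function $f\in C^0(P)\cap C^\infty(P^\circ)$ $$\int_{\partial P}f\,\mathrm{d}\sigma-\int_PC\,f\,\mathrm{d}\mu\geq 0,$$ with equality if and only if $f$ is affine-linear.
   Context: $P=\{\boldsymbol y\in\mathbb{R}^2:\ell^r(\boldsymbol y)\ge0\ \forall r\}$ is a (compact) Delzant polytope with sides $S_r=\{\ell^r=0\}$, $\ell^r$ affine-linear, and interior $P^\circ$. Guillemin's boundary conditions: $u=u_P+h$ with $u_P=\sum_r\ell^r\log\ell^r$ and $h$ smooth on $P$, such that $D^2u$ is positive definite on $P^\circ$ and $\det D^2u=\big(\delta\prod_r\ell^r\big)^{-1}$ for a strictly positive $\delta\in C^0(P)$. $\mathrm{d}\mu$ is Lebesgue measure on $P$. $\mathrm{d}\sigma$ is the measure on $\partial P$ equal on the side $S_r$ to the Lebesgue (length) measure multiplied by $|\nabla\ell^r|^{-1}$ (Donaldson's boundary measure). $C=4\hat S$ is the topological constant ($\hat S$ the average scalar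 curvature of the toric surface). A solution of the system is understood to satisfy the standing condition that the (real, non-negative) eigenvalues of $\xi\,D^2u\,\bar\xi\,D^2u=(D^2u)^{-1}\Phi(D^2u)^{-1}\bar\Phi$ are less than $1$ on $P$. Commas denote derivatives in $\boldsymbol y$. *)

(* Defs.v *)
From HB Require Import structures.
From mathcomp Require Import all_boot all_order all_algebra.
From mathcomp Require Import complex.
From mathcomp Require Import all_classical all_reals all_analysis.

Set Implicit Arguments.
Unset Strict Implicit.
Unset Printing Implicit Defensive.

Import Order.TTheory GRing.Theory Num.Theory.
Import numFieldNormedType.Exports.

Local Open Scope classical_set_scope.
Local Open Scope ring_scope.

(* The plane is R * R.  Its library norm is the max norm, which only matters
   here through the topology; Euclidean lengths are written out explicitly. *)

Section Calculus.
Variable R : realType.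
Implicit Types (f : R * R -> R) (U P : set (R * R)) (y : R * R).

Definition basis_vec (a : 'I_2) : R * R :=
  if a == 0 then (1, 0) else (0, 1).

Definition partial (a : 'I_2) f y : R := 'D_(basis_vec a) f y.

Definition iter_partial (s : seq 'I_2) f : R * R -> R := foldr partial f s.

(* Every iterated partial derivative is (Frechet) differentiable on U; for
   open U this is C^infinity(U). *)
Definition smooth_on U f : Prop :=
  forall (s : seq 'I_2) y, U y -> differentiable (iter_partial s f) y.

(* C^infinity(P) for a closed set P: restrictions to P of functions smooth on
   an open neighbourhood of P. *)
Definition smooth_upto P f : Prop :=
  exists (U : set (R * R)) (g : R * R -> R),
    [/\ open U, P `<=` U, smooth_on U g & forall y, P y -> f y = g y].

Definition csmooth_mx_upto P (M : R * R -> 'M[R[i]]_2) : Prop :=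
  forall a b : 'I_2, smooth_upto P (fun y => complex.Re (M y a b)) /\
                     smooth_upto P (fun y => complex.Im (M y a b)).

Definition hessian f y : 'M[R]_2 :=
  \matrix_(a < 2, b < 2) partial a (partial b f) y.

(* (M^{ab})_{,ab} *)
Definition ddiv (M : R * R -> 'M[R]_2) y : R :=
  \sum_(a < 2) \sum_(b < 2) partial a (partial b (fun z => M z a b)) y.

Definition cddiv (M : R * R -> 'M[R[i]]_2) y : R[i] :=
  Complex (ddiv (fun z => map_mx (@complex.Re R) (M z)) y)
          (ddiv (fun z => map_mx (@complex.Im R) (M z)) y).

Definition posdef (A : 'M[R]_2) : Prop :=
  A^T = A /\ forall v : 'rV[R]_2, v != 0 -> 0 < (v *m A *m v^T) 0 0.

Definition cplx_mx (A : 'M[R]_2) : 'M[R[i]]_2 := map_mx (real_complex R) A.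

Definition conj_mx (A : 'M[R[i]]_2) : 'M[R[i]]_2 := map_mx (@conjc R) A.

(* Principal square root; 0 when there is none. *)
Definition mx_sqrt (M : 'M[R[i]]_2) : 'M[R[i]]_2 :=
  xget 0 [set S : 'M[R[i]]_2 | S *m S = M /\
    forall z : R[i], eigenvalue S z -> 0 < complex.Re z].

Definition affine_on P f : Prop :=
  exists c : R * R * R,
    forall y, P y -> f y = c.1.1 * y.1 + c.1.2 * y.2 + c.2.

Definition plane_measure : set (R * R) -> \bar R :=
  (@lebesgue_measure R \x @lebesgue_measure R)%E.

End Calculus.

(* Side r has inward normal [normal r] in Z^2 and defining function
   ell r y = <normal r, y> + offset r. *)
Record polygon (R : realType) := Polygon {
  nsides : nat;
  normal : 'I_nsides -> int * int;
  offset : 'I_nsides -> R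
}.

Section Polygon.
Variables (R : realType) (p : polygon R).
Implicit Types (r s : 'I_(nsides p)) (y : R * R) (u f h : R * R -> R).

Definition nu r : R * R := ((normal r).1%:~R, (normal r).2%:~R).

Definition ell r y : R := (nu r).1 * y.1 + (nu r).2 * y.2 + offset r.

Definition region : set (R * R) := [set y | forall r, 0 <= ell r y].

Definition side r : set (R * R) := [set y | region y /\ ell r y = 0].

(* The third clause says that every side is a genuine edge; together with the
   last one it makes exactly two sides meet at each vertex, with normals
   forming a basis of the lattice Z^2. *)
Definition delzant : Prop :=
  [/\ compact region,
      interior region !=set0,
      forall r, exists y z, [/\ side r y, side r z & y <> z],
      forall r, coprimez (normal r).1 (normal r).2 &
      forall r s, r != s -> side r `&` side s !=set0 ->
        `|(normal r).1 * (normal s).2 - (normal r).2 * (normal s).1|%R = 1].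

(* u_P; [ln] vanishes at 0, so this is also right on the boundary. *)
Definition guillemin_potential y : R := \sum_r ell r y * ln (ell r y).

Definition guillemin u : Prop :=
  [/\ exists2 h, smooth_upto region h &
        forall y, interior region y -> u y = guillemin_potential y + h y,
      forall y, interior region y -> posdef (hessian u y) &
      exists delta : R * R -> R,
        [/\ {within region, continuous delta},
            forall y, region y -> 0 < delta y &
            forall y, interior region y ->
              \det (hessian u y) = (delta y * \prod_r ell r y)^-1]].

(* Abreu's formula, in the normalisation for which C = 4 \hat S. *)
Definition scalar_curvature u y : R :=
  - 4%:R^-1 * ddiv (fun z => invmx (hessian u z)) y.

(* The average does not depend on the symplectic potential, so it is taken for
   the canonical one. *)
Definition average_scalar_curvature : R :=
  (\int[@plane_measure R]_(y in interior region)
     scalar_curvature guillemin_potential y) / fine (@plane_measure R region).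

Definition top_const : R := 4%:R * average_scalar_curvature.

Definition grad_norm r : R := Num.sqrt ((nu r).1 ^+ 2 + (nu r).2 ^+ 2).

(* Arc-length parametrisation of the line ell r = 0, starting from the point
   closest to the origin. *)
Definition line_param r (t : R) : R * R :=
  (- offset r * (nu r).1 / grad_norm r ^+ 2 - t * ((nu r).2 / grad_norm r),
   - offset r * (nu r).2 / grad_norm r ^+ 2 + t * ((nu r).1 / grad_norm r)).

(* d sigma is length measure on side r divided by the norm of grad (ell r). *)
Definition boundary_integral f : R :=
  \sum_r (grad_norm r)^-1 *
    \int[@lebesgue_measure R]_(t in [set t | region (line_param r t)])
      f (line_param r t).

(* (D^2 u)^{-1} on the closed polygon: D^2 u itself blows up at the boundary,
   so the inverse is extended there by its limit from the interior. *)
Definition inv_hessian_closure u y : 'M[R]_2 :=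
  lim (invmx (hessian u z) @[z --> within (interior region) (nbhs y)]).

(* (D^2u)^{-1} Phi (D^2u)^{-1} \bar Phi on the closed polygon. *)
Definition xi_norm_mx u (Phi : R * R -> 'M[R[i]]_2) y : 'M[R[i]]_2 :=
  let G := cplx_mx (inv_hessian_closure u y) in
  G *m Phi y *m G *m conj_mx (Phi y).

(* z < 1 in R[i] means that z is real and less than 1. *)
Definition eigenvalues_lt1 u (Phi : R * R -> 'M[R[i]]_2) : Prop :=
  forall y, region y -> forall z : R[i],
    eigenvalue (xi_norm_mx u Phi y) z -> z < 1.

Definition toric_hcsck u (xi : R * R -> 'M[R[i]]_2) : Prop :=
  (forall y, interior region y -> cddiv xi y = 0) /\
  (forall y, interior region y ->
     cddiv (fun z =>
       let H := cplx_mx (hessian u z) in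
       mx_sqrt (1%:M - xi z *m H *m conj_mx (xi z) *m H) *m invmx H) y
     = real_complex R (- top_const)).

End Polygon.

(* Main.v *)
Require Import Defs.
From HB Require Import structures.
From mathcomp Require Import all_boot all_order all_algebra.
From mathcomp Require Import complex.
From mathcomp Require Import all_classical all_reals all_analysis.
From mathcomp Require Import measurable_realfun.
From mathcomp Require Import ring lra.
Set Implicit Arguments.
Unset Strict Implicit.
Unset Printing Implicit Defensive.
Import Order.TTheory GRing.Theory Num.Theory.
Import numFieldNormedType.Exports.
Local Open Scope classical_set_scope.
Local Open Scope ring_scope.

(* Write [G = (D^2 u)^-1] and [m = Re ((1 - xi D^2u conj(xi) D^2u)^(1/2) G)].  By
   Guillemin's conditions [G] extends smoothly across the boundary of [P]: it is
   [N / D] with [N = (prod_r ell r) adj (D^2 u)] and [D = (prod_r ell r) det (D^2 u)]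
   smooth and [D = 1 / delta > 0] on [P].  By Cayley-Hamilton the square root of a
   2x2 matrix is an explicit function of its trace and determinant, so the bound on
   the eigenvalues makes [m] smooth near [P] as well, and positive definite inside.
   On the side [r], both [G] and [m] satisfy [nu_a m^{ab} = 0] and
   [nu_a m^{ab}_{,b} = 1].  Since [m^{ab}_{,ab} = - C], Green's formula gives
     boundary_integral F - \int C F = \int m^{ab} F_{,ab}
   for every [F] of class C^2 near [P].  A convex [f] is only smooth inside, so the
   formula is applied to [F_t y = f (y0 + t (y - y0))] with [y0] interior, and [t]
   tends to [1] from below: the right-hand side is nonnegative, and it cannot tend
   to [0] unless the Hessian of [f] vanishes on the interior. *)

(** * Functions of class C^k on open subsets of the plane *)

(** The normalisation of [G] on a side is carried by a factorisation [nu_r G = ell_r w_r], where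
    [w_r] is smooth and [nu_r . w_r = 1] wherever [ell_r] vanishes. Every term of [m] has [G] as its
    left factor, so [nu_r m] is again [ell_r] times a smooth row. On the side [G nu_r = 0] removes
    the quadratic term of that row, and the remaining factor [(1 + det Q) / tr Q], with [Q] the
    matrix square root, equals 1. Positivity of [m] reduces to two signs. Up to a positive scalar
    [m] is [W = (1 + d) G - G S G] with [d = det Q] and [S = Re (Phi G conj(Phi))]; both [det W] and
    [tr (W adj G)] have closed forms in which the eigenvalue bound shows positivity. Strictness
    could be lost as [t] tends to 1. Dilating about a point [z] where the Hessian of [f] does not
    vanish maps each ball around [z] into itself, so the integrand is bounded below on a fixed ball,
    uniformly in [t]. *)

Section Ck.
Variable R : realType.
Implicit Types (f g : R * R -> R) (U V : set (R * R)) (y z : R * R).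

(** Most identities between functions below hold only on an open set. The first-order expansion at
    [y] sees only the germ, and uniqueness of the differential does the rest. *)
Lemma diff_near (V W : normedModType R) (f g : V -> W) (y : V) :
  (\forall z \near y, f z = g z) ->
  differentiable f y -> differentiable g y /\ 'd g y = 'd f y :> (V -> W).
Proof.
move=> fg df.
have E : g \o shift y = cst (g y) + 'd f y +o_ 0 id.
  have /diff_locallyP[_ /eqaddoP H] := df.
  apply/eqaddoP => e e0; have := H e e0.
  have fgy : f y = g y by exact: (nbhs_singleton fg).
  have : \forall z \near (0 : V), f (z + y) = g (z + y).
    have : z + y @[z --> (0 : V)] --> y.
      by rewrite -[X in _ --> X]add0r; apply: cvgD; [exact: cvg_id|exact: cvg_cst].
    by move=> /(_ _ fg).
  by apply: filterS2 => z /= Hz; rewrite !fctE /= Hz fgy.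
have D := diff_unique (@diff_continuous _ _ _ _ _ df) E.
split; last exact: D.
apply/diff_locallyP; split; last by rewrite D.
by rewrite D; exact: diff_continuous.
Qed.

Lemma partialE a f y : differentiable f y -> partial a f y = 'd f y (basis_vec R a).
Proof. by move=> df; rewrite /partial deriveE. Qed.

Lemma open_near U f g y : open U -> U y -> (forall z, U z -> f z = g z) ->
  \forall z \near y, f z = g z.
Proof.
move=> oU Uy fg; have : nbhs y U by exact: open_nbhs_nbhs.
by apply: filterS.
Qed.

Lemma eq_partial U a f g y : open U -> U y -> (forall z, U z -> f z = g z) ->
  differentiable f y -> partial a f y = partial a g y.
Proof.
move=> oU Uy fg df; have [dg E] := diff_near (open_near oU Uy fg) df.
rewrite (partialE a dg) (partialE a df).
exact: esym (congr1 (@^~ (basis_vec R a)) E).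
Qed.

(** Level 0 already asks for differentiability, so [Ck n] makes all iterated partials up to order
    [n] differentiable, hence continuous. This is slightly stronger than C^n and is stable under the
    operations below by induction on [n]. *)
Fixpoint Ck n U f : Prop :=
  if n is n'.+1 then (forall y, U y -> differentiable f y) /\
                     forall a, Ck n' U (partial a f)
  else forall y, U y -> differentiable f y.

Lemma Ck_diff n U f y : Ck n U f -> U y -> differentiable f y.
Proof. by case: n => [|n] /= => [|[+ _]]; exact. Qed.

Lemma Ck_continuous n U f y : Ck n U f -> U y -> {for y, continuous f}.
Proof. by move=> Hf Uy; apply: differentiable_continuous; exact: Ck_diff Hf Uy. Qed.

Lemma Ck_partial n U f a : Ck n.+1 U f -> Ck n U (partial a f).
Proof. by case=> _; exact. Qed.

Lemma CkW n U f : Ck n.+1 U f -> Ck n U f.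
Proof.
elim: n f => [|n IH] f; first by case.
by move=> [df pf]; split=> [y Uy|a]; [exact: df|exact/IH/pf].
Qed.

Lemma Ck_sub n U V f : V `<=` U -> Ck n U f -> Ck n V f.
Proof.
move=> VU; elim: n f => [|n IH] f /=; first by move=> df y /VU/df.
by move=> [df pf]; split=> [y /VU/df|a]; [exact|exact/IH/pf].
Qed.

Lemma eq_Ck n U f g : open U -> (forall y, U y -> f y = g y) -> Ck n U f -> Ck n U g.
Proof.
move=> oU; elim: n f g => [|n IH] f g /= fg.
  by move=> df y Uy; have [] := diff_near (open_near oU Uy fg) (df _ Uy).
move=> [df pf]; split => [y Uy|a].
  by have [] := diff_near (open_near oU Uy fg) (df _ Uy).
apply: IH (pf a) => y Uy; exact: eq_partial oU Uy fg (df _ Uy).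
Qed.

Lemma smooth_on_Ck n U f : smooth_on U f -> Ck n U f.
Proof.
elim: n f => [|n IH] f Hf /=; first exact: (Hf [::]).
split; first exact: (Hf [::]).
(* [foldr] applies the last index of the list first, so an inner derivative is appended at the
   end. *)
by move=> a; apply: IH => s y Uy; have := Hf (rcons s a) y Uy; rewrite /iter_partial -cats1 foldr_cat.
Qed.

Lemma partial_cst (c : R) a y : partial a (fun=> c) y = 0.
Proof. by rewrite /partial; exact: derive_cst. Qed.

Lemma partialD a f g y : differentiable f y -> differentiable g y ->
  partial a (fun z => f z + g z) y = partial a f y + partial a g y.
Proof. by move=> df dg; rewrite /partial deriveD//; exact: diff_derivable. Qed.

Lemma partialM a f g y : differentiable f y -> differentiable g y ->
  partial a (fun z => f z * g z) y = f y * partial a g y + g y * partial a f y.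
Proof. by move=> df dg; rewrite /partial deriveM//; exact: diff_derivable. Qed.

Lemma partialN a f y : differentiable f y ->
  partial a (fun z => - f z) y = - partial a f y.
Proof. by move=> df; rewrite /partial deriveN//; exact: diff_derivable. Qed.

Lemma partialV a f y : differentiable f y -> f y != 0 ->
  partial a (fun z => (f z)^-1) y = - (partial a f y * ((f y)^-1 * (f y)^-1)).
Proof.
move=> df f0; rewrite /partial deriveV//; last exact: diff_derivable.
by rewrite -invfM -expr2 mulrC -mulNr.
Qed.

Lemma diffM' f g y : differentiable f y -> differentiable g y ->
  differentiable (fun z => f z * g z) y.
Proof. exact: differentiableM. Qed.

Lemma diffD' f g y : differentiable f y -> differentiable g y ->
  differentiable (fun z => f z + g z) y.
Proof. exact: differentiableD. Qed.

Lemma diffN' f y : differentiable f y -> differentiable (fun z => - f z) y.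
Proof. exact: differentiableN. Qed.

Lemma Ck_cst n U (c : R) : Ck n U (fun=> c).
Proof.
elim: n c => [|n IH] c /=; first by move=> y _; exact: differentiable_cst.
split=> [y _|a]; first exact: differentiable_cst.
rewrite (_ : partial a _ = fun=> 0); first exact: IH.
by apply/funext => y; rewrite partial_cst.
Qed.

Lemma diff_fst y : differentiable (fst : R * R -> R) y /\
  'd (fst : R * R -> R) y = fst :> (R * R -> R).
Proof.
have C : continuous (@fst R^o R^o : {linear (R^o * R^o)%type -> R^o}).
  by move=> z; exact: cvg_fst.
split; first exact: (@linear_differentiable R (R^o * R^o)%type R^o (@fst R^o R^o)).
exact: (@diff_lin R (R^o * R^o)%type R^o (@fst R^o R^o)).
Qed.

Lemma partial_fst a y : partial a fst y = (basis_vec R a).1.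
Proof. by have [d e] := diff_fst y; rewrite (partialE a d) e. Qed.

Lemma diff_snd y : differentiable (snd : R * R -> R) y /\
  'd (snd : R * R -> R) y = snd :> (R * R -> R).
Proof.
have C : continuous (@snd R^o R^o : {linear (R^o * R^o)%type -> R^o}).
  by move=> z; exact: cvg_snd.
split; first exact: (@linear_differentiable R (R^o * R^o)%type R^o (@snd R^o R^o)).
exact: (@diff_lin R (R^o * R^o)%type R^o (@snd R^o R^o)).
Qed.

Lemma partial_snd a y : partial a snd y = (basis_vec R a).2.
Proof. by have [d e] := diff_snd y; rewrite (partialE a d) e. Qed.

Lemma Ck_fst n U : Ck n U fst.
Proof.
case: n => [|n] /=; first by move=> y _; by have [] := diff_fst y.
split=> [y _|a]; first by have [] := diff_fst y.
rewrite (_ : partial a _ = fun=> (basis_vec R a).1); first exact: Ck_cst.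
by apply/funext => y; rewrite partial_fst.
Qed.

Lemma Ck_snd n U : Ck n U snd.
Proof.
case: n => [|n] /=; first by move=> y _; by have [] := diff_snd y.
split=> [y _|a]; first by have [] := diff_snd y.
rewrite (_ : partial a _ = fun=> (basis_vec R a).2); first exact: Ck_cst.
by apply/funext => y; rewrite partial_snd.
Qed.

Variable U : set (R * R).
Hypothesis oU : open U.

Lemma CkD n f g : Ck n U f -> Ck n U g -> Ck n U (fun z => f z + g z).
Proof.
elim: n f g => [|n IH] f g /=.
  by move=> df dg y Uy; apply: diffD'; [exact: df|exact: dg].
move=> [df pf] [dg pg]; split=> [y Uy|a]; first by apply: diffD'; [exact: df|exact: dg].
apply: (eq_Ck oU) (IH _ _ (pf a) (pg a)) => y Uy.
by rewrite partialD//; [exact: df|exact: dg].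
Qed.

Lemma CkN n f : Ck n U f -> Ck n U (fun z => - f z).
Proof.
elim: n f => [|n IH] f /=; first by move=> df y Uy; exact/diffN'/df.
move=> [df pf]; split=> [y Uy|a]; first exact/diffN'/df.
by apply: (eq_Ck oU) (IH _ (pf a)) => y Uy; rewrite partialN//; exact: df.
Qed.

Lemma CkB n f g : Ck n U f -> Ck n U g -> Ck n U (fun z => f z - g z).
Proof. by move=> Hf /CkN; exact: CkD. Qed.

Lemma CkM n f g : Ck n U f -> Ck n U g -> Ck n U (fun z => f z * g z).
Proof.
elim: n f g => [|n IH] f g.
  by move=> df dg y Uy; apply: diffM'; [exact: df|exact: dg].
move=> Hf Hg; have [df pf] := Hf; have [dg pg] := Hg.
split=> [y Uy|a]; first by apply: diffM'; [exact: df|exact: dg].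
apply: (eq_Ck oU) (CkD (IH _ _ (CkW Hf) (pg a)) (IH _ _ (CkW Hg) (pf a))) => y Uy.
by rewrite partialM//; [exact: df|exact: dg].
Qed.

Lemma CkV n f : (forall y, U y -> f y != 0) -> Ck n U f -> Ck n U (fun z => (f z)^-1).
Proof.
move=> f0; elim: n => [|n IH].
  by move=> df y Uy; apply: differentiableV; [exact: df|exact: f0].
move=> Hf; have [df pf] := Hf; have IHf := IH (CkW Hf).
split=> [y Uy|a]; first by apply: differentiableV; [exact: df|exact: f0].
apply: (eq_Ck oU) (CkN (CkM (pf a) (CkM IHf IHf))) => y Uy.
by rewrite partialV//; [exact: df|exact: f0].
Qed.

Lemma diff_comp1 (f : R -> R) (g : R * R -> R) y df : differentiable g y ->
  is_derive (g y) 1 f df ->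
  differentiable (fun z => f (g z)) y /\
  forall a, partial a (fun z => f (g z)) y = partial a g y * df.
Proof.
move=> dg [dsf esf].
have ds : differentiable f (g y) by exact/derivable1_diffP.
split; first exact: (differentiable_comp dg ds).
move=> a; rewrite [LHS]partialE; last exact: (differentiable_comp dg ds).
by rewrite (diff_comp dg ds) /= diff1E// derive1E esf partialE.
Qed.

Lemma diff_sqrt f y : differentiable f y -> 0 < f y ->
  differentiable (fun z => Num.sqrt (f z)) y /\
  forall a, partial a (fun z => Num.sqrt (f z)) y = partial a f y * (2 * Num.sqrt (f y))^-1.
Proof. by move=> df f0; exact: diff_comp1 df (is_derive1_sqrt f0). Qed.

Lemma Ck_sqrt n f : (forall y, U y -> 0 < f y) -> Ck n U f ->
  Ck n U (fun z => Num.sqrt (f z)).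
Proof.
move=> f0; elim: n => [|n IH].
  by move=> df y Uy; have [] := diff_sqrt (df _ Uy) (f0 _ Uy).
move=> Hf; have [df pf] := Hf; have IHf := IH (CkW Hf).
split=> [y Uy|a]; first by have [] := diff_sqrt (df _ Uy) (f0 _ Uy).
have H2 : forall y, U y -> 2 * Num.sqrt (f y) != 0.
  by move=> y Uy; rewrite mulf_neq0 ?pnatr_eq0// sqrtr_eq0 -ltNge f0.
apply: (eq_Ck oU) (CkM (pf a) (CkV H2 (CkM (Ck_cst n U 2) IHf))) => y Uy.
by have [_ ->] := diff_sqrt (df _ Uy) (f0 _ Uy).
Qed.

Lemma Ck_sum n (I : Type) (r : seq I) (P : pred I) (F : I -> R * R -> R) :
  (forall i, P i -> Ck n U (F i)) -> Ck n U (fun z => \sum_(i <- r | P i) F i z).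
Proof.
move=> H; elim: r => [|i r IH].
  rewrite (_ : (fun z => _) = fun=> 0); first exact: Ck_cst.
  by apply/funext => z; rewrite big_nil.
case: (boolP (P i)) => Pi; last by under eq_fun do rewrite big_cons (negbTE Pi).
by under eq_fun do rewrite big_cons Pi; apply: CkD => //; exact: H.
Qed.

Lemma Ck_prod n (I : Type) (r : seq I) (P : pred I) (F : I -> R * R -> R) :
  (forall i, P i -> Ck n U (F i)) -> Ck n U (fun z => \prod_(i <- r | P i) F i z).
Proof.
move=> H; elim: r => [|i r IH].
  rewrite (_ : (fun z => _) = fun=> 1); first exact: Ck_cst.
  by apply/funext => z; rewrite big_nil.
case: (boolP (P i)) => Pi; last by under eq_fun do rewrite big_cons (negbTE Pi).
by under eq_fun do rewrite big_cons Pi; apply: CkM => //; exact: H.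
Qed.

Lemma Ck_ell n (p : polygon R) r : Ck n U (@ell R p r).
Proof.
apply: CkD; last exact: Ck_cst.
by apply: CkD; apply: CkM; [exact: Ck_cst|exact: Ck_fst|exact: Ck_cst|exact: Ck_snd].
Qed.

Definition Ck_mx k m n (M : R * R -> 'M[R]_(m, n)) := forall i j, Ck k U (fun z => M z i j).

Lemma Ck_mxD k m n (M N : R * R -> 'M[R]_(m, n)) :
  Ck_mx k M -> Ck_mx k N -> Ck_mx k (fun z => M z + N z).
Proof. by move=> HM HN i j; under eq_fun do rewrite mxE; exact: CkD. Qed.

Lemma Ck_mxB k m n (M N : R * R -> 'M[R]_(m, n)) :
  Ck_mx k M -> Ck_mx k N -> Ck_mx k (fun z => M z - N z).
Proof. by move=> HM HN i j; under eq_fun do rewrite !mxE; exact: CkB. Qed.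

Lemma Ck_mxZ k m n c (M : R * R -> 'M[R]_(m, n)) :
  Ck k U c -> Ck_mx k M -> Ck_mx k (fun z => c z *: M z).
Proof. by move=> Hc HM i j; under eq_fun do rewrite mxE; exact: CkM. Qed.

Lemma Ck_mxM k m n q (M : R * R -> 'M[R]_(m, n)) (N : R * R -> 'M[R]_(n, q)) :
  Ck_mx k M -> Ck_mx k N -> Ck_mx k (fun z => M z *m N z).
Proof.
move=> HM HN i j; under eq_fun do rewrite mxE.
by apply: Ck_sum => l _; exact: CkM.
Qed.

End Ck.

(** * Integration by parts on a polygon *)

Section PlaneIntegral.
Variable R : realType.
Notation mu := (@lebesgue_measure R).
Notation RR := (measurableTypeR R * measurableTypeR R)%type.
Notation mu2 := (@lebesgue_measure R \x @lebesgue_measure R)%E.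

(** The sigma-algebra of [RR] is generated by measurable rectangles; an open set is the countable
    union of the rational boxes that it contains. *)
Lemma open_measurable2 (U : set (R * R)) : open U -> measurable (U : set RR).
Proof.
move=> oU.
pose box (q : rat * rat * (rat * rat)) : set RR :=
  (`](ratr q.1.1 : R), ratr q.1.2[%classic `*` `](ratr q.2.1 : R), ratr q.2.2[%classic).
have -> : U = \bigcup_(q in setT) (if pselect (box q `<=` U) then box q else set0 : set RR).
  apply/seteqP; split => [y Uy|y [q _]]; last first.
    by case: pselect => [bU /bU|_ []].
  have : nbhs y U by exact: open_nbhs_nbhs.
  move=> /nbhs_ballP[e /= e0 yeU].
  have He x : exists q : rat * rat, x - e < ratr q.1 < x /\ x < ratr q.2 < x + e.
    have [|a] := @rat_in_itvoo R (x - e) x; first by rewrite ltrBlDr ltrDl.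
    rewrite in_itv /= => Ha.
    have [|b] := @rat_in_itvoo R x (x + e); first by rewrite ltrDl.
    by rewrite in_itv /= => Hb; exists (a, b).
  have [[a b] [/andP[/= a1 a2] /andP[b1 b2]]] := He y.1.
  have [[c d] [/andP[/= c1 c2] /andP[d1 d2]]] := He y.2.
  exists ((a, b), (c, d)) => //.
  case: pselect => [Hb|NB] /=; first by split; rewrite /= in_itv /= ?a2 ?b1 ?c2 ?d1.
  apply: NB => z [/=]; rewrite !in_itv /= => /andP[z1 z2] /andP[z3 z4].
  apply: yeU; split; rewrite /ball /= ltr_norml; apply/andP; split; lra.
apply: countable_bigcupT_measurable => [|q]; first exact: countableP.
case: pselect => [Hb|NB] /=; last exact: measurable0.
apply: measurableX; exact: measurable_itv.
Qed.

Lemma closed_measurable2 (A : set (R * R)) : closed A -> measurable (A : set RR).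
Proof. by move=> /closed_openC/open_measurable2/measurableC; rewrite setCK. Qed.

Lemma compact_closed2 (A : set (R * R)) : compact A -> closed A.
Proof. by apply: compact_closed; exact: norm_hausdorff. Qed.

Lemma compact_measurable2 (A : set (R * R)) : compact A -> measurable (A : set RR).
Proof. by move=> /compact_closed2; exact: closed_measurable2. Qed.

Lemma within_continuous_measurable2 (D : set (R * R)) (f : R * R -> R) :
  measurable (D : set RR) -> {within D, continuous f} ->
  measurable_fun (D : set RR) (f : RR -> measurableTypeR R).
Proof.
move=> mD /continuousP cf; apply: (measurability _ (measurable_realfun.RGenOpens.measurableE R)).
move=> _ [_ [a [b ->] <-]].
have /open_subspaceP[V oV VD] := cf _ (@interval_open _ (BRight a) (BLeft b) erefl erefl).
by rewrite setIC -VD; apply: measurableI => //; exact: open_measurable2.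
Qed.

Lemma compact_box (A : set (R * R)) : compact A ->
  exists2 M : R, 0 < M & forall y, A y -> `|y.1| <= M /\ `|y.2| <= M.
Proof.
move=> /compact_bounded[M [_ HM]]; exists (`|M| + 1); first by rewrite ltr_pwDr.
move=> y Ay; have := HM (`|M| + 1) _ y Ay; rewrite ltr_pwDr// ?ler_norm// => /(_ isT).
by rewrite /= prod_normE ge_max => /andP.
Qed.

Lemma compact_finite2 (A : set (R * R)) : compact A -> (mu2 A < +oo)%E.
Proof.
move=> cA; have [M M0 AM] := compact_box cA.
have AB : A `<=` (`[- M, M]%classic `*` `[- M, M]%classic).
  by move=> y /AM; rewrite !ler_norml => -[H1 H2]; split; rewrite /= in_itv.
have mB : measurable (`[- M, M]%classic `*` `[- M, M]%classic : set RR).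
  by apply: measurableX; exact: measurable_itv.
apply: (@le_lt_trans _ _ (mu2 (`[- M, M]%classic `*` `[- M, M]%classic))).
  by apply: le_measure => //; rewrite inE//; exact: compact_measurable2.
rewrite [X in (X < _)%E](_ : _ = (mu `[(- M)%R, M]%classic * mu `[(- M)%R, M]%classic)%E); last first.
  by apply: product_measure1E; exact: measurable_itv.
by rewrite !lebesgue_measure_itv /=; case: ifPn => _; rewrite ?mule0// -EFinB -EFinM ltry.
Qed.

Lemma within_integrable2 (A : set (R * R)) (f : R * R -> R) :
  compact A -> {within A, continuous f} -> mu2.-integrable (A : set RR) (EFin \o f).
Proof.
move=> cA cf; apply: measurable_bounded_integrable.
- exact: compact_measurable2.
- exact: compact_finite2.
- by apply: within_continuous_measurable2 => //; exact: compact_measurable2.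
- have /compact_bounded[M [_ mrt]] := continuous_compact cf cA.
  by exists M; split; rewrite ?num_real // => ? ? ? ?; exact: mrt.
Qed.

Section Affine.
Variables (c k : R).
Hypothesis k0 : k != 0.
Let phi (t : measurableTypeR R) : measurableTypeR R := c + k * t.

Lemma measurable_affine : measurable_fun setT phi.
Proof.
apply: measurable_realfun.continuous_measurable_fun => t.
by apply: cvgD; [exact: cvg_cst|apply: cvgM; [exact: cvg_cst|exact: cvg_id]].
Qed.

(** The pushforward of [mu] scaled by [|k|] agrees with [mu] on half-open intervals, and Lebesgue
    measure is determined by these values. *)
Lemma lebesgue_measure_affine (A : set (measurableTypeR R)) : measurable A ->
  (mu A = `|k|%:E * mu (phi @^-1` A))%E.
Proof.
move=> mA; have mp := measurable_affine.
pose nu : {measure set (measurableTypeR R) -> \bar R} :=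
  mscale (NngNum (normr_ge0 k)) (pushforward mu phi).
rewrite -[RHS]/(nu mp A); apply: lebesgue_measure_unique mA => _ [[a b] /= ab <-].
rewrite /nu /mscale /= /pushforward.
have [k1|k1] := ltrP 0 k.
  have -> : phi @^-1` `]a, b] = `](a - c) / k, (b - c) / k]%classic.
    apply/seteqP; split => t /=; rewrite !in_itv /= /phi ltr_pdivrMr// ler_pdivlMr// ltrBlDl lerBrDl (mulrC t) //.
  rewrite !lebesgue_measure_itv /= !lte_fin ltr_pM2r ?invr_gt0// ltrD2r.
  case: ifPn => ab'; last by rewrite mule0.
  by rewrite -!EFinB -EFinM gtr0_norm//; congr EFin; field.
(* A decreasing map swaps the open and the closed end of the interval; the length is unaffected. *)
have {}k1 : k < 0 by rewrite lt_neqAle k0.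
have -> : phi @^-1` `]a, b] = `[(b - c) / k, (a - c) / k[%classic.
  apply/seteqP; split => t /=; rewrite !in_itv /= /phi ltr_ndivlMr// ler_ndivrMr// ltrBlDl lerBrDl (mulrC t) andbC //.
rewrite !lebesgue_measure_itv /= !lte_fin ltr_nM2r ?invr_lt0// ltrD2r.
case: ifPn => ab'; last by rewrite mule0.
by rewrite -!EFinB -EFinM ltr0_norm//; congr EFin; field.
Qed.

Lemma ge0_integral_affine (A : set (measurableTypeR R)) (f : R -> \bar R) : measurable A ->
  measurable_fun A f -> (forall x, 0 <= f x)%E ->
  (\int[mu]_(x in A) f x = `|k|%:E * \int[mu]_(t in phi @^-1` A) f (phi t))%E.
Proof.
move=> mA mf f0; have mp := measurable_affine.
rewrite -(@ge0_integral_pushforward _ _ _ _ R phi mp mu A f mA mf); last by move=> y _.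
pose nu : {measure set (measurableTypeR R) -> \bar R} := pushforward mu phi.
rewrite -(@ge0_integral_mscale _ _ R (nu mp) A mA (NngNum (normr_ge0 k)) f mf)//.
by apply: eq_measure_integral => B mB _; exact: lebesgue_measure_affine.
Qed.

Lemma Rintegral_affine (A : set (measurableTypeR R)) (f : R -> R) :
  measurable A -> mu.-integrable A (EFin \o f) ->
  \int[mu]_(x in A) f x = `|k| * \int[mu]_(t in phi @^-1` A) f (phi t).
Proof.
(* Since [|k| > 0], finiteness of the scaled positive and negative parts forces both parts to be
   finite, so no infinite difference arises. *)
have aux (P N : \bar R) : (`|k|%:E * P \is a fin_num -> `|k|%:E * N \is a fin_num ->
    fine (`|k|%:E * P - `|k|%:E * N) = (`|k| * fine (P - N))%R)%E.
  have nk0 : (0 < `|k|%:E)%E by rewrite lte_fin normr_gt0.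
  case: P => [x||]; case: N => [y||] //=; rewrite ?(gt0_muley nk0) ?(gt0_muleNy nk0)//.
  by move=> _ _; rewrite mulrBr.
move=> mA intf; have /integrableP[mf _] := intf.
have intp := integrable_pos_fin_num mA intf.
have intn := integrable_neg_fin_num mA intf.
rewrite (ge0_integral_affine mA (measurable_funepos mf)) in intp; last first.
  by move=> x; exact: funepos_ge0.
rewrite (ge0_integral_affine mA (measurable_funeneg mf)) in intn; last first.
  by move=> x; exact: funeneg_ge0.
rewrite /Rintegral [in LHS]integralE [in RHS]integralE.
rewrite (ge0_integral_affine mA (measurable_funepos mf)); last first.
  by move=> x; exact: funepos_ge0.
rewrite (ge0_integral_affine mA (measurable_funeneg mf)); last first.
  by move=> x; exact: funeneg_ge0.
apply: etrans (aux _ _ intp intn) _.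
by congr (_ * fine (_ - _)%E); apply: eq_integral => x _; rewrite ?funeposE ?funenegE.
Qed.

End Affine.
End PlaneIntegral.

(** * The fundamental theorem of calculus on a one-dimensional slice *)

Section Slice.
Variable R : realType.
Notation mu := (@lebesgue_measure R).

(** [I] is a segment whose left end is the root of a constraint with positive slope and whose right
    end is the root of one with negative slope, which explains the signs. All other terms vanish: a
    root outside [I] meets the zero extension [w \_ I], and a constant constraint has
    [Num.sg 0 = 0], whatever the quotient by 0 is. *)
Lemma integral_halflines n (a c : 'I_n -> R) (w w' : R -> R)
    (I := [set x | forall r, 0 <= a r * x + c r]) :
  (exists M : R, forall x, I x -> `|x| <= M) ->
  (forall r s x, r != s -> I x -> a r * x + c r = 0 -> a s * x + c s = 0 -> False) ->
  (forall x, I x -> is_derive x 1 w (w' x)) ->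
  {within I, continuous w'} ->
  \int[mu]_(x in I) w' x = - \sum_r Num.sg (a r) * (w \_ I) (- c r / a r).
Proof.
move=> [M IM] sep dw cw; pose x_ r := - c r / a r.
have hp r x : 0 < a r -> (0 <= a r * x + c r) = (x_ r <= x).
  by move=> ar; rewrite /x_ ler_pdivrMr// mulrC -lerBlDr sub0r.
have hn r x : a r < 0 -> (0 <= a r * x + c r) = (x <= x_ r).
  by move=> ar; rewrite /x_ ler_ndivlMr// mulrC -lerBlDr sub0r.
have hz r : a r != 0 -> a r * x_ r + c r = 0 by move=> ar; rewrite /x_; field.
have [I0|/set0P[x0 Ix0]] := eqVneq I set0.
  rewrite I0 Rintegral_set0 big1 ?oppr0// => r _.
  by rewrite patchE in_set0 mulr0.
(* Without a positive slope, [I] would contain points arbitrarily far to the left. *)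
have [r0 r0p] : exists r, 0 < a r.
  apply: contrapT => /forallNP H.
  have : I (x0 - (`|M| + `|x0| + 1)).
    move=> r; have /negP := H r; rewrite -leNgt => ar.
    rewrite (_ : _ + _ = a r * x0 + c r + - a r * (`|M| + `|x0| + 1)); last by ring.
    by apply: addr_ge0; [exact: Ix0|rewrite mulr_ge0// ?oppr_ge0// !addr_ge0].
  move=> /IM; rewrite ler_norml => /andP[+ _].
  have := ler_norm M; have := ler_norm x0; lra.
have [s0 s0n] : exists r, a r < 0.
  apply: contrapT => /forallNP H.
  have : I (x0 + (`|M| + `|x0| + 1)).
    move=> r; have /negP := H r; rewrite -leNgt => ar.
    rewrite (_ : _ + _ = a r * x0 + c r + a r * (`|M| + `|x0| + 1)); last by ring.
    by apply: addr_ge0; [exact: Ix0|rewrite mulr_ge0// !addr_ge0].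
  move=> /IM; rewrite ler_norml => /andP[_].
  have := ler_norm M; have := ler_norm (- x0); rewrite normrN; lra.
have [r1 r1p r1max] := @arg_maxP _ _ _ r0 (fun r => 0 < a r) x_ r0p.
have [s1 s1n s1min] := @arg_minP _ _ _ s0 (fun r => a r < 0) x_ s0n.
have IE : I = `[x_ r1, x_ s1]%classic.
  apply/seteqP; split => x.
    by move=> Ix; rewrite /= in_itv /= -(hp _ _ r1p) -(hn _ _ s1n); apply/andP; split; exact: Ix.
  rewrite /= in_itv /= => /andP[x1 x2] r.
  have [ar|ar|ar] := ltrgt0P (a r).
  - by rewrite hp//; apply: le_trans x1; exact: r1max.
  - by rewrite hn//; apply: (le_trans x2); exact: s1min.
  - by have := Ix0 r; rewrite ar !mul0r.
have Ile : x_ r1 <= x_ s1.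
  by move: Ix0; rewrite IE /= in_itv /= => /andP[/le_trans]; apply.
have Ir : I (x_ r1) by rewrite IE /= in_itv /= lexx.
have Is : I (x_ s1) by rewrite IE /= in_itv /= lexx andbT.
have r1s1 : r1 != s1 by apply: contraTneq r1p => ->; rewrite -leNgt ltW.
(* If the segment were a single point, two constraints would vanish there, against [sep]. *)
have Ilt : x_ r1 < x_ s1.
  rewrite lt_neqAle Ile andbT; apply/eqP => E.
  apply: (sep _ _ _ r1s1 Ir); first by rewrite hz// gt_eqF.
  by rewrite E hz// lt_eqF.
have FTC : \int[mu]_(x in I) w' x = w (x_ s1) - w (x_ r1).
  rewrite IE /Rintegral (@continuous_FTC2 _ w' w)//.
  - by rewrite -IE.
  - split.
    + by move=> x xI; have [] := dw x _; rewrite // IE /=; exact: subset_itv_oo_cc xI.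
    + apply: cvg_at_right_filter; apply: differentiable_continuous.
      by apply/derivable1_diffP; have [] := dw _ Ir.
    + apply: cvg_at_left_filter; apply: differentiable_continuous.
      by apply/derivable1_diffP; have [] := dw _ Is.
  - move=> x xI; rewrite derive1E; have [] := dw x _; rewrite // IE /=; exact: subset_itv_oo_cc xI.
rewrite FTC (bigD1 r1)//= (bigD1 s1) 1?eq_sym//= big1 => [|r /andP[rr rs]].
  rewrite -/(x_ r1) -/(x_ s1) !patchE !mem_set// gtr0_sg// ltr0_sg//.
  by rewrite mul1r mulN1r addr0 opprB.
rewrite -/(x_ r) patchE; case: ifPn => [|_]; last by rewrite mulr0.
rewrite inE => Ixr; have := Ixr; rewrite IE /= in_itv /= => /andP[xr1 xr2].
(* By extremality of [r1] and [s1], a further root inside [I] would coincide with an end point,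
   which [sep] excludes. *)
have [ar|ar|->] := ltrgt0P (a r); last by rewrite sgr0 mul0r.
- exfalso; apply: (sep _ _ _ rr Ir); last by rewrite hz// gt_eqF.
  by rewrite (@le_anti _ _ (x_ r1) (x_ r)) ?hz ?gt_eqF// xr1; exact: r1max.
- exfalso; apply: (sep _ _ _ rs Is); last by rewrite hz// lt_eqF.
  by rewrite (@le_anti _ _ (x_ s1) (x_ r)) ?hz ?lt_eqF// xr2 andbT; exact: s1min.
Qed.

End Slice.

Section Preimage.
Variable R : realType.
Notation mu := (@lebesgue_measure R).
Variables (A : set (R * R)) (cA : compact A) (g : R -> R * R).
Hypotheses (cg : continuous g) (bg : exists M : R, forall t, A (g t) -> `|t| <= M).

Lemma compact_curve_preimage : compact (g @^-1` A).
Proof.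
have [M HM] := bg.
apply: (@subclosed_compact _ _ `[- M, M]%classic).
- by apply: closed_comp => [x _|]; [exact: cg|exact: compact_closed2].
- exact: segment_compact.
- by move=> t /HM; rewrite /= in_itv /= ler_norml.
Qed.

Lemma within_curve (f : R * R -> R) :
  {within A, continuous f} -> {within g @^-1` A, continuous (f \o g)}.
Proof.
move=> /subspace_continuousP cf; apply/subspace_continuousP => t At.
move=> U HU; have {}HU : nbhs (g t) (fun z => A z -> U (f z)) := cf _ At _ HU.
have Ht : \forall x \near t, A (g x) -> U (f (g x)) := @cg t _ HU.
exact: Ht.
Qed.

Lemma integrable_curve (f : R * R -> R) : {within A, continuous f} ->
  mu.-integrable (g @^-1` A) (EFin \o (f \o g)).
Proof.
move=> cf; apply: continuous_compact_integrable; first exact: compact_curve_preimage.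
exact: within_curve.
Qed.

Lemma measurable_curve_preimage : measurable (g @^-1` A : set (measurableTypeR R)).
Proof. by apply: compact_measurable; exact: compact_curve_preimage. Qed.

Lemma patch_curve (f : R * R -> R) : (f \_ A) \o g = (f \o g) \_ (g @^-1` A).
Proof. by apply/funext => t; rewrite /= !patchE. Qed.

Lemma integrable_patch_curve (f : R * R -> R) : {within A, continuous f} ->
  mu.-integrable setT (EFin \o ((f \_ A) \o g)).
Proof.
move=> cf; rewrite patch_curve -restrict_EFin.
have mK := measurable_curve_preimage.
apply: (iffLR (integrable_mkcond _ mK)).
exact: integrable_curve.
Qed.

End Preimage.

Section Coordinates.
Variable R : realType.
Notation mu := (@lebesgue_measure R).
Notation RR := (measurableTypeR R * measurableTypeR R)%type.
Notation mu2 := (@lebesgue_measure R \x @lebesgue_measure R)%E.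

(** [coo a] is the coordinate integrated along a slice and [cocoo a] the transverse one, so that
    both coordinate directions are covered by the same argument. *)
Definition coo (a : 'I_2) (y : R * R) : R := if a == 0 then y.1 else y.2.
Definition cocoo (a : 'I_2) (y : R * R) : R := if a == 0 then y.2 else y.1.
Definition mkpoint (a : 'I_2) (x b : R) : R * R := if a == 0 then (x, b) else (b, x).

Lemma coordK a y : mkpoint a (coo a y) (cocoo a y) = y.
Proof. by rewrite /mkpoint /coo /cocoo; case: (a == 0); case: y. Qed.

Lemma coord_point a x b : coo a (mkpoint a x b) = x.
Proof. by rewrite /mkpoint /coo; case: (a == 0). Qed.

Lemma cocoord_point a x b : cocoo a (mkpoint a x b) = b.
Proof. by rewrite /mkpoint /cocoo; case: (a == 0). Qed.

Lemma dot_point a (v : R * R) x b :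
  v.1 * (mkpoint a x b).1 + v.2 * (mkpoint a x b).2 = coo a v * x + cocoo a v * b.
Proof. by rewrite /mkpoint /coo /cocoo; case: (a == 0) => //=; rewrite addrC. Qed.

Lemma continuous_point a (f g : R -> R) : continuous f -> continuous g ->
  continuous (fun t => mkpoint a (f t) (g t)).
Proof.
move=> cf cg t; rewrite /mkpoint; case: (a == 0).
  by apply: (@cvg_pair _ _ _ _ (nbhs (f t)) (nbhs (g t))); [exact: cf|exact: cg].
by apply: (@cvg_pair _ _ _ _ (nbhs (g t)) (nbhs (f t))); [exact: cg|exact: cf].
Qed.

Lemma integral_point a (g : R * R -> R) : mu2.-integrable setT (EFin \o g : RR -> \bar R) ->
  (\int[mu2]_z (g z)%:E = \int[mu]_b \int[mu]_x (g (mkpoint a x b))%:E)%E.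
Proof.
move=> ig; rewrite /mkpoint; case: (a == 0).
  exact/esym/(integral21_prod_meas1 ig).
exact/esym/(integral12_prod_meas1 ig).
Qed.

Lemma measurable_point a (g : R * R -> R) : mu2.-integrable setT (EFin \o g : RR -> \bar R) ->
  measurable_fun setT (fun b : measurableTypeR R => (\int[mu]_x (g (mkpoint a x b))%:E)%E).
Proof.
move=> ig; rewrite /mkpoint; case: (a == 0).
  exact: (measurable_fubini_G ig).
exact: (measurable_fubini_F ig).
Qed.

Lemma is_derive_point a (W : R * R -> R) x b : differentiable W (mkpoint a x b) ->
  is_derive x 1 (fun x => W (mkpoint a x b)) (partial a W (mkpoint a x b)).
Proof.
move=> dW.
have E : (fun h => h^-1 *: (((fun x => W (mkpoint a x b)) \o shift x) (h *: (1 : R)) - W (mkpoint a x b)))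
       = (fun h => h^-1 *: ((W \o shift (mkpoint a x b)) (h *: basis_vec R a) - W (mkpoint a x b))).
  apply/funext => h; congr (_ *: (W _ - _)).
  rewrite /= /mkpoint /basis_vec; case: (a == 0).
    by transitivity (h * 1 + x, h * 0 + b); [rewrite mulr0 add0r|].
  by transitivity (h * 0 + b, h * 1 + x); [rewrite mulr0 add0r|].
split; last by rewrite /partial /derive E.
by have := @diff_derivable _ _ _ _ _ (basis_vec R a) dW; rewrite /derivable E.
Qed.

Lemma Rintegral_sum (T : Type) (r : seq T) (F : T -> R -> R) :
  (forall i, mu.-integrable setT (EFin \o F i)) ->
  \int[mu]_b (\sum_(i <- r) F i b) = \sum_(i <- r) \int[mu]_b F i b.
Proof.
move=> iF; elim: r => [|i r IH].
  under eq_Rintegral do rewrite big_nil.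
  by rewrite big_nil Rintegral_cst ?mul0r//.
under eq_Rintegral do rewrite big_cons.
rewrite big_cons -IH; apply: RintegralD => //.
rewrite (_ : _ \o _ = fun b => (\sum_(i <- r) (F i b)%:E)%E); last first.
  by apply/funext => b /=; rewrite sumEFin.
by apply: integrable_sum => // j _; exact: iF.
Qed.

End Coordinates.

Section Divergence.
Variables (R : realType) (p : polygon R).
Notation mu := (@lebesgue_measure R).
Notation RR := (measurableTypeR R * measurableTypeR R)%type.
Notation mu2 := (@lebesgue_measure R \x @lebesgue_measure R)%E.
Notation P := (region p).
Implicit Types (r s : 'I_(nsides p)) (y : R * R).
Notation cross r s := ((nu r).1 * (nu s).2 - (nu r).2 * (nu s).1).
Hypothesis cP : compact P.
Hypothesis nu0 : forall r, nu r != (0, 0) :> R * R.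
Hypothesis crossP : forall r s y, r != s -> side r y -> side s y -> cross r s != 0.

Notation N := (@grad_norm R p).

Lemma grad_norm_gt0 r : 0 < N r.
Proof.
rewrite /grad_norm sqrtr_gt0 lt_neqAle eq_sym paddr_eq0 ?sqr_ge0// !sqrf_eq0.
rewrite addr_ge0 ?sqr_ge0// andbT.
have := nu0 r; rewrite [nu r]surjective_pairing /=; apply: contraNN => /andP[/eqP -> /eqP ->] //.
Qed.

Lemma grad_norm_sqr r : N r ^+ 2 = (nu r).1 ^+ 2 + (nu r).2 ^+ 2.
Proof. by rewrite sqr_sqrtr// addr_ge0 ?sqr_ge0. Qed.

Lemma ell_point (a : 'I_2) r (x b : R) : ell r (mkpoint a x b) =
  coo a (nu r) * x + (cocoo a (nu r) * b + offset r).
Proof. by rewrite /ell dot_point addrA. Qed.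

Lemma line_param1 r (t : R) : (line_param r t).1 =
  - offset r * (nu r).1 / grad_norm r ^+ 2 - t * ((nu r).2 / grad_norm r).
Proof. by []. Qed.

Lemma line_param2 r (t : R) : (line_param r t).2 =
  - offset r * (nu r).2 / grad_norm r ^+ 2 + t * ((nu r).1 / grad_norm r).
Proof. by []. Qed.

Lemma ell_line_param r (t : R) : ell r (line_param r t) = 0.
Proof.
have N0 : N r != 0 by rewrite gt_eqF// grad_norm_gt0.
have N2 : (nu r).1 ^+ 2 + (nu r).2 ^+ 2 != 0 by rewrite -grad_norm_sqr expf_neq0.
rewrite /ell line_param1 line_param2 grad_norm_sqr; field.
by apply/andP; split.
Qed.

(** [|k|] is the Jacobian between arc length on the side and the transverse coordinate that labels
    the slices. *)
Lemma cocoord_line_param (a : 'I_2) r : exists c k : R,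
  [/\ forall t, cocoo a (line_param r t) = c + k * t &
      `|k| = `|coo a (nu r)| / N r].
Proof.
have HN : `|N r| = N r by rewrite gtr0_norm// grad_norm_gt0.
rewrite /cocoo /coo; case: (a == 0).
  exists (- offset r * (nu r).2 / N r ^+ 2), ((nu r).1 / N r); split.
    by move=> s; rewrite line_param2 [s * _]mulrC.
  by rewrite normrM normfV HN.
exists (- offset r * (nu r).1 / N r ^+ 2), (- ((nu r).2 / N r)); split.
  by move=> s; rewrite line_param1; congr (_ + _); rewrite mulNr mulrC.
by rewrite normrN normrM normfV HN.
Qed.

Lemma coord_le (M : R) a y : `|y.1| <= M /\ `|y.2| <= M -> `|coo a y| <= M /\ `|cocoo a y| <= M.
Proof. by rewrite /coo /cocoo; case: (a == 0) => -[]. Qed.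

Lemma continuous_line_param r : continuous (line_param r).
Proof.
move=> t.
have c1 : (line_param r x).1 @[x --> t] --> (line_param r t).1.
  apply: cvgB; first exact: cvg_cst.
  by apply: cvgM; [exact: cvg_id|exact: cvg_cst].
have c2 : (line_param r x).2 @[x --> t] --> (line_param r t).2.
  apply: cvgD; first exact: cvg_cst.
  by apply: cvgM; [exact: cvg_id|exact: cvg_cst].
exact: (cvg_pair c1 c2).
Qed.

Lemma bounded_line_param r : exists M : R, forall t, P (line_param r t) -> `|t| <= M.
Proof.
have [M M0 HM] := compact_box cP.
have Nr0 := grad_norm_gt0 r.
exists (M + M) => t /HM[H1 H2].
have [h1 h2] : `|(nu r).1| <= N r /\ `|(nu r).2| <= N r.
  by split; rewrite -sqrtr_sqr ler_sqrt ?addr_ge0 ?sqr_ge0// ?lerDl ?lerDr sqr_ge0.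
rewrite -(ler_pM2r Nr0) -[X in _ * X <= _](gtr0_norm Nr0) -normrM.
(* The parameter is recovered as the cross product of the unit normal with the point. *)
have -> : t * N r = (nu r).1 * (line_param r t).2 - (nu r).2 * (line_param r t).1.
  transitivity (t * N r ^+ 2 / N r); first by field; rewrite gt_eqF.
  by rewrite grad_norm_sqr line_param1 line_param2; field; rewrite gt_eqF.
apply: (le_trans (ler_normB _ _)); rewrite !normrM mulrDl ![M * _]mulrC.
by rewrite lerD// ler_pM.
Qed.

Lemma line_param_mkpoint (a : 'I_2) r (t : R) : coo a (nu r) != 0 ->
  mkpoint a (- (cocoo a (nu r) * cocoo a (line_param r t) + offset r) / coo a (nu r))
    (cocoo a (line_param r t)) = line_param r t.
Proof.
move=> n0; rewrite -[RHS](coordK a); congr mkpoint.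
have := ell_line_param r t; rewrite -[in ell r _](coordK a (line_param r t)) ell_point.
by move=> /eqP; rewrite addr_eq0 => /eqP <-; rewrite mulrAC divff// mul1r.
Qed.

(** Cramer's rule for the intersection of two side lines. These points only serve to list the
    exceptional slices, so the junk value at parallel lines is harmless. *)
Definition vertex r s : R * R :=
  (((nu r).2 * offset s - (nu s).2 * offset r) / cross r s,
   ((nu s).1 * offset r - (nu r).1 * offset s) / cross r s).

Lemma vertexP r s y : r != s -> P y -> ell r y = 0 -> ell s y = 0 -> y = vertex r s.
Proof.
move=> rs Py ry sy; have D0 := crossP rs (conj Py ry) (conj Py sy).
move: ry sy; rewrite /ell => /eqP; rewrite addrC addr_eq0 => /eqP or /eqP.
rewrite addrC addr_eq0 => /eqP os; rewrite [LHS]surjective_pairing /vertex or os.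
by congr pair; field.
Qed.

(** Fubini reduces the integral to slices in direction [a], where [integral_halflines] gives end
    point values; these are then collected side by side and rewritten in arc length. Slices through
    a vertex, where two constraints vanish at once, form a null set. *)
Lemma integral_partial (a : 'I_2) (W : R * R -> R) :
  (forall y, P y -> differentiable W y) -> {within P, continuous (partial a W)} ->
  \int[mu2]_(y in P) partial a W y =
  - \sum_r coo a (nu r) / N r *
      \int[mu]_(t in [set t | P (line_param r t)]) W (line_param r t).
Proof.
move=> dW cW'.
have cW : {within P, continuous W}.
  by apply/continuous_in_subspaceT => y; rewrite inE => Py; exact/differentiable_continuous/dW.
have [M M0 HM] := compact_box cP.
pose dWP := partial a W \_ P.
have idW : mu2.-integrable setT (EFin \o dWP : RR -> \bar R).
  rewrite -restrict_EFin; apply: (iffLR (integrable_mkcond _ (compact_measurable2 cP))).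
  exact: within_integrable2.
(* The point where the slice at height [b] meets the line of side [r]. For a side parallel to the
   slice the quotient is 0 by convention, and its weight [Num.sg 0] removes it. *)
pose xr r b := - (cocoo a (nu r) * b + offset r) / coo a (nu r).
pose g r b := mkpoint a (xr r b) b.
have cg r : continuous (g r).
  apply: continuous_point => b; last exact: cvg_id.
  apply: cvgM; last exact: cvg_cst.
  apply: cvgN; apply: cvgD; last exact: cvg_cst.
  by apply: cvgM; [exact: cvg_cst|exact: cvg_id].
have bg r : exists M : R, forall b, P (g r b) -> `|b| <= M.
  by exists M => b /HM /(coord_le a)[_]; rewrite cocoord_point.
pose S b := - \sum_r Num.sg (coo a (nu r)) * (W \_ P) (g r b).
have iWg r : mu.-integrable setT (EFin \o ((W \_ P) \o g r)).
  exact: integrable_patch_curve.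
have slice b : (forall r s, b <> cocoo a (vertex r s)) ->
    (\int[mu]_x (dWP (mkpoint a x b))%:E = (S b)%:E)%E.
  move=> bV; pose I := [set x | P (mkpoint a x b)].
  have cpt : continuous (fun x => mkpoint a x b).
    by apply: continuous_point => x; [exact: cvg_id|exact: cvg_cst].
  have bI : exists M : R, forall x, P (mkpoint a x b) -> `|x| <= M.
    by exists M => x /HM /(coord_le a)[+ _]; rewrite coord_point.
  rewrite [LHS](_ : _ = \int[mu]_(x in I) (partial a W (mkpoint a x b))%:E)%E; last first.
    rewrite [RHS]integral_mkcond; apply: eq_integral => x _.
    by rewrite restrict_EFin /= /dWP !patchE.
  have iI := integrable_curve cP cpt bI cW'.
  have mI := measurable_curve_preimage cP cpt bI.
  rewrite -[LHS]fineK; last exact: (integrable_fin_num mI iI).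
  congr EFin.
  have IE : I = [set x | forall r, 0 <= coo a (nu r) * x + (cocoo a (nu r) * b + offset r)].
    by apply/seteqP; split => x /= Hx r; have := Hx r; rewrite ell_point.
  rewrite -/(Rintegral _ _ _) IE.
  apply: etrans (@integral_halflines R (nsides p) (fun r => coo a (nu r))
    (fun r => cocoo a (nu r) * b + offset r) (fun x => W (mkpoint a x b))
    (fun x => partial a W (mkpoint a x b)) _ _ _ _) _.
  - by rewrite -IE.
  - move=> r s x rs; rewrite -IE /= => Px; rewrite -!ell_point => xr0 xs0.
    by apply: (bV r s); rewrite -(vertexP rs Px xr0 xs0) cocoord_point.
  - by rewrite -IE => x Px; apply: is_derive_point; exact: dW.
  - rewrite -IE; exact: (within_curve cpt cW').
  - congr (- _); apply: eq_bigr => r _; congr (_ * _).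
    by rewrite -IE /g -/(xr r b) !patchE.
have iWs r : mu.-integrable setT (EFin \o (fun b => - Num.sg (coo a (nu r)) * (W \_ P) (g r b))).
  rewrite (_ : _ \o _ = fun b => ((- Num.sg (coo a (nu r)))%:E * ((W \_ P) (g r b))%:E)%E)//.
  by apply: integrableZl => //; exact: iWg.
have SE b : S b = \sum_r - Num.sg (coo a (nu r)) * (W \_ P) (g r b).
  by rewrite /S -sumrN; apply: eq_bigr => r _; rewrite mulNr.
have mS : measurable_fun setT (EFin \o S : measurableTypeR R -> \bar R).
  rewrite (_ : _ \o _ = fun b => (\sum_r (- Num.sg (coo a (nu r)) * (W \_ P) (g r b))%:E)%E).
    by apply: (@measurable_int _ _ _ mu); apply: integrable_sum => // r _; exact: iWs.
  by apply/funext => b /=; rewrite SE sumEFin.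
(* Only finitely many heights are exceptional, and they do not affect the outer integral. *)
have cV : countable (range (fun rs : 'I_(nsides p) * 'I_(nsides p) => cocoo a (vertex rs.1 rs.2))).
  exact: (sub_countable (card_image_le _ _) (countableP _)).
transitivity (\int[mu]_b S b).
  rewrite /Rintegral integral_mkcond; congr fine.
  rewrite restrict_EFin (integral_point a idW).
  apply: ae_eq_integral => //; first exact: measurable_point.
  exists (range (fun rs : 'I_(nsides p) * 'I_(nsides p) => cocoo a (vertex rs.1 rs.2))); split.
  - exact: countable_measurable.
  - exact: countable_lebesgue_measure0.
  - move=> b /= Hb; apply: contrapT => NV; apply: Hb => _; apply: slice => r s bE.
    by apply: NV; exists (r, s).
under eq_Rintegral do rewrite SE.
rewrite Rintegral_sum// -sumrN; apply: eq_bigr => r _.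
rewrite RintegralZl//; last exact: iWg.
rewrite mulNr; congr (- _).
have [->|n0] := eqVneq (coo a (nu r)) 0; first by rewrite sgr0 !mul0r.
have [c [k [ck kE]]] := cocoord_line_param a r.
have k0 : k != 0 by rewrite -normr_gt0 kE divr_gt0 ?normr_gt0// grad_norm_gt0.
have gE t : g r (c + k * t) = line_param r t by rewrite /g /xr -ck line_param_mkpoint.
rewrite (_ : \int[mu]_b _ = \int[mu]_(b in g r @^-1` P) W (g r b)); last first.
  rewrite [RHS]Rintegral_mkcond; apply: eq_Rintegral => b _.
  by rewrite !patchE.
rewrite (@Rintegral_affine R c k k0 (g r @^-1` P) (W \o g r)); last 2 first.
- exact: measurable_curve_preimage.
- exact: integrable_curve.
(* The sign from the slice formula times the Jacobian [|nu_a| / N] restores the signed factor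
   [nu_a / N]. *)
rewrite mulrA kE mulrA -numEsg; congr (_ * _).
rewrite (_ : _ @^-1` _ = [set t | P (line_param r t)]); last first.
  by apply/seteqP; split => t /=; rewrite gE.
by apply: eq_Rintegral => t _; rewrite /= gE.
Qed.

End Divergence.

(** * Derivatives along lines and under dilations *)

Section Lines.
Variable R : realType.
Implicit Types (y z v : R * R) (f : R * R -> R).

Lemma diff_pairE f y v : 'd f y v = v.1 * 'd f y (1, 0) + v.2 * 'd f y (0, 1).
Proof.
have {1}-> : v = v.1 *: (1, 0) + v.2 *: (0, 1) :> R * R.
  rewrite [LHS]surjective_pairing; transitivity (v.1 * 1 + v.2 * 0, v.1 * 0 + v.2 * 1); last by [].
  by rewrite !mulr1 !mulr0 addr0 add0r.
by rewrite linearD !linearZ.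
Qed.

Lemma deriveD2 f y v : differentiable f y ->
  'D_v f y = v.1 * partial ord0 f y + v.2 * partial (lift ord0 ord0) f y.
Proof.
move=> df; rewrite (partialE ord0 df) (partialE (lift ord0 ord0) df) deriveE; last exact: df.
exact: diff_pairE.
Qed.

Definition line y v (s : R) : R * R := (y.1 + s * v.1, y.2 + s * v.2).

Lemma is_derive_line f y v (s : R) : differentiable f (line y v s) ->
  is_derive s 1 (fun s => f (line y v s))
    (v.1 * partial ord0 f (line y v s) + v.2 * partial (lift ord0 ord0) f (line y v s)).
Proof.
move=> df; rewrite -(deriveD2 v df).
have E : (fun h => h^-1 *: (((fun s => f (line y v s)) \o shift s) (h *: (1 : R)) - f (line y v s)))
       = (fun h => h^-1 *: ((f \o shift (line y v s)) (h *: v) - f (line y v s))).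
  apply/funext => h; congr (_ *: (f _ - _)); rewrite /line /=.
  transitivity (h * v.1 + (y.1 + s * v.1), h * v.2 + (y.2 + s * v.2)); last by [].
  by congr pair; rewrite /GRing.scale /=; ring.
split; last by rewrite /derive E.
by have := @diff_derivable _ _ _ _ _ v df; rewrite /derivable E.
Qed.

Definition dil z (t : R) y : R * R := (z.1 + t * (y.1 - z.1), z.2 + t * (y.2 - z.2)).

Lemma differentiable_dil z (t : R) y : differentiable (dil z t) y.
Proof.
have d1 : differentiable (fun x : R * R => z.1 + t * (x.1 - z.1)) y.
  apply: diffD'; first exact: differentiable_cst.
  apply: diffM'; first exact: differentiable_cst.
  by apply: diffD'; [have [] := diff_fst y|exact: differentiable_cst].
have d2 : differentiable (fun x : R * R => z.2 + t * (x.2 - z.2)) y.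
  apply: diffD'; first exact: differentiable_cst.
  apply: diffM'; first exact: differentiable_cst.
  by apply: diffD'; [have [] := diff_snd y|exact: differentiable_cst].
exact: differentiable_pair d1 d2.
Qed.

Lemma continuous_dil z (t : R) : continuous (dil z t).
Proof. by move=> y; apply: differentiable_continuous; exact: differentiable_dil. Qed.

Lemma diff_dil z (t : R) f y : differentiable f (dil z t y) ->
  differentiable (fun x => f (dil z t x)) y /\
  forall a, partial a (fun x => f (dil z t x)) y = t * partial a f (dil z t y).
Proof.
move=> df; have dd := differentiable_dil z t y.
split; first exact: (differentiable_comp dd df).
move=> a; set v := basis_vec R a.
have -> : t * partial a f (dil z t y) = 'D_(t *: v) f (dil z t y).
  rewrite (partialE a df) deriveE; last exact: df.
  by rewrite linearZ.
rewrite /partial /derive.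
have E : (fun h : R => h^-1 *: (((fun x => f (dil z t x)) \o shift y) (h *: v) - f (dil z t y)))
       = (fun h : R => h^-1 *: ((f \o shift (dil z t y)) (h *: (t *: v)) - f (dil z t y))).
  apply/funext => h; congr (_ *: (f _ - _)); rewrite /= /dil.
  symmetry; transitivity (h * (t * v.1) + (z.1 + t * (y.1 - z.1)), h * (t * v.2) + (z.2 + t * (y.2 - z.2))); first by [].
  symmetry; transitivity (z.1 + t * ((h * v.1 + y.1) - z.1), z.2 + t * ((h * v.2 + y.2) - z.2)); first by [].
  by congr pair; ring.
by rewrite -/v E.
Qed.

Lemma Ck_dil z (t : R) n (V : set (R * R)) f : open V -> Ck n V f ->
  Ck n (dil z t @^-1` V) (fun x => f (dil z t x)).
Proof.
move=> oV; have oU : open (dil z t @^-1` V).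
  by apply: open_comp => // x _; exact: continuous_dil.
elim: n f => [|n IH] f.
  by move=> df y Vy; have [] := diff_dil (df _ Vy).
move=> [df pf]; split=> [y Vy|a]; first by have [] := diff_dil (df _ Vy).
apply: (eq_Ck oU) (CkM oU (Ck_cst n _ t) (IH _ (pf a))) => y Vy.
by have [_ ->] := diff_dil (df _ Vy).
Qed.

Lemma is_derive_line2 f y v (s : R) (V : set (R * R)) : Ck 1 V f -> V (line y v s) ->
  is_derive s 1 (fun s => v.1 * partial ord0 f (line y v s) + v.2 * partial (lift ord0 ord0) f (line y v s))
  (v.1 * (v.1 * partial ord0 (partial ord0 f) (line y v s)
          + v.2 * partial (lift ord0 ord0) (partial ord0 f) (line y v s))
   + v.2 * (v.1 * partial ord0 (partial (lift ord0 ord0) f) (line y v s)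
          + v.2 * partial (lift ord0 ord0) (partial (lift ord0 ord0) f) (line y v s))).
Proof.
move=> Cf Vs.
have H b := is_derive_line (Ck_diff (Ck_partial b Cf) Vs).
have H0 := @is_deriveZ _ _ _ _ v.1 _ _ _ (H ord0).
have H1 := @is_deriveZ _ _ _ _ v.2 _ _ _ (H (lift ord0 ord0)).
exact: (is_deriveD H0 H1).
Qed.

End Lines.

Local Opaque partial.
Notation i1 := (lift ord0 ord0 : 'I_2).

(** * Green's formula for a degenerate second-order operator *)

Section GreenAlgebra.
Variable R : comRingType.

(** The divergence of [m^{ab} F_{,b} - F m^{ab}_{,b}]: the entry [b] stands for both off-diagonal
    entries of [m], and this symmetry cancels all terms with first derivatives of [F]. *)
Lemma green_algebra (a b c F00 F01 F10 F11 F0 F1 F p q r s d00 d01 d10 d11 : R) :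
  ((a * F00 + F0 * p + (b * F01 + F1 * q)) + - (F * (d00 + d01) + (p + r) * F0))
  + ((b * F10 + F0 * r + (c * F11 + F1 * s)) + - (F * (d10 + d11) + (q + s) * F1))
  = ((a * F00 + b * F01) + (b * F10 + c * F11)) - F * ((d00 + d01) + (d10 + d11)).
Proof. by ring. Qed.

(** The same field paired with the inward normal: degeneracy of [m] along the side removes the
    derivatives of [F], and the normalisation of its first derivatives leaves [- F]. *)
Lemma green_flux (n0 n1 a b c d F0 F1 F p q r s : R) :
  n0 * a + n1 * c = 0 -> n0 * b + n1 * d = 0 -> n0 * (p + q) + n1 * (r + s) = 1 ->
  n0 * ((a * F0 + b * F1) + - (F * (p + q))) + n1 * ((c * F0 + d * F1) + - (F * (r + s)))
  = -1 * F.
Proof.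
move=> H0 H1 H.
transitivity (F0 * (n0 * a + n1 * c) + F1 * (n0 * b + n1 * d) - F * (n0 * (p + q) + n1 * (r + s))).
  by ring.
by rewrite H0 H1 H; ring.
Qed.

End GreenAlgebra.

Section Green.
Variables (R : realType) (p : polygon R).
Notation mu := (@lebesgue_measure R).
Notation RR := (measurableTypeR R * measurableTypeR R)%type.
Notation mu2 := (@lebesgue_measure R \x @lebesgue_measure R)%E.
Notation P := (region p).
Implicit Types (r s : 'I_(nsides p)) (y : R * R).
Notation cross r s := ((nu r).1 * (nu s).2 - (nu r).2 * (nu s).1).
Hypothesis cP : compact P.
Hypothesis nu0 : forall r, nu r != (0, 0) :> R * R.
Hypothesis crossP : forall r s y, r != s -> side r y -> side s y -> cross r s != 0.

Lemma within_CkP n (U : set (R * R)) (F : R * R -> R) :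
  P `<=` U -> Ck n U F -> {within P, continuous F}.
Proof.
move=> PU CF; apply/continuous_in_subspaceT => y; rewrite inE => Py.
exact: Ck_continuous CF (PU _ Py).
Qed.

Lemma integrable_CkP n (U : set (R * R)) (F : R * R -> R) :
  P `<=` U -> Ck n U F -> mu2.-integrable (P : set RR) (EFin \o F).
Proof. by move=> PU CF; apply: within_integrable2 => //; exact: within_CkP PU CF. Qed.

Lemma integrable_boundary r (F : R * R -> R) : {within P, continuous F} ->
  mu.-integrable [set t | P (line_param r t)] (EFin \o (F \o line_param r)).
Proof.
apply: (integrable_curve cP); first exact: continuous_line_param.
exact: bounded_line_param.
Qed.

Lemma measurable_boundary r :
  measurable ([set t | P (line_param r t)] : set (measurableTypeR R)).
Proof.
apply: (measurable_curve_preimage cP); first exact: continuous_line_param.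
exact: bounded_line_param.
Qed.

Lemma divergence_polygon (U : set (R * R)) (V : 'I_2 -> R * R -> R) :
  P `<=` U -> (forall a, Ck 1 U (V a)) ->
  \int[mu2]_(y in P) (\sum_(a < 2) partial a (V a) y) =
  - \sum_(r : 'I_(nsides p)) (grad_norm r)^-1 *
      \int[mu]_(t in [set t | P (line_param r t)])
        (\sum_(a < 2) coo a (nu r) * V a (line_param r t)).
Proof.
move=> PU CV.
have HP (a : 'I_2) := integral_partial cP nu0 crossP
  (fun y Py => Ck_diff (CV a) (PU _ Py)) (within_CkP PU (Ck_partial a (CV a))).
under eq_Rintegral do rewrite !big_ord_recl big_ord0 addr0.
rewrite RintegralD; [|exact: compact_measurable2|exact: integrable_CkP PU (Ck_partial _ (CV _))|exact: integrable_CkP PU (Ck_partial _ (CV _))].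
rewrite !HP -opprD -big_split /=; congr (- _); apply: eq_bigr => r _.
have iV a : mu.-integrable [set t | P (line_param r t)]
    (EFin \o (fun t => coo a (nu r) * V a (line_param r t))).
  rewrite (_ : _ \o _ = fun t => ((coo a (nu r))%:E * (V a (line_param r t))%:E)%E)//.
  apply: integrableZl; first exact: measurable_boundary.
  exact/integrable_boundary/(within_CkP PU (CV a)).
under [in RHS]eq_Rintegral do rewrite !big_ord_recl big_ord0 addr0.
rewrite RintegralD; [|exact: measurable_boundary|exact: iV|exact: iV].
rewrite !RintegralZl; try exact: measurable_boundary.
- by rewrite mulrDr !mulrA ![_^-1 * _]mulrC.
- exact/integrable_boundary/(within_CkP PU (CV _)).
- exact/integrable_boundary/(within_CkP PU (CV _)).
Qed.

Lemma sum_ord2 (f : 'I_2 -> R) : \sum_(a < 2) f a = f ord0 + f (lift ord0 ord0).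
Proof. by rewrite !big_ord_recl big_ord0 addr0. Qed.

Definition hcontract (m : R * R -> 'M[R]_2) (F : R * R -> R) y : R :=
  \sum_(a < 2) \sum_(b < 2) m y a b * partial a (partial b F) y.

Lemma hcontractE m F y : hcontract m F y =
  (m y ord0 ord0 * partial ord0 (partial ord0 F) y
   + m y ord0 (lift ord0 ord0) * partial ord0 (partial (lift ord0 ord0) F) y)
  + (m y (lift ord0 ord0) ord0 * partial (lift ord0 ord0) (partial ord0 F) y
   + m y (lift ord0 ord0) (lift ord0 ord0) * partial (lift ord0 ord0) (partial (lift ord0 ord0) F) y).
Proof.
apply: etrans (sum_ord2 _) _.
exact: (congr2 +%R (sum_ord2 (fun b => m y ord0 b * partial ord0 (partial b F) y)) (sum_ord2 (fun b => m y (lift ord0 ord0) b * partial (lift ord0 ord0) (partial b F) y))).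
Qed.

Lemma ddivE (m : R * R -> 'M[R]_2) y : ddiv m y =
  (partial ord0 (partial ord0 (fun z => m z ord0 ord0)) y
   + partial ord0 (partial (lift ord0 ord0) (fun z => m z ord0 (lift ord0 ord0))) y)
  + (partial (lift ord0 ord0) (partial ord0 (fun z => m z (lift ord0 ord0) ord0)) y
   + partial (lift ord0 ord0) (partial (lift ord0 ord0) (fun z => m z (lift ord0 ord0) (lift ord0 ord0))) y).
Proof.
apply: etrans (sum_ord2 _) _.
exact: (congr2 +%R (sum_ord2 (fun b => partial ord0 (partial b (fun z => m z ord0 b)) y)) (sum_ord2 (fun b => partial (lift ord0 ord0) (partial b (fun z => m z (lift ord0 ord0) b)) y))).
Qed.

Lemma green_formula (U : set (R * R)) (m : R * R -> 'M[R]_2) (F : R * R -> R) :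
  open U -> P `<=` U -> Ck_mx U 2 m -> Ck 2 U F ->
  (forall y, (m y)^T = m y) ->
  (forall r y, side r y -> forall b, \sum_(a < 2) coo a (nu r) * m y a b = 0) ->
  (forall r y, side r y ->
     \sum_(a < 2) coo a (nu r) * \sum_(b < 2) partial b (fun z => m z a b) y = 1) ->
  \int[mu2]_(y in P) (hcontract m F y - F y * ddiv m y) = boundary_integral p F.
Proof.
move=> oU PU Cm CF msym m0 m1.
pose i1 : 'I_2 := lift ord0 ord0.
(* The field [V^a = m^{ab} F_{,b} - F m^{ab}_{,b}], to which the divergence theorem is applied. *)
have [V VE] : exists V : 'I_2 -> R * R -> R, V = fun a y =>
    (m y a ord0 * partial ord0 F y + m y a i1 * partial i1 F y)
  + - (F y * (partial ord0 (fun z => m z a ord0) y + partial i1 (fun z => m z a i1) y)).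
  by eexists.
have CF1 := CkW CF.
have CV a : Ck 1 U (V a).
  have C1 b : Ck 1 U (fun y => m y a b * partial b F y).
    exact: (CkM oU (CkW (Cm a b)) (Ck_partial b CF)).
  have C2 := CkD oU (Ck_partial ord0 (Cm a ord0)) (Ck_partial i1 (Cm a i1)).
  by rewrite VE; exact: (CkD oU (CkD oU (C1 ord0) (C1 i1)) (CkN oU (CkM oU CF1 C2))).
have dV y : P y -> \sum_(a < 2) partial a (V a) y = hcontract m F y - F y * ddiv m y.
  move=> /PU Uy.
  have dF a : differentiable (partial a F) y by apply: Ck_diff (Ck_partial a CF) Uy.
  have dm a b : differentiable (fun z => m z a b) y by apply: Ck_diff (Cm a b) Uy.
  have ddm a b c : differentiable (partial c (fun z => m z a b)) y.
    by apply: Ck_diff (Ck_partial c (Cm a b)) Uy.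
  have m10 z : m z i1 ord0 = m z ord0 i1 by rewrite -[in LHS](msym z) mxE.
  have dF0 : differentiable F y by apply: Ck_diff CF Uy.
  have pV a : partial a (V a) y =
      (m y a ord0 * partial a (partial ord0 F) y + partial ord0 F y * partial a (fun z => m z a ord0) y
     + (m y a i1 * partial a (partial i1 F) y + partial i1 F y * partial a (fun z => m z a i1) y))
     + - (F y * (partial a (partial ord0 (fun z => m z a ord0)) y + partial a (partial i1 (fun z => m z a i1)) y)
     + (partial ord0 (fun z => m z a ord0) y + partial i1 (fun z => m z a i1) y) * partial a F y).
    have d1 b : differentiable (fun z => m z a b * partial b F z) y by apply: diffM'; [exact: dm|exact: dF].
    have d2 : differentiable (fun z => partial ord0 (fun z => m z a ord0) z + partial i1 (fun z => m z a i1) z) y.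
      by apply: diffD'; exact: ddm.
    rewrite VE partialD; [|by apply: diffD'; exact: d1|by apply: diffN'; apply: diffM'; [exact: dF0|exact: d2]].
    rewrite partialD; [|exact: d1|exact: d1].
    rewrite partialM; [|exact: dm|exact: dF].
    rewrite partialM; [|exact: dm|exact: dF].
    rewrite partialN; last by apply: diffM'; [exact: dF0|exact: d2].
    rewrite partialM; [|exact: dF0|exact: d2].
    by rewrite partialD; [|exact: ddm|exact: ddm].
  rewrite sum_ord2 hcontractE ddivE -/i1 (pV ord0) (pV i1).
  have M10 : (fun z => m z i1 ord0) = (fun z => m z ord0 i1) by apply/funext.
  rewrite M10 (m10 y).
  exact: green_algebra.
have -> : \int[mu2]_(y in P) (hcontract m F y - F y * ddiv m y) =
    \int[mu2]_(y in P) (\sum_(a < 2) partial a (V a) y).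
  by apply: eq_Rintegral => y; rewrite inE => Py; rewrite dV.
rewrite (divergence_polygon PU CV) -sumrN /boundary_integral; apply: eq_bigr => r _.
rewrite -mulrN; congr (_ * _).
have -> : \int[mu]_(t in [set t | P (line_param r t)])
      (\sum_(a < 2) coo a (nu r) * V a (line_param r t)) =
    \int[mu]_(t in [set t | P (line_param r t)]) (-1 * F (line_param r t)).
  apply: eq_Rintegral => t; rewrite inE /= => Pt; set y := line_param r t.
  have sy : side r y by split; [exact: Pt|exact: ell_line_param].
  have H0 := m0 r y sy ord0; have H1 := m0 r y sy i1; have H := m1 r y sy.
  rewrite !sum_ord2 -/i1 in H0 H1 H *.
  by rewrite VE; apply: green_flux H0 H1 H.
rewrite RintegralZl; last 2 first.
- exact: measurable_boundary.
- exact/integrable_boundary/(within_CkP PU CF).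
by rewrite mulN1r opprK.
Qed.

End Green.

(** * Dilations of the polygon *)

Section Geometry.
Variables (R : realType) (p : polygon R).
Notation P := (region p).
Notation Po := (interior (region p)).
Implicit Types (r s : 'I_(nsides p)) (y z : R * R).
Hypothesis cP : compact P.
Hypothesis nu0 : forall r, nu r != (0, 0) :> R * R.

Lemma ell_dil r z (t : R) y : ell r (dil z t y) = (1 - t) * ell r z + t * ell r y.
Proof. by rewrite /ell /dil; move: (nu r) => n /=; ring. Qed.

Lemma continuous_ell r : continuous (@ell R p r).
Proof. by move=> y; apply: (Ck_continuous (Ck_ell openT 0 r)). Qed.

(** A step of size [s] against the inward normal lowers [ell r] by [s * grad_norm r ^+ 2], so a zero
    of [ell r] has points outside the polygon arbitrarily close to it. *)
Lemma interior_gt0 y r : Po y -> 0 < ell r y.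
Proof.
move=> Iy; have Py : P y by exact: interior_subset Iy.
rewrite lt_neqAle Py andbT; apply/eqP => ry0.
have [n nE] : exists n : R * R, n = nu r by eexists.
have cg : line y (- n.1, - n.2) s @[s --> (0 : R)] --> y.
  rewrite [X in _ --> X](_ : y = line y (- n.1, - n.2) 0); last first.
    by rewrite /line /= !mul0r !addr0 -surjective_pairing.
  have c1 (a b : R) : (a + s * b) @[s --> (0 : R)] --> a + 0 * b.
    by apply: cvgD; [exact: cvg_cst|apply: cvgM; [exact: cvg_id|exact: cvg_cst]].
  exact: (cvg_pair (c1 _ _) (c1 _ _)).
have := cg _ Iy; rewrite /= => /nbhs_ballP[e /= e0 He].
have : P (line y (- n.1, - n.2) (e / 2)).
  by apply: He; rewrite /ball /= sub0r normrN gtr0_norm ?divr_gt0// ltr_pdivrMr// ltr_pMr// ltr1n.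
move=> /(_ r); rewrite /ell /line -nE /=.
have := grad_norm_sqr r; have := grad_norm_gt0 nu0 r; rewrite -nE => N0 NE.
have N2 : 0 < grad_norm r ^+ 2 by rewrite exprn_gt0.
have E : ell r y = n.1 * y.1 + n.2 * y.2 + offset r by rewrite nE.
have e20 : 0 < e / 2 * grad_norm r ^+ 2 by rewrite mulr_gt0// divr_gt0.
rewrite (_ : _ + _ + _ = ell r y - e / 2 * grad_norm r ^+ 2); last by rewrite E NE; ring.
by rewrite -ry0 sub0r oppr_ge0 leNgt e20.
Qed.

Lemma gt0_interior y : (forall r, 0 < ell r y) -> Po y.
Proof.
move=> H.
have Hr r : nbhs y [set z | 0 < ell r z].
  exact: (@cvgr_gt _ _ _ _ _ (ell r y) (@continuous_ell r y) 0 (H r)).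
have Hn := @filter_forall _ _ (fun r => [set z | 0 < ell r z]) (nbhs y) _ Hr.
apply: (@filterS _ _ (nbhs_filter y) _ _ _ (Hn (nbhs_filter y))) => z Hz r; apply: ltW; exact: Hz.
Qed.

Lemma interior_dil z (t : R) y : Po z -> P y -> 0 <= t < 1 -> Po (dil z t y).
Proof.
move=> Iz Py /andP[t0 t1]; apply: gt0_interior => r; rewrite ell_dil.
by rewrite ltr_wpDr// ?mulr_ge0// mulr_gt0// ?subr_gt0// interior_gt0.
Qed.

Lemma region_dil z (t : R) y : P z -> P y -> 0 <= t <= 1 -> P (dil z t y).
Proof.
move=> Pz Py /andP[t0 t1] r; rewrite ell_dil.
by rewrite addr_ge0// mulr_ge0// subr_ge0.
Qed.

Lemma dil1 z y : dil z 1 y = y.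
Proof. by rewrite /dil [RHS]surjective_pairing; congr pair; ring. Qed.

(** Each point [x] has a neighbourhood and a range of [t] that work together; compactness, in the
    form of near coverings, makes the range of [t] uniform. *)
Lemma near_dil z (g : R * R -> R) : P z -> {within P, continuous g} ->
  forall e : R, 0 < e -> \forall t \near (1 : R), forall x, P x -> 0 <= t <= 1 -> `|g (dil z t x) - g x| <= e.
Proof.
move=> Pz /subspace_continuousP cg e e0.
have := (compact_near_coveringP P).1 cP R (nbhs (1 : R))
  (fun t x => P x -> 0 <= t <= 1 -> `|g (dil z t x) - g x| <= e) _.
have H x : P x -> \forall x' \near x & t \near (1 : R), P x' -> 0 <= t <= 1 -> `|g (dil z t x') - g x'| <= e.
  move=> Px.
  have e2 : 0 < e / 2 by rewrite divr_gt0.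
  have near_x : \forall x' \near x, P x' -> `|g x - g x'| < e / 2.
    have := cg x Px (ball (g x) (e / 2)) (nbhsx_ballx _ _ e2).
    by rewrite /= /within /=.
  have cd : dil z w.2 w.1 @[w --> (x, 1 : R)] --> x.
    rewrite -[X in _ --> X](dil1 z x).
    have c1 : w.1 @[w --> (x, (1 : R))] --> x by exact: cvg_fst.
    have c2 : w.2 @[w --> (x, (1 : R))] --> (1 : R) by exact: cvg_snd.
    have c11 : (w.1).1 @[w --> (x, (1 : R))] --> x.1 by apply: (cvg_comp _ _ c1); exact: cvg_fst.
    have c12 : (w.1).2 @[w --> (x, (1 : R))] --> x.2 by apply: (cvg_comp _ _ c1); exact: cvg_snd.
    have d1 : (z.1 + w.2 * (w.1.1 - z.1)) @[w --> (x, (1 : R))] --> z.1 + 1 * (x.1 - z.1).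
      by apply: cvgD; [exact: cvg_cst|apply: cvgM => //; apply: cvgB => //; exact: cvg_cst].
    have d2 : (z.2 + w.2 * (w.1.2 - z.2)) @[w --> (x, (1 : R))] --> z.2 + 1 * (x.2 - z.2).
      by apply: cvgD; [exact: cvg_cst|apply: cvgM => //; apply: cvgB => //; exact: cvg_cst].
    exact: (cvg_pair d1 d2).
  have near_d := cd _ near_x.
  have near_1 : \forall w \near (x, (1 : R)), P w.1 -> `|g x - g w.1| < e / 2.
    exact: (@cvg_fst _ _ (nbhs x) (nbhs (1 : R)) _ _ near_x).
  have : \forall w \near (x, (1 : R)), P w.1 -> 0 <= w.2 <= 1 -> `|g (dil z w.2 w.1) - g w.1| <= e.
    apply: (@filterS2 _ _ (nbhs_filter ((x, 1) : (R * R) * R)) _ _ _ _ near_d near_1) => -[x' t] /= h1 h2 Px' t01.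
    have {}h1 := h1 (region_dil Pz Px' t01); have {}h2 := h2 Px'.
    rewrite -[X in `|X|](subrKA (g x)) (le_trans (ler_normD _ _))//.
    by rewrite distrC [leRHS]splitr lerD// ltW.
  by [].
move=> /(_ _ H); apply: filterS => t /= Ht x Px; exact: (Ht x Px Px).
Qed.

End Geometry.

(** * Convex functions and positive matrices *)

Section Convex.
Variable R : realType.

(** After multiplication by [a] the trace is the form evaluated at [(a, b)] plus the determinant
    times [h11], and symmetrically with [c]. The coefficient [h] stands for the sum of the two mixed
    second derivatives, the only combination that a symmetric matrix pairs with. *)
Lemma trace_psd_ge0 (a b c h00 h h11 : R) :
  0 < a -> 0 < c -> 0 < a * c - b ^+ 2 ->
  (forall v0 v1, 0 <= h00 * v0 ^+ 2 + h * v0 * v1 + h11 * v1 ^+ 2) ->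
  0 <= a * h00 + b * h + c * h11 /\
  (a * h00 + b * h + c * h11 = 0 -> [/\ h00 = 0, h = 0 & h11 = 0]).
Proof.
move=> a0 c0 D0 H.
have ha : 0 <= h00 by have := H 1 0; rewrite !expr2; lra.
have hc : 0 <= h11 by have := H 0 1; rewrite !expr2; lra.
have E1 : a * (a * h00 + b * h + c * h11) =
  (h00 * a ^+ 2 + h * a * b + h11 * b ^+ 2) + (a * c - b ^+ 2) * h11 by ring.
have E2 : c * (a * h00 + b * h + c * h11) =
  (h00 * b ^+ 2 + h * b * c + h11 * c ^+ 2) + (a * c - b ^+ 2) * h00 by ring.
have p1 : 0 <= (a * c - b ^+ 2) * h11 by rewrite mulr_ge0// ltW.
have p2 : 0 <= (a * c - b ^+ 2) * h00 by rewrite mulr_ge0// ltW.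
split; first by rewrite -(pmulr_rge0 _ a0) E1 addr_ge0.
move=> E0; rewrite E0 mulr0 in E1 E2.
have z1 : (a * c - b ^+ 2) * h11 = 0 by apply/le_anti; rewrite p1 andbT; have := H a b; lra.
have z2 : (a * c - b ^+ 2) * h00 = 0 by apply/le_anti; rewrite p2 andbT; have := H b c; lra.
have D1 : a * c - b ^+ 2 != 0 by rewrite gt_eqF.
have h110 : h11 = 0 by move/eqP: z1; rewrite mulf_eq0 (negbTE D1) => /eqP.
have h000 : h00 = 0 by move/eqP: z2; rewrite mulf_eq0 (negbTE D1) => /eqP.
split => //; rewrite h110 h000 in H.
by apply/le_anti; have := H 1 1; have := H 1 (-1); rewrite !expr2; lra.
Qed.

(* The symmetric difference quotient [g s + g (- s) - 2 g 0] would be negative for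
   small [s] if the second derivative were. *)
Lemma midpoint_derive2_ge0 (g dg : R -> R) (c e : R) : 0 < e ->
  (forall s : R, `|s| < e -> is_derive s 1 g (dg s)) -> is_derive (0 : R) 1 dg c ->
  (forall s : R, `|s| < e -> 2 * g 0 <= g s + g (- s)) -> 0 <= c.
Proof.
move=> e0 dgs [ddg Edg] gmid; rewrite leNgt; apply/negP => c0.
have : h^-1 *: (dg (h + 0) - dg 0) @[h --> (0 : R)^'] --> c.
  have := ddg; rewrite /derivable => /cvg_ex[l Hl].
  have : l = c.
    rewrite -Edg /derive; apply/esym/cvg_lim; first exact: Rhausdorff.
    exact: Hl.
  move=> <-; move: Hl; apply: cvg_trans; apply: near_eq_cvg; near=> h.
  by rewrite /= /GRing.scale /= mulr1.
move=> /cvgr_lt /(_ 0 c0) /nbhs_ballP[d /= d0 Hd].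
have Hneg (h : R) : h != 0 -> `|h| < d -> h^-1 * (dg h - dg 0) < 0.
  move=> h0 hd; have := Hd h; rewrite /ball /= sub0r normrN => /(_ hd h0).
  by rewrite addr0.
pose s := Num.min d e / 2.
have m0 : 0 < Num.min d e by rewrite lt_min d0.
have s0 : 0 < s by rewrite divr_gt0.
have sm : s < Num.min d e by rewrite ltr_pdivrMr// ltr_pMr// ltr1n.
have [sd se] : s < d /\ s < e by move: sm; rewrite lt_min => /andP.
pose psi t := g t + g (- t).
have dpsi (t : R) : `|t| < e -> is_derive t 1 psi (dg t - dg (- t)).
  move=> te; rewrite /psi.
  have H1 := dgs t te.
  have H2 : is_derive (- t) 1 g (dg (- t)) by apply: dgs; rewrite normrN.
  have H3 : is_derive t 1 (fun t => g (- t)) (dg (- t) * -1).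
    exact: (@is_derive1_comp _ g -%R t (dg (- t)) (-1)).
  by apply: is_derive_eq; rewrite mulrN1.
have [||xi xi0s E] := @MVT R psi (fun t => dg t - dg (- t)) 0 s s0.
- move=> x; rewrite in_itv /= => /andP[x0 xs]; apply: dpsi.
  by rewrite gtr0_norm// (lt_trans xs).
- apply/continuous_in_subspaceT => x; rewrite inE /= in_itv /= => /andP[x0 xs].
  apply: differentiable_continuous; apply/derivable1_diffP.
  have [] := dpsi x _; last by [].
  by rewrite ger0_norm// (le_lt_trans xs).
move: xi0s; rewrite in_itv /= => /andP[x0 xs].
have n1 : dg xi - dg 0 < 0.
  have := Hneg xi; rewrite gt_eqF// gtr0_norm// (lt_trans xs sd) => /(_ isT isT).
  by rewrite pmulr_rlt0 ?invr_gt0.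
have n2 : 0 < dg (- xi) - dg 0.
  have := Hneg (- xi); rewrite oppr_eq0 gt_eqF// normrN gtr0_norm// (lt_trans xs sd) => /(_ isT isT).
  by rewrite invrN mulNr oppr_lt0 pmulr_rgt0 ?invr_gt0.
have : psi s - psi 0 < 0 by rewrite E nmulr_rlt0 ?subr_gt0//; lra.
have : 2 * g 0 <= psi s by apply: gmid; rewrite gtr0_norm.
by rewrite /psi oppr0; lra.
Unshelve. all: by end_near. Qed.

End Convex.

Lemma Rintegral_dist d (T : measurableType d) (R : realType)
    (nu : {measure set T -> \bar R}) (A : set T) (f g : T -> R) (e : R) :
  measurable A -> (nu A < +oo)%E -> nu.-integrable A (EFin \o f) ->
  nu.-integrable A (EFin \o g) -> (forall x, A x -> `|f x - g x| <= e) ->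
  `|\int[nu]_(x in A) f x - \int[nu]_(x in A) g x| <= e * fine (nu A).
Proof.
move=> mA nuA intf intg H.
have fge x : A x -> f x <= g x + e /\ g x <= f x + e.
  by move=> /H; rewrite ler_norml => /andP[h1 h2]; split; lra.
have inte : nu.-integrable A (EFin \o (fun=> e)).
  by apply: measurable_bounded_integrable => //; exists `|e|; split => [|x xe y _]; rewrite ?num_real//= ltW.
have intD h : nu.-integrable A (EFin \o h) -> nu.-integrable A (EFin \o (fun x => h x + e)).
  by move=> ih; rewrite (_ : _ \o _ = (EFin \o h) \+ (EFin \o (fun=> e))); [exact: integrableD|].
have h1 : \int[nu]_(x in A) f x <= \int[nu]_(x in A) (g x + e).
  by apply: le_Rintegral => //; [exact: intD|move=> x /fge[]].
have h2 : \int[nu]_(x in A) g x <= \int[nu]_(x in A) (f x + e).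
  by apply: le_Rintegral => //; [exact: intD|move=> x /fge[]].
rewrite RintegralD// Rintegral_cst// in h1; rewrite RintegralD// Rintegral_cst// in h2.
by rewrite ler_norml; apply/andP; split; lra.
Qed.

Lemma hessian_form (R : comRingType) (a b c d v0 v1 : R) :
  v0 * (v0 * a + v1 * c) + v1 * (v0 * b + v1 * d) =
  a * v0 ^+ 2 + (b + c) * v0 * v1 + d * v1 ^+ 2.
Proof. by ring. Qed.

(** The lower bound 1/2 keeps the factor [t ^+ 2] of a dilated Hessian away from 0 in
    [futaki_gt0]. *)
Lemma near1_ex (R : realType) (Q : R -> Prop) : (\forall t \near (1 : R), Q t) ->
  exists t : R, [/\ 2^-1 <= t, t < 1 & Q t].
Proof.
move=> /nbhs_ballP[d /= d0 Hd].
have m0 : 0 < Num.min d 1 by rewrite lt_min d0 ltr01.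
have [md m1] : Num.min d 1 <= d /\ Num.min d 1 <= 1 by rewrite !ge_min !lexx orbT.
exists (1 - Num.min d 1 / 2); split; [lra|lra|].
by apply: Hd; rewrite /ball /= opprB addrC subrK gtr0_norm ?divr_gt0//; lra.
Qed.

Section Positivity.
Variables (R : realType) (p : polygon R).
Notation P := (region p).
Notation Po := (interior (region p)).
Implicit Types (r s : 'I_(nsides p)) (y z v : R * R).
Hypothesis cP : compact P.
Hypothesis nu0 : forall r, nu r != (0, 0) :> R * R.
Variable y0 : R * R.
Hypothesis Iy0 : Po y0.

Let PoP y : Po y -> P y. Proof. exact: interior_subset. Qed.

(** The dilates of a point of the polygon about [y0] are interior and tend to that point, so closed
    conditions pass from the interior to the boundary. *)
Lemma density_ge0 (g : R * R -> R) : {within P, continuous g} ->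
  (forall y, Po y -> 0 <= g y) -> forall y, P y -> 0 <= g y.
Proof.
move=> cg g0 y Py; apply/ler_addgt0Pr => e e0.
have [t [t0 t1 Ht]] := near1_ex (near_dil cP (PoP Iy0) cg e0).
have t01 : 0 <= t <= 1 by lra.
have := Ht y Py t01; have := g0 _ (interior_dil nu0 Iy0 Py (_ : 0 <= t < 1)).
rewrite ler_norml => /(_ _)/[swap] /andP[h1 h2] => /(_ _).
have t01' : 0 <= t < 1 by lra.
by move=> /(_ t01'); lra.
Qed.

Lemma density_eq (g : R * R -> R) c : {within P, continuous g} ->
  (forall y, Po y -> g y = c) -> forall y, P y -> g y = c.
Proof.
move=> cg gc y Py; have t01' : 0 <= (2^-1 : R) < 1 by lra.
apply/eqP; rewrite eq_sym -subr_eq0 -normr_le0; apply/ler_addgt0Pr => e e0; rewrite add0r.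
have [t [t0 t1 Ht]] := near1_ex (near_dil cP (PoP Iy0) cg e0).
have t01 : 0 <= t <= 1 by lra.
have t02 : 0 <= t < 1 by lra.
by have := Ht y Py t01; rewrite gc//; exact: interior_dil.
Qed.

Lemma line_interior y v : Po y ->
  exists2 e : R, 0 < e & forall s : R, `|s| < e -> Po (line y v s).
Proof.
move=> Iy.
have cg : line y v s @[s --> (0 : R)] --> line y v 0.
  have c1 (a b : R) : (a + s * b) @[s --> (0 : R)] --> a + 0 * b.
    by apply: cvgD; [exact: cvg_cst|apply: cvgM; [exact: cvg_id|exact: cvg_cst]].
  exact: (cvg_pair (c1 _ _) (c1 _ _)).
rewrite (_ : line y v 0 = y) in cg; last first.
  by rewrite /line !mul0r !addr0 -surjective_pairing.
have nPo : nbhs y Po by apply: open_nbhs_nbhs; split => //; exact: open_interior.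
have := cg _ nPo; rewrite /= => /nbhs_ballP[e /= e0 He].
by exists e => // s se; apply: He; rewrite /ball /= sub0r normrN.
Qed.

Section Convexity.
Variable f : R * R -> R.
Hypothesis convf : convex_function P f.
Hypothesis smf : smooth_on Po f.

Lemma convex_midpoint y z : P y -> P z ->
  2 * f ((y.1 + z.1) / 2, (y.2 + z.2) / 2) <= f y + f z.
Proof.
move=> Py Pz.
have : f (2^-1 * y.1 + (1 - 2^-1) * z.1, 2^-1 * y.2 + (1 - 2^-1) * z.2)
    <= 2^-1 * f y + (1 - 2^-1) * f z.
  have h0 : 0 <= (2^-1 : R) by rewrite invr_ge0.
  have h1 : (2^-1 : R) <= 1 by lra.
  exact: (convf (Itv01 h0 h1) (mem_set Py) (mem_set Pz)).
rewrite (_ : (_, _) = ((y.1 + z.1) / 2, (y.2 + z.2) / 2)); first lra.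
by congr pair; field.
Qed.

(** On a short segment through [y] in the direction [(v0, v1)], midpoint convexity bounds the second
    derivative from below, and that derivative is the Hessian form. *)
Lemma convex_hessian y : Po y -> forall v0 v1 : R, 0 <= partial ord0 (partial ord0 f) y * v0 ^+ 2
  + (partial ord0 (partial i1 f) y + partial i1 (partial ord0 f) y) * v0 * v1
  + partial i1 (partial i1 f) y * v1 ^+ 2.
Proof.
move=> Iy v0 v1; pose v := (v0, v1).
have [e e0 He] := line_interior v Iy.
have Cf : Ck 1 Po f by exact: smooth_on_Ck.
have l0 : line y v 0 = y by rewrite /line !mul0r !addr0 -surjective_pairing.
have H2 := @is_derive_line2 _ f y v 0 Po Cf.
rewrite l0 in H2.
have gmid (s : R) : `|s| < e -> 2 * f (line y v 0) <= f (line y v s) + f (line y v (- s)).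
  move=> se; have se' : `|- s| < e by rewrite normrN.
  have := convex_midpoint (PoP (He s se)) (PoP (He (- s) se')).
  rewrite (_ : (_, _) = line y v 0) //.
  by rewrite l0 [RHS]surjective_pairing; congr pair; rewrite /line /=; field.
rewrite -hessian_form.
exact: (midpoint_derive2_ge0 e0 (fun (s : R) se => is_derive_line (Ck_diff Cf (He s se))) (H2 Iy) gmid).
Qed.

End Convexity.
End Positivity.

(** * Positivity of the boundary functional *)

Lemma dilation_form (R : comRingType) (t a b c d A B C D : R) :
  a * (t * (t * A)) + b * (t * (t * B)) + (c * (t * (t * C)) + d * (t * (t * D)))
  = t ^+ 2 * (a * A + b * B + (c * C + d * D)).
Proof. by ring. Qed.

Section Functional.
Variables (R : realType) (p : polygon R).
Notation mu := (@lebesgue_measure R).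
Notation RR := (measurableTypeR R * measurableTypeR R)%type.
Notation mu2 := (@lebesgue_measure R \x @lebesgue_measure R)%E.
Notation P := (region p).
Notation Po := (interior (region p)).
Implicit Types (r s : 'I_(nsides p)) (y z : R * R).
Hypothesis cP : compact P.
Hypothesis nu0 : forall r, nu r != (0, 0) :> R * R.

(** The Donaldson-Futaki functional of toric geometry, with the constant left free. *)
Definition futaki (C : R) (F : R * R -> R) : R :=
  boundary_integral p F - \int[mu2]_(y in P) (C * F y).

Lemma integrableZ_CkP (C : R) (F : R * R -> R) : {within P, continuous F} ->
  mu2.-integrable (P : set RR) (EFin \o (fun y => C * F y)).
Proof.
move=> cF; rewrite (_ : _ \o _ = fun y => (C%:E * (F y)%:E)%E)//.
by apply: integrableZl; [exact: compact_measurable2|exact: within_integrable2].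
Qed.

(** Continuity in the sup norm, which lets uniform approximation by dilates reach functions without
    derivatives at the boundary. [K] is the total boundary mass plus [|C|] times the area. *)
Lemma futaki_dist C : exists2 K, 0 <= K & forall (F G : R * R -> R) (e : R), 0 <= e ->
  {within P, continuous F} -> {within P, continuous G} ->
  (forall y, P y -> `|F y - G y| <= e) -> `|futaki C F - futaki C G| <= K * e.
Proof.
pose Kb := \sum_(r : 'I_(nsides p)) (grad_norm r)^-1 * fine (mu [set t | P (line_param r t)]).
pose Ki := `|C| * fine (mu2 P).
have fi0 (nuA : \bar R) : (0 <= nuA)%E -> 0 <= fine nuA by exact: fine_ge0.
exists (Kb + Ki) => [|F G e e0 cF cG FG].
  by rewrite addr_ge0 ?sumr_ge0// ?mulr_ge0 ?fi0// => r _; rewrite mulr_ge0 ?fi0// invr_ge0 ltW// grad_norm_gt0.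
have -> : futaki C F - futaki C G = (boundary_integral p F - boundary_integral p G)
    - (\int[mu2]_(y in P) (C * F y) - \int[mu2]_(y in P) (C * G y)).
  by rewrite /futaki; ring.
rewrite mulrDl; apply: (le_trans (ler_normB _ _)); apply: lerD.
  rewrite /boundary_integral -sumrB mulr_suml; apply: (le_trans (ler_norm_sum _ _ _)).
  apply: ler_sum => r _; rewrite -mulrBr normrM gtr0_norm; last by rewrite invr_gt0 grad_norm_gt0.
  rewrite -mulrA ler_wpM2l//; first by rewrite invr_ge0 ltW// grad_norm_gt0.
  rewrite mulrC; apply: Rintegral_dist.
  - exact: measurable_boundary.
  - apply: compact_finite_measure; apply: (compact_curve_preimage cP).
      exact: continuous_line_param.
    exact: bounded_line_param.
  - exact: integrable_boundary.
  - exact: integrable_boundary.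
  - by move=> t Pt; exact: FG.
rewrite /Ki mulrAC; apply: Rintegral_dist.
- exact: compact_measurable2.
- exact: compact_finite2.
- exact: integrableZ_CkP.
- exact: integrableZ_CkP.
- by move=> y Py; rewrite -mulrBr normrM ler_wpM2l//; exact: FG.
Qed.

Lemma eq_futaki C (F G : R * R -> R) : (forall y, P y -> F y = G y) -> futaki C F = futaki C G.
Proof.
move=> FG; rewrite /futaki /boundary_integral; congr (_ - _).
  apply: eq_bigr => r _; congr (_ * _); apply: eq_Rintegral => t; rewrite inE /= => Pt.
  exact: FG.
by apply: eq_Rintegral => y; rewrite inE => Py; rewrite FG.
Qed.

(** The matrix and the point of the Hessian are separate because, for a dilated function, [m] is
    taken at [y] and the Hessian of [f] at [dil z t y]. *)
Definition pairing (M : 'M[R]_2) (f : R * R -> R) z : R :=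
  (M ord0 ord0 * partial ord0 (partial ord0 f) z + M ord0 i1 * partial ord0 (partial i1 f) z)
  + (M i1 ord0 * partial i1 (partial ord0 f) z + M i1 i1 * partial i1 (partial i1 f) z).

Lemma partial_dil (V : set (R * R)) f z (t : R) y a b : open V -> Ck 1 V f -> V (dil z t y) ->
  partial a (partial b (fun x => f (dil z t x))) y = t * (t * partial a (partial b f) (dil z t y)).
Proof.
move=> oV Cf Vy.
have oU : open (dil z t @^-1` V) by apply: open_comp => // x _; exact: continuous_dil.
have db : differentiable (partial b f) (dil z t y) by apply: Ck_diff (Ck_partial b Cf) Vy.
have [dd Hd] := diff_dil db.
have dm : differentiable (fun x => t * partial b f (dil z t x)) y.
  by apply: diffM'; [exact: differentiable_cst|exact: dd].
rewrite (@eq_partial _ (dil z t @^-1` V) a _ (fun x => t * partial b f (dil z t x)) y oU Vy); last 2 first.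
- by move=> x Vx; have [_ ->] := diff_dil (Ck_diff Cf Vx).
- by apply: (Ck_diff (n := 0)) Vy; apply: Ck_partial; exact: (Ck_dil _ _ oV Cf).
rewrite partialM; [|exact: differentiable_cst|exact: dd].
by rewrite Hd partial_cst mulr0 addr0.
Qed.

Lemma hcontract_dil (m : R * R -> 'M[R]_2) (V : set (R * R)) f z (t : R) y :
  open V -> Ck 1 V f -> V (dil z t y) ->
  hcontract m (fun x => f (dil z t x)) y = t ^+ 2 * pairing (m y) f (dil z t y).
Proof.
move=> oV Cf Vy; have E a b := partial_dil a b oV Cf Vy.
apply: etrans (hcontractE m _ y) _; apply: etrans (dilation_form t _ _ _ _ _ _ _ _).
exact: (congr2 +%R (congr2 +%R (congr1 _ (E ord0 ord0)) (congr1 _ (E ord0 i1)))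
  (congr2 +%R (congr1 _ (E i1 ord0)) (congr1 _ (E i1 i1)))).
Qed.

End Functional.

Lemma pairing_form (R : comRingType) (a b c A B C D : R) :
  a * A + b * B + (b * C + c * D) = a * A + b * (B + C) + c * D.
Proof. by ring. Qed.

Section Donaldson.
Variables (R : realType) (p : polygon R).
Notation mu := (@lebesgue_measure R).
Notation RR := (measurableTypeR R * measurableTypeR R)%type.
Notation mu2 := (@lebesgue_measure R \x @lebesgue_measure R)%E.
Notation P := (region p).
Notation Po := (interior (region p)).
Implicit Types (r s : 'I_(nsides p)) (y z : R * R).
Notation cross r s := ((nu r).1 * (nu s).2 - (nu r).2 * (nu s).1).
Hypothesis cP : compact P.
Hypothesis nu0 : forall r, nu r != (0, 0) :> R * R.
Hypothesis crossP : forall r s y, r != s -> side r y -> side s y -> cross r s != 0.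
Variable y0 : R * R.
Hypothesis Iy0 : Po y0.

Variables (U : set (R * R)) (m : R * R -> 'M[R]_2) (C : R).
Hypotheses (oU : open U) (PU : P `<=` U) (Cm : Ck_mx U 2 m).
Hypothesis msym : forall y, (m y)^T = m y.
Hypothesis m0 : forall r y, side r y -> forall b, \sum_(a < 2) coo a (nu r) * m y a b = 0.
Hypothesis m1 : forall r y, side r y ->
  \sum_(a < 2) coo a (nu r) * \sum_(b < 2) partial b (fun z => m z a b) y = 1.
Hypothesis mC : forall y, Po y -> ddiv m y = - C.
Hypothesis mpos : forall y, Po y ->
  [/\ 0 < m y ord0 ord0, 0 < m y i1 i1 & 0 < m y ord0 ord0 * m y i1 i1 - m y ord0 i1 ^+ 2].

Let PoP y : Po y -> P y. Proof. exact: interior_subset. Qed.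
Let oPo : open Po. Proof. exact: open_interior. Qed.

Lemma Ck_hcontract (V : set (R * R)) F : open V -> V `<=` U -> Ck 2 V F -> Ck 0 V (hcontract m F).
Proof.
move=> oV VU CF; apply: (Ck_sum oV) => a _; apply: (Ck_sum oV) => b _.
exact: (CkM oV (CkW (CkW (Ck_sub VU (Cm a b)))) (Ck_partial a (Ck_partial b CF))).
Qed.

Lemma Ck_ddiv : Ck 0 U (ddiv m).
Proof.
apply: (Ck_sum oU) => a _; apply: (Ck_sum oU) => b _.
exact: Ck_partial a (Ck_partial b (Cm a b)).
Qed.

(** The equation is given in the interior only; both sides are continuous on the closed polygon. *)
Lemma ddiv_closure y : P y -> ddiv m y = - C.
Proof. exact: (density_eq cP nu0 Iy0 (within_CkP PU Ck_ddiv) mC). Qed.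

Lemma futakiE (W : set (R * R)) F : open W -> P `<=` W -> Ck 2 W F ->
  futaki p C F = \int[mu2]_(y in P) hcontract m F y.
Proof.
move=> oW PW CF; pose V := U `&` W.
have oV : open V by exact: openI.
have PV : P `<=` V by move=> y Py; split; [exact: PU|exact: PW].
have VU : V `<=` U by move=> y [].
have CFV : Ck 2 V F by apply: Ck_sub CF => y [].
have CmV : Ck_mx V 2 m by move=> a b; exact: Ck_sub (Cm a b).
have icon := integrable_CkP cP PV (Ck_hcontract oV VU CFV).
rewrite /futaki -(green_formula cP nu0 crossP oV PV CmV CFV msym m0 m1).
have -> : \int[mu2]_(y in P) (hcontract m F y - F y * ddiv m y) =
    \int[mu2]_(y in P) (hcontract m F y + C * F y).
  by apply: eq_Rintegral => y; rewrite inE => Py; rewrite ddiv_closure// mulrN opprK mulrC.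
rewrite RintegralD; [|exact: compact_measurable2|exact: icon|apply: (integrableZ_CkP cP); exact: within_CkP PW CF].
by rewrite addrK.
Qed.

Variable f : R * R -> R.
Hypothesis convf : convex_function P f.
Hypothesis contf : {within P, continuous f}.
Hypothesis smf : smooth_on Po f.

Lemma pairing_ge0 y z : Po y -> Po z -> 0 <= pairing (m y) f z /\
  (pairing (m y) f z = 0 -> forall v0 v1 : R,
    v0 * (v0 * partial ord0 (partial ord0 f) z + v1 * partial i1 (partial ord0 f) z)
  + v1 * (v0 * partial ord0 (partial i1 f) z + v1 * partial i1 (partial i1 f) z) = 0).
Proof.
move=> Iy Iz; have [a0 c0 D0] := mpos Iy.
have m10 : m y i1 ord0 = m y ord0 i1 by rewrite -[in LHS](msym y) mxE.
have [H1 H2] := trace_psd_ge0 a0 c0 D0 (convex_hessian convf smf Iz).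
have E : pairing (m y) f z = m y ord0 ord0 * partial ord0 (partial ord0 f) z
  + m y ord0 i1 * (partial ord0 (partial i1 f) z + partial i1 (partial ord0 f) z)
  + m y i1 i1 * partial i1 (partial i1 f) z.
  by rewrite /pairing m10; exact: pairing_form.
rewrite E; split; first exact: H1.
by move=> /H2[h00 h h11] v0 v1; rewrite hessian_form h00 h h11; ring.
Qed.

Let ft z (t : R) y := f (dil z t y).

Lemma open_dil z (t : R) : open (dil z t @^-1` Po).
Proof. by apply: open_comp => // x _; exact: continuous_dil. Qed.

Lemma sub_dil z (t : R) : Po z -> 0 <= t < 1 -> P `<=` dil z t @^-1` Po.
Proof. by move=> Iz t01 y Py; exact: interior_dil. Qed.

(** For [t < 1] the preimage of the interior under the dilation is an open set containing the whole
    polygon, so the dilated function is smooth up to the boundary and Green's formula applies. *)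
Lemma futaki_dil z (t : R) : Po z -> 0 <= t < 1 ->
  futaki p C (ft z t) = \int[mu2]_(y in P) (t ^+ 2 * pairing (m y) f (dil z t y)) /\
  mu2.-integrable (P : set RR) (EFin \o (fun y => t ^+ 2 * pairing (m y) f (dil z t y))).
Proof.
move=> Iz t01.
have Cft : Ck 2 (dil z t @^-1` Po) (ft z t) by apply: Ck_dil => //; exact: smooth_on_Ck.
have E y : P y -> hcontract m (ft z t) y = t ^+ 2 * pairing (m y) f (dil z t y).
  move=> Py; apply: (hcontract_dil m oPo (smooth_on_Ck 1 smf)).
  exact: sub_dil.
split.
  rewrite (futakiE (@open_dil z t) (sub_dil Iz t01) Cft).
  by apply: eq_Rintegral => y; rewrite inE => /E ->.
have oV : open (U `&` dil z t @^-1` Po) by apply: openI => //; exact: open_dil.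
have PV : P `<=` U `&` dil z t @^-1` Po by move=> y Py; split; [exact: PU|exact: sub_dil].
have CV : Ck 2 (U `&` dil z t @^-1` Po) (ft z t) by apply: Ck_sub Cft => y [].
have := integrable_CkP cP PV (Ck_hcontract oV (@subIsetl _ _ _) CV).
by apply: eq_integrable; [exact: compact_measurable2|move=> y; rewrite inE => /E /= ->].
Qed.

(** Positive definiteness of [m] is known inside only, so boundary points are reached by density. *)
Lemma pairing_dil_ge0 z (t : R) y : Po z -> 0 <= t < 1 -> P y ->
  0 <= t ^+ 2 * pairing (m y) f (dil z t y).
Proof.
move=> Iz t01.
pose V := U `&` dil z t @^-1` Po.
have oV : open V by apply: openI => //; exact: open_dil.
have PV : P `<=` V by move=> x Px; split; [exact: PU|exact: sub_dil].
have Cft : Ck 2 V (ft z t).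
  have : Ck 2 (dil z t @^-1` Po) (ft z t) by apply: Ck_dil => //; exact: smooth_on_Ck.
  by apply: Ck_sub => x [].
have E x : P x -> hcontract m (ft z t) x = t ^+ 2 * pairing (m x) f (dil z t x).
  by move=> Px; apply: (hcontract_dil m oPo (smooth_on_Ck 1 smf)); exact: sub_dil.
move=> Py; rewrite -E//; move: y Py.
apply: (density_ge0 cP nu0 Iz (within_CkP PV (Ck_hcontract oV (@subIsetl _ _ _) Cft))).
move=> x Ix; rewrite E; last exact: PoP.
have Id : Po (dil z t x) by apply: sub_dil => //; exact: PoP.
have [h _] := pairing_ge0 Ix Id.
exact: (mulr_ge0 (sqr_ge0 t) h).
Qed.

Lemma within_dil z (t : R) : Po z -> 0 <= t < 1 -> {within P, continuous (ft z t)}.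
Proof.
move=> Iz t01; have Cft : Ck 0 (dil z t @^-1` Po) (ft z t) by apply: Ck_dil => //; exact: smooth_on_Ck.
exact: within_CkP (sub_dil Iz t01) Cft.
Qed.

Lemma futaki_approx z (e : R) : Po z -> 0 < e -> exists t : R,
  [/\ 2^-1 <= t, t < 1 & `|futaki p C (ft z t) - futaki p C f| <= e].
Proof.
move=> Iz e0; have [K K0 HK] := futaki_dist cP nu0 C.
have K1 : 0 < K + 1 by rewrite ltr_wpDl.
have e1 : 0 < e / (K + 1) by rewrite divr_gt0.
have [t [t0 t1 Ht]] := near1_ex (near_dil cP (PoP Iz) contf e1).
exists t; split => //.
have t01 : 0 <= t < 1 by lra.
have t01' : 0 <= t <= 1 by lra.
apply: (le_trans (HK _ _ _ (ltW e1) (within_dil Iz t01) contf (fun y Py => Ht y Py t01'))).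
by rewrite mulrA ler_pdivrMr// mulrDr mulr1 [K * e]mulrC lerDl ltW.
Qed.

Lemma futaki_ge0 : 0 <= futaki p C f.
Proof.
apply/ler_addgt0Pr => e e0; have [t [t0 t1]] := futaki_approx Iy0 e0.
have t01 : 0 <= t < 1 by lra.
have h0 : 0 <= futaki p C (ft y0 t).
  have [-> _] := futaki_dil Iy0 t01.
  by apply: Rintegral_ge0 => y Py; exact: pairing_dil_ge0.
move: h0; move: (futaki p C f) (futaki p C (ft y0 t)) => A B B0.
by rewrite ler_norml => /andP[h1 h2]; lra.
Qed.

Lemma pairing_near z c : Po z -> c < pairing (m z) f z -> exists2 rho : R, 0 < rho &
  forall y x, ball z rho y -> ball z rho x -> P y /\ c < pairing (m y) f x.
Proof.
move=> Iz cz.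
have cont : pairing (m w.1) f w.2 @[w --> (z, z)] --> pairing (m z) f z.
  have cm a b : m w.1 a b @[w --> (z, z)] --> m z a b.
    apply: (@cvg_comp _ _ _ fst (fun y => m y a b) _ (nbhs z)); first exact: cvg_fst.
    exact: Ck_continuous (Cm a b) (PU (PoP Iz)).
  have cf a b : partial a (partial b f) w.2 @[w --> (z, z)] --> partial a (partial b f) z.
    apply: (@cvg_comp _ _ _ snd (partial a (partial b f)) _ (nbhs z)); first exact: cvg_snd.
    exact: Ck_continuous (Ck_partial a (Ck_partial b (smooth_on_Ck 2 smf))) Iz.
  by apply: cvgD; apply: cvgD; apply: cvgM.
have Hn : nbhs ((z, z) : (R * R) * (R * R)) [set w | c < pairing (m w.1) f w.2].
  exact: (@cvgr_gt _ _ _ _ _ _ cont _ cz).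
have [r1 /= r10 H1] := (nbhs_ballP _ _).1 Hn.
have [r2 /= r20 H2] := (nbhs_ballP _ _).1 (Iz : nbhs z P).
exists (Num.min r1 r2); first by rewrite lt_min r10.
have sub1 x : ball z (Num.min r1 r2) x -> ball z r1 x by apply: le_ball; rewrite ge_min lexx.
have sub2 x : ball z (Num.min r1 r2) x -> ball z r2 x by apply: le_ball; rewrite ge_min lexx orbT.
move=> y x yz xz; split; first by apply: H2; exact: sub2.
by apply: (H1 (y, x)); split => /=; exact: sub1.
Qed.

Lemma ball_dil z (rho t : R) y : 0 <= t <= 1 -> ball z rho y -> ball z rho (dil z t y).
Proof.
move=> /andP[t0 t1] [h1 h2]; split; rewrite /ball /= /dil /= in h1 h2 *.
  rewrite opprD addNKr normrN normrM ger0_norm// distrC.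
  by apply: le_lt_trans h1; rewrite ler_piMl.
rewrite opprD addNKr normrN normrM ger0_norm// distrC.
by apply: le_lt_trans h2; rewrite ler_piMl.
Qed.

(** By joint continuity the pairing stays above [c / 2] when both of its points are in a fixed ball
    around [z]. Dilations centred at [z] preserve that ball, so the lower bound [k] does not depend
    on [t] and survives the limit. *)
Lemma futaki_gt0 z : Po z -> 0 < pairing (m z) f z -> 0 < futaki p C f.
Proof.
move=> Iz; move Ec : (pairing (m z) f z) => c c0.
have cc : c / 2 < pairing (m z) f z by rewrite Ec ltr_pdivrMr// ltr_pMr// ltr1n.
(* The factor 1/4 is the lower bound of [t ^+ 2] for [t >= 1/2]; the ball is a square of side
   [2 * rho] because of the max norm. *)
have c8 : c / 8 = 4^-1 * (c / 2) by field.
have [rho rho0 H] := pairing_near Iz cc.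
pose B : set RR := ball z.1 rho `*` ball z.2 rho.
have Bz y : B y -> ball z rho y by [].
have mB : measurable B.
  by apply: measurableX; apply: open_measurable; exact: ball_open.
have BP : B `<=` P by move=> y /Bz By; have [] := H y y By By.
have muB : mu2 B = (rho *+ 2 * (rho *+ 2))%:E.
  rewrite [LHS](_ : _ = (mu (ball z.1 rho) * mu (ball z.2 rho))%E); last first.
    by apply: product_measure1E; apply: open_measurable; exact: ball_open.
  by rewrite !lebesgue_measure_ball ?ltW.
pose k := c / 8 * (rho *+ 2 * (rho *+ 2)).
have k0 : 0 < k by rewrite /k !mulr_gt0 ?divr_gt0 ?pmulrn_lgt0.
have main (t : R) : 2^-1 <= t -> t < 1 -> k <= futaki p C (ft z t).
  move=> t0 t1; have t01 : 0 <= t < 1 by lra.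
  have t01' : 0 <= t <= 1 by lra.
  have [-> ig] := futaki_dil Iz t01.
  have t2 : 4^-1 <= t ^+ 2.
    have := ler_pM (_ : 0 <= 2^-1 :> R) (_ : 0 <= 2^-1 :> R) t0 t0; rewrite -expr2.
    by rewrite !invr_ge0 !ler0n => /(_ isT isT); lra.
  rewrite -lee_fin fineK; last by apply: integrable_fin_num => //; exact: compact_measurable2.
  rewrite /k EFinM -muB -integral_cst//.
  apply: (@le_trans _ _ (\int[mu2]_(y in B) (t ^+ 2 * pairing (m y) f (dil z t y))%:E)%E).
    apply: ge0_le_integral => //.
    - by move=> y By; rewrite lee_fin divr_ge0// ltW.
    - have /integrableP[mg _] := ig.
      by apply: measurable_funS mg => //; exact: compact_measurable2.
    - move=> y By; rewrite lee_fin.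
      have [_ Hc] := H y (dil z t y) (Bz _ By) (ball_dil t01' (Bz _ By)).
      rewrite c8; apply: ler_pM; [by rewrite invr_ge0|by rewrite divr_ge0// ltW|exact: t2|exact: ltW].
  apply: ge0_subset_integral => //.
  - exact: compact_measurable2.
  - by have /integrableP[] := ig.
  - by move=> y Py; rewrite lee_fin; exact: pairing_dil_ge0.
(* An error of [k / 2] still leaves at least [k / 2]. *)
have [t [t0 t1]] := futaki_approx Iz (ltac:(lra) : 0 < k / 2).
move: (main t t0 t1); move: (futaki p C f) (futaki p C (ft z t)) => A1 A2 h.
by rewrite ler_norml => /andP[h1 h2]; lra.
Qed.

(** Vanishing forces the Hessian form of [f] to be zero at every interior point. Along the segment
    from [y0], two applications of the mean value theorem then give the first-order Taylor
    polynomial at [y0]. *)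
Lemma futaki_eq0_affine : futaki p C f = 0 -> affine_on P f.
Proof.
move=> L0.
have flat z : Po z -> forall v0 v1 : R,
    v0 * (v0 * partial ord0 (partial ord0 f) z + v1 * partial i1 (partial ord0 f) z)
  + v1 * (v0 * partial ord0 (partial i1 f) z + v1 * partial i1 (partial i1 f) z) = 0.
  move=> Iz; have [h0 h1] := pairing_ge0 Iz Iz; apply: h1.
  apply/eqP; rewrite eq_le h0 andbT leNgt; apply/negP => h2.
  by have := futaki_gt0 Iz h2; rewrite L0 ltxx.
exists ((partial ord0 f y0, partial i1 f y0),
  f y0 - partial ord0 f y0 * y0.1 - partial i1 f y0 * y0.2) => y Py /=.
pose v := (y.1 - y0.1, y.2 - y0.2).
have lineE (s : R) : line y0 v s = dil y0 s y by [].
have l1 : line y0 v 1 = y by rewrite lineE dil1.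
have l0 : line y0 v 0 = y0 by rewrite /line !mul0r !addr0 -surjective_pairing.
have Cf : Ck 1 Po f by exact: smooth_on_Ck.
have Il (s : R) : 0 <= s < 1 -> Po (line y0 v s) by move=> s01; rewrite lineE; exact: interior_dil.
pose dg (s : R) := v.1 * partial ord0 f (line y0 v s) + v.2 * partial i1 f (line y0 v s).
have D1 (s : R) : 0 <= s < 1 -> is_derive s 1 (fun s : R => f (line y0 v s)) (dg s).
  by move=> s01; apply: is_derive_line; exact: (Ck_diff Cf (Il s s01)).
have D2 (s : R) : 0 <= s < 1 -> is_derive s 1 dg 0.
  move=> s01; have H := @is_derive_line2 _ f y0 v s Po Cf (Il s s01).
  by rewrite flat in H; [exact: H|exact: Il].
have cl : continuous (line y0 v).
  move=> s; have c1 (a b : R) : (a + x * b) @[x --> s] --> a + s * b.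
    by apply: cvgD; [exact: cvg_cst|apply: cvgM; [exact: cvg_id|exact: cvg_cst]].
  exact: (cvg_pair (c1 _ _) (c1 _ _)).
(* [y] may lie on the boundary, where [f] is only continuous; the mean value theorem uses the
   derivative on the open interval alone. *)
have w01 : {within `[(0 : R), 1], continuous (fun s : R => f (line y0 v s))}.
  apply: continuous_subspaceW (within_curve cl contf) => s; rewrite /= in_itv /= => s01.
  by rewrite lineE; apply: (region_dil (PoP Iy0) Py).
have D1' (s : R) : s \in `]0, 1[ -> is_derive s 1 (fun s : R => f (line y0 v s)) (dg s).
  by rewrite in_itv /= => /andP[s0 s1]; apply: D1; rewrite ltW.
have [c c01 Ec] := MVT ltr01 D1' w01.
have [c0 c1] : 0 < c /\ c < 1 by move: c01; rewrite in_itv /= => /andP.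
have D2' (s : R) : s \in `]0, c[ -> is_derive s 1 dg 0.
  by rewrite in_itv /= => /andP[s0 s1]; apply: D2; rewrite ltW//= (lt_trans s1).
have w0c : {within `[0, c], continuous dg}.
  apply/continuous_in_subspaceT => s; rewrite inE /= in_itv /= => /andP[s0 s1].
  apply: differentiable_continuous; apply/derivable1_diffP.
  have [] // := D2 s _.
  by rewrite s0 (le_lt_trans s1).
have [e _ Ed] := MVT (df := fun=> 0) c0 D2' w0c.
move: Ec; rewrite l1 l0; rewrite subr0 mulr1 => Ec.
rewrite mul0r in Ed; move/eqP: Ed; rewrite subr_eq0 => /eqP Ed.
move: Ec; rewrite Ed /dg l0 /v /= => Ec.
move: Ec; move: (f y) (f y0) (partial ord0 f y0) (partial i1 f y0) => A1 A2 B1 B2 /eqP.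
by rewrite subr_eq => /eqP ->; ring.
Qed.

Lemma affine_futaki_eq0 : affine_on P f -> futaki p C f = 0.
Proof.
move=> [[[a b] c] /= fE].
pose F (y : R * R) := a * y.1 + b * y.2 + c.
have CF n : Ck n setT F.
  apply: (CkD openT); last exact: Ck_cst.
  by apply: (CkD openT); apply: (CkM openT); [exact: Ck_cst|exact: Ck_fst|exact: Ck_cst|exact: Ck_snd].
rewrite (eq_futaki C (G := F)); last by move=> y Py; exact: fE.
rewrite (futakiE openT (@subsetT _ _) (CF 2)).
have pF e : partial e F = fun=> a * (basis_vec R e).1 + b * (basis_vec R e).2.
  apply/funext => y.
  have [df _] := diff_fst y; have [ds _] := diff_snd y.
  have da : differentiable (fun y : R * R => a * y.1) y by apply: diffM' => //; exact: differentiable_cst.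
  have db : differentiable (fun y : R * R => b * y.2) y by apply: diffM' => //; exact: differentiable_cst.
  rewrite /F partialD; [|by apply: diffD'|exact: differentiable_cst].
  rewrite partialD; [|exact: da|exact: db].
  rewrite partialM; [|exact: differentiable_cst|exact: df].
  rewrite partialM; [|exact: differentiable_cst|exact: ds].
  by rewrite !partial_cst partial_fst partial_snd !mulr0 !addr0.
rewrite (_ : \int[mu2]_(y in P) hcontract m F y = \int[mu2]_(y in P) (0 : R)).
  by rewrite Rintegral_cst ?mul0r//; exact: compact_measurable2.
apply: eq_Rintegral => y _; rewrite /hcontract big1 // => d _; rewrite big1 // => e _.
by rewrite pF partial_cst mulr0.
Qed.

Theorem futaki_positive :
  0 <= futaki p C f /\ (futaki p C f = 0 <-> affine_on P f).
Proof.
split; first exact: futaki_ge0.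
by split; [exact: futaki_eq0_affine|exact: affine_futaki_eq0].
Qed.

End Donaldson.

(** * Two by two matrices and their square roots *)

Section Mx2.
Variable F : comRingType.
Implicit Types A B : 'M[F]_2.

Lemma ord2P (i : 'I_2) : i = ord0 \/ i = i1.
Proof. by case: (unliftP ord0 i) => [j ->|->]; [right; rewrite (ord1 j)|left]. Qed.

Lemma mx2P A B : A ord0 ord0 = B ord0 ord0 -> A ord0 i1 = B ord0 i1 ->
  A i1 ord0 = B i1 ord0 -> A i1 i1 = B i1 i1 -> A = B.
Proof. by move=> h00 h01 h10 h11; apply/matrixP => i j; case: (ord2P i) => ->; case: (ord2P j) => ->. Qed.

Lemma mulmx2 A B i j : (A *m B) i j = A i ord0 * B ord0 j + A i i1 * B i1 j.
Proof. by rewrite mxE !big_ord_recl big_ord0 addr0. Qed.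

Lemma det2 A : \det A = A ord0 ord0 * A i1 i1 - A ord0 i1 * A i1 ord0.
Proof.
rewrite (expand_det_row _ ord0) !big_ord_recl big_ord0 addr0 /cofactor !det_mx11 !mxE /=.
rewrite !addn0 expr0 mul1r /= expr1 mulN1r mulrN.
by congr (A ord0 ord0 * A _ _ - A ord0 i1 * A _ _); apply/val_inj.
Qed.

Lemma tr2 A : \tr A = A ord0 ord0 + A i1 i1.
Proof. by rewrite /mxtrace !big_ord_recl big_ord0 addr0. Qed.

Lemma add2E A B i j : (A + B) i j = A i j + B i j. Proof. by rewrite mxE. Qed.
Lemma opp2E A i j : (- A) i j = - A i j. Proof. by rewrite mxE. Qed.
Lemma scale2E (c : F) A i j : (c *: A) i j = c * A i j. Proof. by rewrite mxE. Qed.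
Definition entry2E := (add2E, opp2E, scale2E, mulmx2).

Lemma scalar2 (c : F) : [/\ (c%:M : 'M[F]_2) ord0 ord0 = c, (c%:M : 'M[F]_2) ord0 i1 = 0,
  (c%:M : 'M[F]_2) i1 ord0 = 0 & (c%:M : 'M[F]_2) i1 i1 = c].
Proof. by split; rewrite mxE. Qed.

Lemma cayley_hamilton2 A : A *m A = \tr A *: A - (\det A)%:M.
Proof.
have [s00 s01 s10 s11] := scalar2 (\det A).
by apply: mx2P; rewrite !entry2E ?s00 ?s01 ?s10 ?s11 tr2 ?det2; ring.
Qed.

Definition sym2 (a b c : F) : 'M[F]_2 :=
  \matrix_(i, j) if i == ord0 then (if j == ord0 then a else b) else (if j == ord0 then b else c).

Lemma sym2E a b c : [/\ sym2 a b c ord0 ord0 = a, sym2 a b c ord0 i1 = b,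
  sym2 a b c i1 ord0 = b & sym2 a b c i1 i1 = c].
Proof. by split; rewrite mxE. Qed.

Lemma sym2_tr a b c : (sym2 a b c)^T = sym2 a b c.
Proof. by apply: mx2P; rewrite !mxE. Qed.

Lemma sym2P A : A^T = A -> A = sym2 (A ord0 ord0) (A ord0 i1) (A i1 i1).
Proof.
move=> sA; have [h00 h01 h10 h11] := sym2E (A ord0 ord0) (A ord0 i1) (A i1 i1).
by apply: mx2P; rewrite ?h00 ?h01 ?h10 ?h11// -[in LHS]sA mxE.
Qed.

(* With [K = G A G A G + G B G B G] the real part of [G Phi G conj(Phi) G], these
   are the two invariants that decide the positivity of [c G - K]. *)
Lemma mix_det (g0 g1 g2 s0 s1 s2 c : F) (G := sym2 g0 g1 g2) (S := sym2 s0 s1 s2) :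
  \det (c *: G - G *m S *m G) =
  \det G * (c ^+ 2 - c * \tr (G *m S) + \det G * \det S).
Proof.
have [e0 e1 e2 e3] := sym2E g0 g1 g2; have [f0 f1 f2 f3] := sym2E s0 s1 s2.
by rewrite !det2 tr2 !entry2E /G /S ?e0 ?e1 ?e2 ?e3 ?f0 ?f1 ?f2 ?f3; ring.
Qed.

Lemma mix_tr (g0 g1 g2 s0 s1 s2 c : F) (G := sym2 g0 g1 g2) (S := sym2 s0 s1 s2)
    (W := c *: G - G *m S *m G) :
  W ord0 ord0 * g2 - 2 * W ord0 i1 * g1 + W i1 i1 * g0 = \det G * (2 * c - \tr (G *m S)).
Proof.
have [e0 e1 e2 e3] := sym2E g0 g1 g2; have [f0 f1 f2 f3] := sym2E s0 s1 s2.
by rewrite /W det2 tr2 !entry2E /G /S ?e0 ?e1 ?e2 ?e3 ?f0 ?f1 ?f2 ?f3; ring.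
Qed.

(** Take the determinant of the Hermitian matrix [(A + iB) G (A - iB)]. Its real part is the matrix
    on the left, its imaginary part [B G A - A G B] is antisymmetric, and the sum of two squares is
    the squared modulus of [det (A + iB)]. *)
Lemma det_re (g0 g1 g2 a0 a1 a2 b0 b1 b2 : F)
    (G := sym2 g0 g1 g2) (A := sym2 a0 a1 a2) (B := sym2 b0 b1 b2) :
  \det (A *m G *m A + B *m G *m B) =
  \det G * ((a0 * a2 - b0 * b2 - (a1 ^+ 2 - b1 ^+ 2)) ^+ 2
           + (a0 * b2 + b0 * a2 - 2 * a1 * b1) ^+ 2)
  + (B *m G *m A - A *m G *m B) ord0 i1 ^+ 2.
Proof.
have [e0 e1 e2 e3] := sym2E g0 g1 g2; have [f0 f1 f2 f3] := sym2E a0 a1 a2.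
have [h0 h1 h2 h3] := sym2E b0 b1 b2.
rewrite !det2 !entry2E /G /A /B ?e0 ?e1 ?e2 ?e3 ?f0 ?f1 ?f2 ?f3 ?h0 ?h1 ?h2 ?h3; ring.
Qed.

End Mx2.

Lemma eigenvalue2 (F : fieldType) (A : 'M[F]_2) z :
  eigenvalue A z = (z ^+ 2 - \tr A * z + \det A == 0).
Proof.
rewrite /eigenvalue /eigenspace kermx_eq0 row_free_unit unitmxE unitfE negbK.
congr (_ == 0); rewrite !det2 tr2 !entry2E; have [-> -> -> ->] := scalar2 z; ring.
Qed.

Section Sqrt.
Variable R : realType.
Local Notation "x %:C" := (real_complex R x).

Lemma eigenvalues2 (A : 'M[R[i]]_2) : exists z1 z2,
  [/\ z1 + z2 = \tr A, z1 * z2 = \det A, eigenvalue A z1 & eigenvalue A z2].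
Proof.
(* The coefficients of the characteristic equation in the form [x ^+ 2 = - det A + tr A * x]. *)
pose P (n : nat) : R[i] := if n == 0%N then - \det A else \tr A.
have [x xE] := @solve_monicpoly _ 2 P isT.
rewrite !big_ord_recl big_ord0 /P /= expr0 expr1 mulr1 addr0 in xE.
exists x, (\tr A - x); split.
- by rewrite addrC subrK.
- by rewrite mulrBr -expr2 xE; ring.
- by rewrite eigenvalue2 xE; apply/eqP; ring.
- by rewrite eigenvalue2 sqrrB xE; apply/eqP; rewrite !expr2; ring.
Qed.

Lemma ltC1 (z : R[i]) : z < 1 -> exists2 x : R, z = x%:C & x < 1.
Proof. by case: z => a b; rewrite ltcE /= => /andP[/eqP <- ?]; exists a. Qed.

(** The two quantities are the determinant and the trace of [1 - X], that is the product and the sum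
    of the positive numbers [1 - x1] and [1 - x2]; the order on [R[i]] makes the eigenvalues
    real. *)
Lemma eigenvalues_lt1_real (X : 'M[R[i]]_2) (T q : R) :
  \tr X = T%:C -> \det X = q%:C -> (forall z, eigenvalue X z -> z < 1) ->
  0 < 1 - T + q /\ 0 < 2 - T.
Proof.
move=> trX detX H; have [z1 [z2 [zD zM e1 e2]]] := eigenvalues2 X.
have [x1 z1E x11] := ltC1 (H _ e1); have [x2 z2E x21] := ltC1 (H _ e2).
rewrite z1E z2E trX -rmorphD in zD; rewrite z1E z2E detX -rmorphM in zM.
have TE : x1 + x2 = T by case: zD.
have qE : x1 * x2 = q by case: zM => ->.
rewrite -TE -qE; split; last lra.
by rewrite (_ : _ + _ = (1 - x1) * (1 - x2)); [rewrite mulr_gt0// subr_gt0|ring].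
Qed.

Lemma sqr_gt0_re (z : R[i]) : 0 < complex.Re z -> 0 < z ^+ 2 -> exists2 x : R, z = x%:C & 0 < x.
Proof.
case: z => a b /= a0; rewrite expr2 ltcE /= => /andP[/eqP E _].
have /eqP : 2 * a * b = 0 by rewrite -[RHS]E; ring.
rewrite mulf_eq0 mulf_eq0 pnatr_eq0 /= gt_eqF//= => /eqP ->.
by exists a.
Qed.

Lemma eigenvalue_sqr (S : 'M[R[i]]_2) z : eigenvalue S z -> eigenvalue (S *m S) (z ^+ 2).
Proof.
move=> /eigenvalueP[v vS v0]; apply/eigenvalueP; exists v => //.
by rewrite mulmxA vS -scalemxAl vS scalerA expr2.
Qed.

(* A 2x2 matrix with positive eigenvalues has a unique principal square root,
   given by Cayley-Hamilton: [S = (S ^ 2 + det S) / tr S]. *)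
Lemma mx_sqrtE (X : 'M[R[i]]_2) (T q d tau : R) :
  \tr X = T%:C -> \det X = q%:C -> (forall z, eigenvalue X z -> z < 1) ->
  0 < d -> d ^+ 2 = 1 - T + q -> 0 < tau -> tau ^+ 2 = 2 - T + 2 * d ->
  mx_sqrt (1%:M - X) = (tau^-1)%:C *: (1%:M - X + (d%:C)%:M).
Proof.
move=> trX detX HX d0 dE tau0 tauE; set Y := 1%:M - X.
have tau_neq0 : tau%:C != 0 by rewrite eq_complex /= negb_and gt_eqF.
have tV : (tau^-1)%:C = (tau%:C)^-1 by rewrite fmorphV.
have [u00 u01 u10 u11] := scalar2 (1 : R[i]).
have trY : \tr Y = (2 - T)%:C.
  by rewrite /Y mxtraceD raddfN /= trX mxtrace1 rmorphB rmorph_nat.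
have detY : \det Y = (1 - T + q)%:C.
  rewrite (_ : (1 - T + q)%:C = 1 - \tr X + \det X); last first.
    by rewrite trX detX rmorphD rmorphB rmorph1.
  rewrite /Y !det2 tr2 !entry2E u00 u01 u10 u11; ring.
have eigY z : eigenvalue Y z -> 0 < z.
  move=> /eigenvalueP[v vY v0].
  have /HX : eigenvalue X (1 - z).
    apply/eigenvalueP; exists v => //.
    by move: vY; rewrite /Y mulmxBr mulmx1 scalerBl scale1r => <-; rewrite opprB addrC subrK.
  by rewrite ltrBlDr ltrDl.
clearbody Y; set S0 := _ *: _.
have S0sq : S0 *m S0 = Y.
  rewrite /S0 -scalemxAl -scalemxAr scalerA mulmxDl !mulmxDr -scalar_mxM !mul_scalar_mx mul_mx_scalar.
  rewrite (_ : Y *m Y + _ + _ = (tau%:C ^+ 2) *: Y); last first.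
    have -> : tau%:C ^+ 2 = (2 - T)%:C + 2 * d%:C.
      by rewrite -rmorphXn /= tauE rmorphD rmorphM rmorph_nat.
    rewrite cayley_hamilton2 trY detY -dE rmorphXn /=.
    have [v00 v01 v10 v11] := scalar2 (d%:C ^+ 2).
    have [w00 w01 w10 w11] := scalar2 (d%:C * d%:C).
    by apply: mx2P; rewrite !entry2E ?v00 ?v01 ?v10 ?v11 ?w00 ?w01 ?w10 ?w11; ring.
  by rewrite scalerA tV -invfM -expr2 mulVf ?scale1r// expf_neq0.
have S0eig z : eigenvalue S0 z -> 0 < complex.Re z.
  move=> /eigenvalueP[v vS v0].
  have /eigY : eigenvalue Y (tau%:C * z - d%:C).
    apply/eigenvalueP; exists v => //.
    rewrite scalerBl -scalerA -vS /S0 -scalemxAr scalerA tV mulfV// scale1r.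
    by rewrite mulmxDr mul_mx_scalar addrK.
  by case: (z) => a b; rewrite ltcE /= => /andP[_]; rewrite mul0r subr0 subr_gt0 => /(lt_trans d0); rewrite pmulr_rgt0.
(* Any admissible root [S] has positive real eigenvalues, since their squares are positive
   eigenvalues of [Y]. This fixes [det S = d] and [tr S = tau], and Cayley-Hamilton leaves only
   [S0]. *)
rewrite /mx_sqrt; case: xgetP => [S _ [SY Seig]|/(_ S0)]; last by case.
have [z1 [z2 [zD zM e1 e2]]] := eigenvalues2 S.
have zpos z : eigenvalue S z -> exists2 x : R, z = x%:C & 0 < x.
  move=> ez; have ezz := eigenvalue_sqr ez; rewrite SY in ezz.
  exact: (sqr_gt0_re (Seig z ez) (eigY _ ezz)).
have [x1 z1E x10] := zpos _ e1; have [x2 z2E x20] := zpos _ e2.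
rewrite z1E z2E -rmorphD in zD; rewrite z1E z2E -rmorphM in zM.
have detS : x1 * x2 = d.
  have : \det S * \det S = \det Y by rewrite -det_mulmx SY.
  rewrite -zM detY -rmorphM -dE => /complexI.
  by rewrite -expr2 => /eqP; rewrite eqrXn2 ?mulr_ge0 ?ltW// => /eqP.
have trS : x1 + x2 = tau.
  have : \tr Y = \tr S * \tr S - 2 * \det S.
    rewrite -SY cayley_hamilton2 mxtraceD raddfN /= mxtraceZ mxtrace_scalar.
    by rewrite mulr_natl.
  rewrite trY -zM -zD -rmorphM -(rmorph_nat (real_complex R)) -rmorphM -rmorphB => /complexI.
  rewrite detS => E.
  have /eqP : (x1 + x2) ^+ 2 = tau ^+ 2 by rewrite tauE expr2; lra.
  by rewrite eqrXn2 ?addr_ge0 ?ltW// => /eqP.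
have := cayley_hamilton2 S; rewrite SY -zM -zD detS trS; rewrite /S0 => ->.
by rewrite subrK scalerA tV mulVf// scale1r.
Qed.

End Sqrt.

(** * Real and imaginary parts, and positivity of the real part *)

Section ComplexMx.
Variable R : realType.
Local Notation "x %:C" := (real_complex R x).
Implicit Types (M N G A B : 'M[R]_2).

Definition cx M N : 'M[R[i]]_2 := \matrix_(i, j) Complex (M i j) (N i j).

Lemma cxE M N i j : cx M N i j = Complex (M i j) (N i j).
Proof. by rewrite mxE. Qed.

Lemma cx_re_im (P : 'M[R[i]]_2) :
  P = cx (map_mx (@complex.Re R) P) (map_mx (@complex.Im R) P).
Proof. by apply/matrixP => i j; rewrite !mxE; case: (P i j). Qed.

Lemma cx0 M : cplx_mx M = cx M 0.
Proof. by apply/matrixP => i j; rewrite !mxE. Qed.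

Lemma conj_cx M N : conj_mx (cx M N) = cx M (- N).
Proof. by apply/matrixP => i j; rewrite !mxE. Qed.

Lemma cxM M N M' N' : cx M N *m cx M' N' = cx (M *m M' - N *m N') (M *m N' + N *m M').
Proof.
by apply/matrixP => i j; rewrite mulmx2 !cxE !entry2E; apply/eqP; rewrite eq_complex /=;
  apply/andP; split; apply/eqP; ring.
Qed.

Lemma tr_cx M N : \tr (cx M N) = Complex (\tr M) (\tr N).
Proof. by rewrite !tr2 !cxE. Qed.

(** For symmetric [Phi = A + iB], [qmx] is the real part of [Phi G conj(Phi)], and [qdet] is the
    squared modulus of [det (G Phi)]. *)
Definition qmx A B G := A *m G *m A + B *m G *m B.
Definition qdet A B G := \det G ^+ 2 *
  ((A ord0 ord0 * A i1 i1 - B ord0 ord0 * B i1 i1 - (A ord0 i1 ^+ 2 - B ord0 i1 ^+ 2)) ^+ 2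
  + (A ord0 ord0 * B i1 i1 + B ord0 ord0 * A i1 i1 - 2 * A ord0 i1 * B ord0 i1) ^+ 2).

Lemma xi_mxE G A B :
  cplx_mx G *m cx A B *m cplx_mx G *m conj_mx (cx A B) =
  cx (G *m qmx A B G) (G *m B *m G *m A - G *m A *m G *m B).
Proof.
rewrite cx0 conj_cx !cxM !(mul0mx, mulmx0, subr0, addr0, add0r).
by rewrite !mulmxN opprK /qmx mulmxDr !mulmxA [- _ + _]addrC.
Qed.

(** The imaginary part is the difference of the traces of [G B G A] and [G A G B], which agree by
    cyclicity. *)
Lemma tr_xi G A B :
  \tr (cplx_mx G *m cx A B *m cplx_mx G *m conj_mx (cx A B)) = (\tr (G *m qmx A B G))%:C.
Proof.
rewrite xi_mxE tr_cx; congr Complex; rewrite mxtraceD raddfN /=.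
by rewrite -[G *m B *m G *m A]mulmxA mxtrace_mulC !mulmxA subrr.
Qed.

Lemma det_xi G A B : A^T = A -> B^T = B ->
  \det (cplx_mx G *m cx A B *m cplx_mx G *m conj_mx (cx A B)) = (qdet A B G)%:C.
Proof.
move=> sA sB; have A10 : A i1 ord0 = A ord0 i1 by rewrite -[in LHS]sA mxE.
have B10 : B i1 ord0 = B ord0 i1 by rewrite -[in LHS]sB mxE.
rewrite !det_mulmx cx0 conj_cx !det2 !cxE !mxE /qdet det2 A10 B10.
apply/eqP; rewrite eq_complex /=; apply/andP; split; apply/eqP; ring.
Qed.

Lemma re_sqrt_mx G A B (d t : R) :
  map_mx (@complex.Re R) (t%:C *: (1%:M - cplx_mx G *m cx A B *m cplx_mx G *m conj_mx (cx A B)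
     + (d%:C)%:M) *m cplx_mx G)
  = t *: ((1 + d) *: G - G *m qmx A B G *m G).
Proof.
rewrite xi_mxE; set M := G *m qmx A B G; set N := _ - _.
rewrite cx0 -scalemxAl mulmxDl mulmxBl mul1mx mul_scalar_mx cxM.
rewrite !mulmx0 subr0 add0r.
by apply/matrixP => i j; rewrite !mxE /=; ring.
Qed.

(** The sign of its determinant makes [W] definite. The last quantity is [tr (W adj G)], which
    cannot be positive for a negative definite [W]. *)
Lemma posdef_of_det_trace (w0 w1 w2 g0 g1 g2 : R) :
  0 < g0 -> 0 < g2 -> 0 < g0 * g2 - g1 ^+ 2 -> 0 < w0 * w2 - w1 ^+ 2 ->
  0 < w0 * g2 - 2 * w1 * g1 + w2 * g0 -> 0 < w0 /\ 0 < w2.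
Proof.
move=> g00 g20 D0 W0 T0.
have ww : 0 < w0 * w2 by apply: (lt_le_trans W0); rewrite gerBl sqr_ge0.
have [w0p|w0n] := ltrP 0 w0; first by rewrite pmulr_rgt0 in ww.
have {}w0n : w0 < 0.
  by rewrite lt_neqAle w0n andbT; apply: contraTneq ww => ->; rewrite mul0r ltxx.
have w2n : w2 < 0 by rewrite nmulr_rgt0 in ww.
exfalso.
have form v0 v1 : 0 <= g2 * v0 ^+ 2 + (- 2 * g1) * v0 * v1 + g0 * v1 ^+ 2.
  rewrite -(pmulr_rge0 _ g20).
  rewrite [X in 0 <= X](_ : _ = (g2 * v0 - g1 * v1) ^+ 2 + (g0 * g2 - g1 ^+ 2) * v1 ^+ 2); last by ring.
  by rewrite addr_ge0 ?sqr_ge0// mulr_ge0 ?sqr_ge0// ltW.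
have W1 : 0 < (- w0) * (- w2) - (- w1) ^+ 2 by rewrite mulrNN sqrrN.
have w0' : 0 < - w0 by rewrite oppr_gt0.
have w2' : 0 < - w2 by rewrite oppr_gt0.
have [h _] := trace_psd_ge0 w0' w2' W1 form.
move: T0; rewrite ltNge => /negP; apply; lra.
Qed.

Lemma mixed_mx_posdef G A B (d t : R) : G^T = G -> A^T = A -> B^T = B ->
  0 < G ord0 ord0 -> 0 < G i1 i1 -> 0 < \det G -> 0 < d -> 0 < t ->
  d ^+ 2 = 1 - \tr (G *m qmx A B G) + qdet A B G ->
  0 < 2 - \tr (G *m qmx A B G) + 2 * d ->
  let m := t *: ((1 + d) *: G - G *m qmx A B G *m G) in
  [/\ 0 < m ord0 ord0, 0 < m i1 i1 & 0 < m ord0 ord0 * m i1 i1 - m ord0 i1 ^+ 2].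
Proof.
move=> sG sA sB g0 g2 D0 d0 t0 dE tau0 m.
pose S := qmx A B G; have sS : S^T = S.
  by rewrite /S /qmx linearD /= !trmx_mul sA sB sG !mulmxA.
pose W := (1 + d) *: G - G *m S *m G.
have sW : W^T = W by rewrite /W linearB /= linearZ /= !trmx_mul sS sG mulmxA.
have G10 : G i1 ord0 = G ord0 i1 by rewrite -[in LHS]sG mxE.
have W10 : W i1 ord0 = W ord0 i1 by rewrite -[in LHS]sW mxE.
have detW : \det W = \det G * ((1 + d) ^+ 2 - (1 + d) * \tr (G *m S) + \det G * \det S).
  by rewrite /W (sym2P sG) (sym2P sS) mix_det.
have detS : \det G * \det S = qdet A B G + \det G * (B *m G *m A - A *m G *m B) ord0 i1 ^+ 2.
  have := det_re (G ord0 ord0) (G ord0 i1) (G i1 i1) (A ord0 ord0) (A ord0 i1) (A i1 i1)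
    (B ord0 ord0) (B ord0 i1) (B i1 i1).
  by rewrite -(sym2P sG) -(sym2P sA) -(sym2P sB) /S /qmx => ->; rewrite /qdet; ring.
have detW0 : 0 < \det W.
  rewrite detW detS; apply: mulr_gt0 => //.
  set e := (B *m G *m A - A *m G *m B) ord0 i1.
  (* The last bracket vanishes by the equation for [d ^+ 2]; what remains is a positive product plus
     a multiple of a square. *)
  rewrite (_ : _ + _ = d * (2 - \tr (G *m S) + 2 * d) + \det G * e ^+ 2
     + (1 - \tr (G *m S) + qdet A B G - d ^+ 2)); last by ring.
  by rewrite -/S dE -/S subrr addr0 ltr_pwDl// ?mulr_gt0// mulr_ge0 ?sqr_ge0// ltW.
have trW : W ord0 ord0 * G i1 i1 - 2 * W ord0 i1 * G ord0 i1 + W i1 i1 * G ord0 ord0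
    = \det G * (2 - \tr (G *m S) + 2 * d).
  have := mix_tr (G ord0 ord0) (G ord0 i1) (G i1 i1) (S ord0 ord0) (S ord0 i1) (S i1 i1) (1 + d).
  by rewrite -(sym2P sG) -(sym2P sS) -/W => ->; congr (_ * _); ring.
have [w0 w2] : 0 < W ord0 ord0 /\ 0 < W i1 i1.
  apply: (@posdef_of_det_trace _ (W ord0 i1) _ (G ord0 ord0) (G ord0 i1) (G i1 i1)) => //.
  - by move: D0; rewrite det2 G10 -expr2.
  - by move: detW0; rewrite det2 W10 -expr2.
  - by rewrite trW mulr_gt0.
have mE i j : m i j = t * W i j by rewrite /m scale2E.
rewrite !mE; split; [exact: mulr_gt0|exact: mulr_gt0|].
rewrite (_ : _ - _ = t ^+ 2 * \det W); last by rewrite det2 W10; ring.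
by rewrite mulr_gt0// exprn_gt0.
Qed.

End ComplexMx.

(** * The inverse Hessian of a Guillemin potential *)

Section Potential.
Variable R : realType.
Implicit Types (y : R * R).

Lemma partial_sum (I : Type) (r : seq I) (F : I -> R * R -> R) a y :
  (forall i, differentiable (F i) y) ->
  differentiable (fun z => \sum_(i <- r) F i z) y /\
  partial a (fun z => \sum_(i <- r) F i z) y = \sum_(i <- r) partial a (F i) y.
Proof.
move=> dF; elim: r => [|i r [IH1 IH2]].
  rewrite big_nil (_ : (fun z => _) = fun=> 0); last by apply/funext => z; rewrite big_nil.
  by split; [exact: differentiable_cst|exact: partial_cst].
rewrite (_ : (fun z => _) = fun z => F i z + \sum_(j <- r) F j z); last first.
  by apply/funext => z; rewrite big_cons.
split; first by apply: diffD'; [exact: dF|exact: IH1].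
by rewrite big_cons partialD; [rewrite IH2|exact: dF|exact: IH1].
Qed.

Variable p : polygon R.
Notation Po := (interior (region p)).
Implicit Types r s : 'I_(nsides p).

Lemma basis_vecE (a : 'I_2) (v : R * R) :
  v.1 * (basis_vec R a).1 + v.2 * (basis_vec R a).2 = coo a v.
Proof. by rewrite /basis_vec /coo; case: (a == 0) => /=; rewrite !mulr1 !mulr0 ?addr0 ?add0r. Qed.

Lemma diff_ell r y : differentiable (@ell R p r) y.
Proof. exact: Ck_diff (Ck_ell openT 0 r) (I : setT y). Qed.

Lemma partial_ell r a y : partial a (@ell R p r) y = coo a (nu r).
Proof.
have [df _] := diff_fst y; have [ds _] := diff_snd y.
have da : differentiable (fun z : R * R => (nu r).1 * z.1) y.
  by apply: diffM'; [exact: differentiable_cst|exact: df].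
have db : differentiable (fun z : R * R => (nu r).2 * z.2) y.
  by apply: diffM'; [exact: differentiable_cst|exact: ds].
rewrite /ell partialD; [|exact: diffD'|exact: differentiable_cst].
rewrite partialD; [|exact: da|exact: db].
rewrite partialM; [|exact: differentiable_cst|exact: df].
rewrite partialM; [|exact: differentiable_cst|exact: ds].
by rewrite !partial_cst partial_fst partial_snd !mulr0 !addr0 basis_vecE.
Qed.

Variables (u g : R * R -> R) (U : set (R * R)).
Hypotheses (PoU : Po `<=` U) (Cg : Ck 2 U g).
Hypothesis uE : forall y, Po y -> u y = guillemin_potential p y + g y.
Hypothesis ell_gt0 : forall r y, Po y -> 0 < ell r y.

Let oPo : open Po. Proof. exact: open_interior. Qed.

Lemma diff_ln_ell r y : Po y -> differentiable (fun z => ln (ell r z)) y /\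
  forall a, partial a (fun z => ln (ell r z)) y = coo a (nu r) * (ell r y)^-1.
Proof.
move=> Iy; have [d e] := diff_comp1 (diff_ell r y) (is_derive1_ln (ell_gt0 r Iy)).
by split=> [|a]; [exact: d|rewrite e partial_ell].
Qed.

Lemma partial_potential b y : Po y ->
  partial b u y = \sum_(r : 'I_(nsides p)) coo b (nu r) * (ln (ell r y) + 1) + partial b g y.
Proof.
move=> Iy.
have dr r : differentiable (fun z => ell r z * ln (ell r z)) y.
  by apply: diffM'; [exact: diff_ell|have [] := diff_ln_ell r Iy].
have [dS eS] := @partial_sum _ (index_enum _) (fun (r : 'I_(nsides p)) z => ell r z * ln (ell r z)) b y dr.
have dg : differentiable g y by exact: Ck_diff Cg (PoU Iy).
have Heq z : Po z -> guillemin_potential p z + g z = u z by move=> /uE.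
rewrite -(eq_partial b oPo Iy Heq (diffD' dS dg)).
rewrite partialD; [|exact: dS|exact: dg].
congr (_ + _); rewrite eS; apply: eq_bigr => r _.
have [dl el] := diff_ln_ell r Iy.
rewrite partialM; [|exact: diff_ell|exact: dl].
rewrite el partial_ell mulrCA mulfV ?mulr1; last by rewrite gt_eqF// ell_gt0.
by rewrite mulrDr mulr1 addrC mulrC.
Qed.

(** The singular part is a sum of rank-one terms [nu_r^T nu_r / ell_r], the shape treated by [gnum]
    and [gden]. *)
Lemma hessian_potential y a b : Po y ->
  hessian u y a b = \sum_(r : 'I_(nsides p)) coo a (nu r) * coo b (nu r) * (ell r y)^-1 + partial a (partial b g) y.
Proof.
move=> Iy; rewrite mxE.
have dr r : differentiable (fun z => coo b (nu r) * (ln (ell r z) + 1)) y.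
  apply: diffM'; first exact: differentiable_cst.
  by apply: diffD'; [have [] := diff_ln_ell r Iy|exact: differentiable_cst].
have [dS eS] := @partial_sum _ (index_enum _) (fun (r : 'I_(nsides p)) z => coo b (nu r) * (ln (ell r z) + 1)) a y dr.
have dg : differentiable (partial b g) y by exact: Ck_diff (Ck_partial b Cg) (PoU Iy).
have Heq z : Po z -> \sum_(r : 'I_(nsides p)) coo b (nu r) * (ln (ell r z) + 1)
    + partial b g z = partial b u z by move=> /partial_potential ->.
rewrite -(eq_partial a oPo Iy Heq (diffD' dS dg)).
rewrite partialD; [|exact: dS|exact: dg].
congr (_ + _); rewrite eS; apply: eq_bigr => r _.
have [dl el] := diff_ln_ell r Iy.
have dl1 : differentiable (fun z => ln (ell r z) + 1) y.
  by apply: diffD'; [exact: dl|exact: differentiable_cst].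
rewrite partialM; [|exact: differentiable_cst|exact: dl1].
rewrite partialD; [|exact: dl|exact: differentiable_cst].
by rewrite el !partial_cst mulr0 !addr0 mulrA [coo b _ * _]mulrC.
Qed.

End Potential.

(** * Adjugate and determinant with cleared denominators *)

Section GuilleminAlgebra.
Variables (R : realType) (n : nat) (x1 x2 e : 'I_n -> R).
Implicit Types r s t : 'I_n.

Definition cross2 r s := x1 r * x2 s - x2 r * x1 s.
Definition prodD1 r := \prod_(t | t != r) e t.
Definition prodD2 r s := \prod_(t | (t != r) && (t != s)) e t.

(* For [H = \sum_r x_r^T x_r / e r + b] and [L = \prod_r e r] these are [L adj H] and
   [L det H] with the denominators cleared, so that they make sense where some [e r]
   vanishes; the double sum in [gden] comes from Lagrange's identity. *)
Definition gnum (b0 b1 b2 : R) := sym2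
  (\sum_r prodD1 r * x2 r ^+ 2 + (\prod_r e r) * b2)
  (- (\sum_r prodD1 r * (x1 r * x2 r) + (\prod_r e r) * b1))
  (\sum_r prodD1 r * x1 r ^+ 2 + (\prod_r e r) * b0).

Definition gden (b0 b1 b2 : R) :=
  2^-1 * (\sum_r \sum_(s | s != r) cross2 r s ^+ 2 * prodD2 r s)
  + \sum_r prodD1 r * (b2 * x1 r ^+ 2 - 2 * b1 * (x1 r * x2 r) + b0 * x2 r ^+ 2)
  + (\prod_r e r) * (b0 * b2 - b1 ^+ 2).

(** Together with [gside2] this is [x_r gnum] divided by [e r]: in that row the summand of index [r]
    cancels and every other one contains [e r]. *)
Definition gside1 (b0 b1 b2 : R) r :=
  \sum_(s | s != r) prodD2 r s * (cross2 r s * x2 s) + prodD1 r * (b2 * x1 r - b1 * x2 r).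
Definition gside2 (b0 b1 b2 : R) r :=
  - (\sum_(s | s != r) prodD2 r s * (cross2 r s * x1 s)) + prodD1 r * (b0 * x2 r - b1 * x1 r).

Lemma prodD2C r s : prodD2 r s = prodD2 s r.
Proof. by rewrite /prodD2; apply: eq_bigl => t; rewrite andbC. Qed.

Lemma prod_prodD1 r : \prod_t e t = e r * prodD1 r.
Proof. exact: bigD1. Qed.

Lemma prodD1_prodD2 r s : r != s -> prodD1 s = e r * prodD2 r s.
Proof. by move=> rs; rewrite /prodD1 (bigD1 r)// prodD2C. Qed.

Let side_comb (a b S T L X c d q L1 : R) : a * S - b * T = q * X -> L = q * L1 ->
  a * (S + L * c) + b * - (T + L * d) = q * (X + L1 * (c * a - d * b)).
Proof. by move=> /eqP; rewrite subr_eq => /eqP H ->; rewrite mulrDr H; ring. Qed.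

Lemma gnum_side1 b0 b1 b2 r :
  x1 r * gnum b0 b1 b2 ord0 ord0 + x2 r * gnum b0 b1 b2 i1 ord0 = e r * gside1 b0 b1 b2 r.
Proof.
rewrite /gnum; have [-> _ -> _] := sym2E (\sum_r prodD1 r * x2 r ^+ 2 + (\prod_r e r) * b2)
  (- (\sum_r prodD1 r * (x1 r * x2 r) + (\prod_r e r) * b1))
  (\sum_r prodD1 r * x1 r ^+ 2 + (\prod_r e r) * b0).
have -> : gside1 b0 b1 b2 r = \sum_(s | s != r) prodD2 r s * (cross2 r s * x2 s) + prodD1 r * (b2 * x1 r - b1 * x2 r) by [].
have key : x1 r * (\sum_s prodD1 s * x2 s ^+ 2) - x2 r * (\sum_s prodD1 s * (x1 s * x2 s))
  = e r * \sum_(s | s != r) prodD2 r s * (cross2 r s * x2 s).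
  rewrite !mulr_sumr -sumrB (bigD1 r)//= [X in X + _](_ : _ = 0) ?add0r; last by ring.
  by apply: eq_bigr => s sr; rewrite (@prodD1_prodD2 r s) 1?eq_sym// /cross2; ring.
exact: side_comb key (prod_prodD1 r).
Qed.

Lemma gnum_side2 b0 b1 b2 r :
  x1 r * gnum b0 b1 b2 ord0 i1 + x2 r * gnum b0 b1 b2 i1 i1 = e r * gside2 b0 b1 b2 r.
Proof.
rewrite /gnum; have [_ -> _ ->] := sym2E (\sum_r prodD1 r * x2 r ^+ 2 + (\prod_r e r) * b2)
  (- (\sum_r prodD1 r * (x1 r * x2 r) + (\prod_r e r) * b1))
  (\sum_r prodD1 r * x1 r ^+ 2 + (\prod_r e r) * b0).
have -> : gside2 b0 b1 b2 r = - (\sum_(s | s != r) prodD2 r s * (cross2 r s * x1 s)) + prodD1 r * (b0 * x2 r - b1 * x1 r) by [].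
have key : x2 r * (\sum_s prodD1 s * x1 s ^+ 2) - x1 r * (\sum_s prodD1 s * (x1 s * x2 s))
  = e r * - \sum_(s | s != r) prodD2 r s * (cross2 r s * x1 s).
  rewrite -sumrN !mulr_sumr -sumrB (bigD1 r)//= [X in X + _](_ : _ = 0) ?add0r; last by ring.
  by apply: eq_bigr => s sr; rewrite (@prodD1_prodD2 r s) 1?eq_sym// /cross2; ring.
by rewrite addrC; exact: side_comb key (prod_prodD1 r).
Qed.

(** On the side only products omitting [e r] survive. The double sum in [gden] meets each pair
    [{r, s}] twice, which the factor [2^-1] undoes. This identity is the source of the normalisation
    of the normal derivative. *)
Lemma gside_den b0 b1 b2 r : e r = 0 ->
  x1 r * gside1 b0 b1 b2 r + x2 r * gside2 b0 b1 b2 r = gden b0 b1 b2.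
Proof.
move=> er0.
have L0 : \prod_t e t = 0 by rewrite (prod_prodD1 r) er0 mul0r.
have L1 s : s != r -> prodD1 s = 0.
  by move=> sr; rewrite (@prodD1_prodD2 r s) 1?eq_sym// er0 mul0r.
have L2 s t : s != r -> t != r -> prodD2 s t = 0.
  move=> sr tr; rewrite /prodD2 (bigD1 r) /=; first by rewrite er0 mul0r.
  by rewrite ![r == _]eq_sym sr tr.
rewrite /gden L0 mul0r addr0 (bigD1 r)//= [X in _ = _ + X](bigD1 r)//=.
rewrite [X in _ + (_ + X)]big1 ?addr0; last by move=> s /L1 ->; rewrite mul0r.
have -> : \sum_(s | s != r) \sum_(t | t != s) cross2 s t ^+ 2 * prodD2 s t
  = \sum_(s | s != r) cross2 r s ^+ 2 * prodD2 r s.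
  apply: eq_bigr => s sr; rewrite (bigD1 r) 1?eq_sym//= big1 ?addr0; last first.
    by move=> t /andP[_ tr]; rewrite L2// mulr0.
  by rewrite prodD2C /cross2; ring.
set S := \sum_(s | _) _.
have -> : S = x1 r * (\sum_(s | s != r) prodD2 r s * (cross2 r s * x2 s))
   - x2 r * (\sum_(s | s != r) prodD2 r s * (cross2 r s * x1 s)).
  by rewrite !mulr_sumr -sumrB; apply: eq_bigr => s _; rewrite /cross2; ring.
by rewrite /gside1 /gside2; field.
Qed.

Hypothesis e0 : forall r, e r != 0.
Variables b0 b1 b2 : R.
Let h0 := \sum_r x1 r ^+ 2 / e r + b0.
Let h1 := \sum_r x1 r * x2 r / e r + b1.
Let h2 := \sum_r x2 r ^+ 2 / e r + b2.

Let prodD1E r : prodD1 r = (\prod_t e t) / e r.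
Proof. by rewrite (prod_prodD1 r) mulrAC mulfV ?mul1r. Qed.

Lemma gnumE : gnum b0 b1 b2 = (\prod_r e r) *: sym2 h2 (- h1) h0.
Proof.
have key (F : 'I_n -> R) b : \sum_r prodD1 r * F r + (\prod_r e r) * b
    = (\prod_r e r) * (\sum_r F r / e r + b).
  rewrite mulrDr mulr_sumr; congr (_ + _).
  by apply: eq_bigr => r _; rewrite prodD1E mulrAC mulrA.
rewrite /gnum !key -/h0 -/h1 -/h2; apply/matrixP => i j; rewrite !mxE.
by case: ifP => _; case: ifP => _; rewrite ?mulrN.
Qed.

Lemma gdenE : gden b0 b1 b2 = (\prod_r e r) * (h0 * h2 - h1 ^+ 2).
Proof.
set L := \prod_r e r.
pose A := \sum_r x1 r ^+ 2 / e r; pose B := \sum_r x2 r ^+ 2 / e r.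
pose C := \sum_r x1 r * x2 r / e r.
have q1 : \sum_r prodD1 r * (b2 * x1 r ^+ 2 - 2 * b1 * (x1 r * x2 r) + b0 * x2 r ^+ 2)
  = L * (b2 * A - 2 * b1 * C + b0 * B).
  rewrite /A /B /C !mulr_sumr -sumrB -big_split /= mulr_sumr; apply: eq_bigr => r _.
  by rewrite prodD1E -/L; ring.
have q2 : \sum_r \sum_(s | s != r) cross2 r s ^+ 2 * prodD2 r s = L * (2 * (A * B - C ^+ 2)).
  (* Doubling symmetrises the expression, so that its three double sums combine termwise into
     [cross2 r s ^+ 2], with zero diagonal. *)
  have -> : 2 * (A * B - C ^+ 2) = A * B - 2 * (C * C) + B * A by ring.
  rewrite /A /B /C !big_distrlr /= mulr_sumr -sumrB -big_split /= mulr_sumr.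
  apply: eq_bigr => r _.
  rewrite mulr_sumr -sumrB -big_split /= mulr_sumr.
  rewrite [in RHS](bigD1 r)//= [X in _ = X + _](_ : _ = 0) ?add0r; last by ring.
  apply: eq_bigr => s sr.
  have -> : prodD2 r s = L / e r / e s.
    rewrite -prodD1E (@prodD1_prodD2 s r)// prodD2C mulrAC mulfV ?mul1r//.
  by rewrite /cross2; ring.
by rewrite /gden q1 q2 -/L /h0 /h1 /h2 -/A -/B -/C; field.
Qed.

End GuilleminAlgebra.

Section InverseHessian.
Variable R : realType.
Implicit Types (U : set (R * R)) (y z : R * R).

Lemma open_Ck_gt0 n U (f : R * R -> R) : open U -> Ck n U f ->
  open [set z | U z /\ 0 < f z].
Proof.
move=> oU Cf; rewrite openE => y [Uy fy]; rewrite /interior.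
have h1 : \forall z \near y, U z by exact: open_nbhs_nbhs.
have h2 : \forall z \near y, 0 < f z.
  have cf : {for y, continuous f} by exact: Ck_continuous Cf Uy.
  exact: (cvgr_gt _ cf).
exact: (@filterS2 _ _ (nbhs_filter y) _ _ _ _ h1 h2).
Qed.

Lemma posdef_diag_gt0 (A : 'M[R]_2) i : posdef A -> 0 < A i i.
Proof.
move=> [_ posA]; have := posA (delta_mx 0 i); rewrite -rowE trmx_delta -colE.
rewrite !mxE; apply; apply/eqP => /matrixP/(_ 0 i); rewrite !mxE !eqxx => /eqP.
by rewrite oner_eq0.
Qed.

Variable p : polygon R.
Notation P := (region p).
Notation Po := (interior (region p)).
Implicit Types r s : 'I_(nsides p).
Hypothesis cP : compact P.
Hypothesis nu0 : forall r, nu r != (0, 0) :> R * R.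
Variable y0 : R * R.
Hypothesis Iy0 : Po y0.
Let PoP y : Po y -> P y. Proof. exact: interior_subset. Qed.

Lemma coo0 (v : R * R) : coo ord0 v = v.1. Proof. by []. Qed.
Lemma coo1 (v : R * R) : coo i1 v = v.2. Proof. by []. Qed.

Section Smoothness.
Variables (U : set (R * R)) (n : nat) (b0 b1 b2 : R * R -> R).
Hypotheses (oU : open U) (C0 : Ck n U b0) (C1 : Ck n U b1) (C2 : Ck n U b2).
Let x1 r := (@nu R p r).1.
Let x2 r := (@nu R p r).2.
Let e z r := @ell R p r z.

Let Cl r : Ck n U (fun z => e z r). Proof. exact: Ck_ell. Qed.
Let CL : Ck n U (fun z => \prod_r e z r).
Proof. by apply: (Ck_prod oU) => r _; exact: Cl. Qed.
Let CL1 r : Ck n U (fun z => prodD1 (e z) r).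
Proof. by apply: (Ck_prod oU) => t _; exact: Cl. Qed.
Let CL2 r s : Ck n U (fun z => prodD2 (e z) r s).
Proof. by apply: (Ck_prod oU) => t _; exact: Cl. Qed.
Let Cc (c : R) : Ck n U (fun=> c). Proof. exact: Ck_cst. Qed.

Lemma Ck_gden : Ck n U (fun z => gden x1 x2 (e z) (b0 z) (b1 z) (b2 z)).
Proof.
apply: (CkD oU); first apply: (CkD oU).
- apply: (CkM oU (Cc _)); apply: (Ck_sum oU) => r _; apply: (Ck_sum oU) => s _.
  exact: (CkM oU (Cc _) (CL2 r s)).
- apply: (Ck_sum oU) => r _; apply: (CkM oU (CL1 r)).
  apply: (CkD oU (CkB oU (CkM oU C2 (Cc _)) (CkM oU (CkM oU (Cc _) C1) (Cc _)))).
  exact (CkM oU C0 (Cc _)).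
- exact (CkM oU CL (CkB oU (CkM oU C0 C2) (CkM oU C1 C1))).
Qed.

Lemma Ck_gnum : Ck_mx U n (fun z => gnum x1 x2 (e z) (b0 z) (b1 z) (b2 z)).
Proof.
have S (F : 'I_(nsides p) -> R) (b : R * R -> R) : Ck n U b ->
    Ck n U (fun z => \sum_r prodD1 (e z) r * F r + (\prod_r e z r) * b z).
  move=> Cb; apply: (CkD oU); last exact (CkM oU CL Cb).
  by apply: (Ck_sum oU) => r _; exact (CkM oU (CL1 r) (Cc _)).
have D0 := S (fun r => x2 r ^+ 2) _ C2; have D2 := S (fun r => x1 r ^+ 2) _ C0.
have D1 := CkN oU (S (fun r => x1 r * x2 r) _ C1).
move=> i j; case: (ord2P i) => ->; case: (ord2P j) => ->.
- by apply: eq_Ck oU _ D0 => z _; rewrite mxE.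
- by apply: eq_Ck oU _ D1 => z _; rewrite mxE.
- by apply: eq_Ck oU _ D1 => z _; rewrite mxE.
- by apply: eq_Ck oU _ D2 => z _; rewrite mxE.
Qed.

Lemma Ck_gside1 r : Ck n U (fun z => gside1 x1 x2 (e z) (b0 z) (b1 z) (b2 z) r).
Proof.
apply: (CkD oU).
  by apply: (Ck_sum oU) => s _; exact (CkM oU (CL2 r s) (Cc _)).
by apply: (CkM oU (CL1 r)); exact (CkB oU (CkM oU C2 (Cc _)) (CkM oU C1 (Cc _))).
Qed.

Lemma Ck_gside2 r : Ck n U (fun z => gside2 x1 x2 (e z) (b0 z) (b1 z) (b2 z) r).
Proof.
apply: (CkD oU).
  by apply: (CkN oU); apply: (Ck_sum oU) => s _; exact (CkM oU (CL2 r s) (Cc _)).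
by apply: (CkM oU (CL1 r)); exact (CkB oU (CkM oU C0 (Cc _)) (CkM oU C1 (Cc _))).
Qed.

End Smoothness.

(** [w r] is the smooth quotient of [nu_r G] by [ell r]. Its pairing with [nu_r] encodes the
    condition on the normal derivative of [G] without differentiating, a form that passes to
    [mixed_mx]. *)
Lemma inv_hessian_extension (u : R * R -> R) : guillemin p u ->
  exists (U : set (R * R)) (G : R * R -> 'M[R]_2) (w : 'I_(nsides p) -> 'I_2 -> R * R -> R),
  [/\ open U /\ P `<=` U,
      Ck_mx U 2 G /\ (forall y, (G y)^T = G y),
      forall r a, Ck 2 U (w r a),
      (forall r y a, coo ord0 (nu r) * G y ord0 a + coo i1 (nu r) * G y i1 a = ell r y * w r a y) /\
      (forall r y, U y -> ell r y = 0 ->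
        coo ord0 (nu r) * w r ord0 y + coo i1 (nu r) * w r i1 y = 1)
    & forall y, Po y -> [/\ hessian u y *m G y = 1%:M,
        0 < G y ord0 ord0, 0 < G y i1 i1 & 0 < \det (G y)]].
Proof.
move=> [[h [Uh [g [oUh PUh smg hg]]] uh] pd [delta [cdelta delta0 detE]]].
pose b0 := partial ord0 (partial ord0 g); pose b1 := partial ord0 (partial i1 g).
pose b2 := partial i1 (partial i1 g).
(* Two derivatives go into the Hessian of [g], and two must remain for [G]. *)
have C4 := smooth_on_Ck 4 smg.
have C0 : Ck 2 Uh b0 := Ck_partial _ (Ck_partial _ C4).
have C1 : Ck 2 Uh b1 := Ck_partial _ (Ck_partial _ C4).
have C2 : Ck 2 Uh b2 := Ck_partial _ (Ck_partial _ C4).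
pose x1 r := (@nu R p r).1; pose x2 r := (@nu R p r).2; pose e z r := @ell R p r z.
pose D z := gden x1 x2 (e z) (b0 z) (b1 z) (b2 z).
pose N z := gnum x1 x2 (e z) (b0 z) (b1 z) (b2 z).
have CD : Ck 2 Uh D by exact: Ck_gden.
have l0 (r : 'I_(nsides p)) y : Po y -> 0 < ell r y by exact: interior_gt0.
have uE y : Po y -> u y = guillemin_potential p y + g y.
  by move=> Iy; rewrite uh// hg//; exact: PoP.
have PoU : Po `<=` Uh by move=> y /PoP; exact: PUh.
have hE y a b : Po y -> hessian u y a b = \sum_(r < nsides p) coo a (nu r) * coo b (nu r) * (ell r y)^-1
    + partial a (partial b g) y by move=> Iy; exact (hessian_potential PoU (CkW (CkW C4)) uE l0 a b Iy).
have hsym y : Po y -> (hessian u y)^T = hessian u y by move=> /pd[].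
pose h0 y := hessian u y ord0 ord0; pose h1 y := hessian u y ord0 i1.
pose h2 y := hessian u y i1 i1.
have hS y : Po y -> hessian u y = sym2 (h0 y) (h1 y) (h2 y) by move=> /hsym/sym2P.
have NE y : Po y -> N y = (\prod_(r < nsides p) ell r y) *: sym2 (h2 y) (- h1 y) (h0 y).
  move=> Iy; rewrite /N gnumE; first by rewrite /h0 /h1 /h2 !hE.
  by move=> r; rewrite gt_eqF// l0.
have DE y : Po y -> D y = (\prod_(r < nsides p) ell r y) * (h0 y * h2 y - h1 y ^+ 2).
  move=> Iy; rewrite /D gdenE; first by rewrite /h0 /h1 /h2 !hE.
  by move=> r; rewrite gt_eqF// l0.
have detH y : Po y -> \det (hessian u y) = h0 y * h2 y - h1 y ^+ 2.
  by move=> Iy; rewrite [in LHS](hS y Iy) det2; have [-> -> -> ->] := sym2E (h0 y) (h1 y) (h2 y).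
have L0 y : Po y -> 0 < \prod_(r < nsides p) ell r y by move=> Iy; apply: prodr_gt0 => r _; exact: l0.
have dD y : Po y -> delta y * D y = 1.
  move=> Iy; rewrite DE// -detH// detE// mulrA mulfV// gt_eqF// mulr_gt0//; last exact: L0.
  by apply: delta0; exact: PoP.
(* The determinant condition is an interior statement; continuity of [delta] up to the boundary
   carries it over and excludes zeros of [D] there. *)
have dDP y : P y -> delta y * D y = 1.
  apply: (density_eq cP nu0 Iy0 _ dD) => x.
  by apply: continuousM; [exact: cdelta|exact: within_CkP PUh CD x].
have D0 y : P y -> 0 < D y.
  by move=> Py; rewrite -(pmulr_rgt0 _ (delta0 _ Py)) dDP.
pose U := [set z | Uh z /\ 0 < D z].
have oU : open U by exact: open_Ck_gt0 oUh CD.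
have UUh : U `<=` Uh by move=> z [].
have CDV : Ck 2 U (fun z => (D z)^-1).
  by apply: (CkV oU); [move=> y [_]; rewrite lt0r => /andP[]|exact: Ck_sub UUh CD].
have B0 := Ck_sub UUh C0; have B1 := Ck_sub UUh C1; have B2 := Ck_sub UUh C2.
pose G z := (D z)^-1 *: N z.
pose w r (a : 'I_2) z := (D z)^-1 * (if a == ord0 then gside1 x1 x2 (e z) (b0 z) (b1 z) (b2 z) r
   else gside2 x1 x2 (e z) (b0 z) (b1 z) (b2 z) r).
exists U, G, w; split.
- by split => // y Py; split; [exact: PUh|exact: D0].
- split; first exact (Ck_mxZ oU CDV (Ck_gnum oU B0 B1 B2)).
  by move=> y; rewrite /G linearZ /= /N /gnum sym2_tr.
- move=> r a; apply: (CkM oU CDV).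
  by case: (a == ord0); [exact: Ck_gside1|exact: Ck_gside2].
- split; last first.
    move=> r y Uy ly; have [_ Dy] := Uy.
    rewrite /w /= !coo0 !coo1 mulrCA [X in _ + X]mulrCA -mulrDr.
    by rewrite (@gside_den _ _ x1 x2 (e y) (b0 y) (b1 y) (b2 y) r ly) mulVf// gt_eqF.
  move=> r y a.
  have com (q a1 a2 n1 n2 E X : R) : a1 * n1 + a2 * n2 = E * X ->
      a1 * (q * n1) + a2 * (q * n2) = E * (q * X).
    by move=> H; rewrite mulrCA [a2 * _]mulrCA -mulrDr H mulrCA.
  case: (ord2P a) => ->; rewrite !coo0 !coo1 /G !scale2E; apply: com.
    exact: (gnum_side1 x1 x2 (e y) (b0 y) (b1 y) (b2 y) r).
  exact: (gnum_side2 x1 x2 (e y) (b0 y) (b1 y) (b2 y) r).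
- move=> y Iy; have dH : \det (hessian u y) = h0 y * h2 y - h1 y ^+ 2 by exact: detH.
  have [sH posH] := pd _ Iy.
  have dH0 : 0 < h0 y * h2 y - h1 y ^+ 2.
    rewrite -dH detE// invr_gt0 mulr_gt0//; last exact: L0.
    by apply: delta0; exact: PoP.
  have GE : G y = (h0 y * h2 y - h1 y ^+ 2)^-1 *: sym2 (h2 y) (- h1 y) (h0 y).
    rewrite /G NE// DE// scalerA; congr (_ *: _); rewrite invfM mulrAC mulVf ?mul1r//.
    by rewrite gt_eqF// L0.
  have h00 : 0 < h0 y := posdef_diag_gt0 ord0 (pd _ Iy).
  have h20 : 0 < h2 y := posdef_diag_gt0 i1 (pd _ Iy).
  have [s0 s1 s2 s3] := sym2E (h2 y) (- h1 y) (h0 y).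
  split.
  + rewrite GE -scalemxAr (hS y Iy).
    have [t0 t1 t2 t3] := sym2E (h0 y) (h1 y) (h2 y).
    have [q0 q1 q2 q3] := scalar2 (1 : R).
    have nz : h0 y * h2 y - h1 y ^+ 2 != 0 by rewrite gt_eqF.
    move: (h0 y) (h1 y) (h2 y) nz s0 s1 s2 s3 t0 t1 t2 t3 => a b c nz s0 s1 s2 s3 t0 t1 t2 t3.
    apply: mx2P; rewrite !entry2E ?s0 ?s1 ?s2 ?s3 ?t0 ?t1 ?t2 ?t3 ?q0 ?q1 ?q2 ?q3;
    by field.
  + by rewrite GE scale2E s0 mulr_gt0// invr_gt0.
  + by rewrite GE scale2E s3 mulr_gt0// invr_gt0.
  + rewrite GE det2 !scale2E s0 s1 s2 s3.
    rewrite (_ : _ - _ = ((h0 y * h2 y - h1 y ^+ 2)^-1) ^+ 2 * (h0 y * h2 y - h1 y ^+ 2)); last first.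
      by move: (_^-1) => q; ring.
    by rewrite mulr_gt0// exprn_gt0// invr_gt0.
Qed.

End InverseHessian.

(** * Passage from the interior to the closed polygon *)

Section Closure.
Variable R : realType.
Implicit Types (U : set (R * R)) (y z : R * R).

Lemma cvg_Ck_mx n U m1 m2 (G : R * R -> 'M[R]_(m1, m2)) y : U y -> Ck_mx U n G ->
  G z @[z --> y] --> G y.
Proof.
move=> Uy CG A [Q nQ QA].
have : \forall z \near y, forall i j, Q i j (G z i j).
  apply: (filter_forall (nbhs_filter y)) => i; apply: (filter_forall (nbhs_filter y)) => j.
  have cf : {for y, continuous (fun z => G z i j)} by exact: Ck_continuous (CG i j) Uy.
  exact (cf _ (nQ i j)).
by apply: (@filterS _ _ (nbhs_filter y)) => z Hz; exact: QA.
Qed.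

Variable p : polygon R.
Notation P := (region p).
Notation Po := (interior (region p)).
Hypothesis nu0 : forall r, @nu R p r != (0, 0) :> R * R.
Variable y0 : R * R.
Hypothesis Iy0 : Po y0.

(** A limit from the interior is meaningful only if interior points accumulate at [y]; dilates about
    [y0] provide them. *)
Lemma within_interior_proper y : P y -> ProperFilter (within Po (nbhs y)).
Proof.
move=> Py; apply: Build_ProperFilter_ex => A; rewrite /within /= => nA.
have cd : dil y0 t y @[t --> (1 : R)] --> y.
  rewrite -[X in _ --> X](dil1 y0 y).
  have c1 (a b : R) : (a + t * b) @[t --> (1 : R)] --> a + 1 * b.
    by apply: cvgD; [exact: cvg_cst|apply: cvgM; [exact: cvg_id|exact: cvg_cst]].
  exact: (cvg_pair (c1 _ _) (c1 _ _)).
have [t [t0 t1 Ht]] := near1_ex (cd _ nA).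
exists (dil y0 t y); apply: Ht; apply: (interior_dil nu0 Iy0 Py).
by rewrite t1 andbT (le_trans _ t0)// invr_ge0.
Qed.

Lemma inv_hessian_closureE n U u (G : R * R -> 'M[R]_2) y : P y -> U y -> Ck_mx U n G ->
  (forall z, Po z -> invmx (hessian u z) = G z) -> inv_hessian_closure p u y = G y.
Proof.
move=> Py Uy CG GE; have PF := within_interior_proper Py.
apply: cvg_lim; first exact: norm_hausdorff.
have c : G z @[z --> within Po (nbhs y)] --> G y.
  exact: cvg_within_filter (cvg_Ck_mx Uy CG).
apply: cvg_trans c; apply: near_eq_cvg; rewrite near_withinE.
by apply: nearW => z Iz; rewrite GE.
Qed.

End Closure.

Section SmoothMatrix.
Variable R : realType.
Implicit Types (U P : set (R * R)) (y z : R * R).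

(** Independent extensions of the two off-diagonal entries may differ away from [P]; taking one of
    them for both keeps the extension symmetric everywhere. *)
Lemma smooth_upto_sym n P (M : R * R -> 'M[R]_2) :
  (forall i j, smooth_upto P (fun y => M y i j)) ->
  (forall y, P y -> (M y)^T = M y) ->
  exists (U : set (R * R)) (A : R * R -> 'M[R]_2), [/\ open U, P `<=` U, Ck_mx U n A,
    forall y, (A y)^T = A y & forall y, P y -> M y = A y].
Proof.
move=> sM symM.
have [U0 [g0 [oU0 PU0 /(smooth_on_Ck n) s0 e0]]] := sM ord0 ord0.
have [U1 [g1 [oU1 PU1 /(smooth_on_Ck n) s1 e1]]] := sM ord0 i1.
have [U2 [g2 [oU2 PU2 /(smooth_on_Ck n) s2 e2]]] := sM i1 i1.
have oU : open (U0 `&` U1 `&` U2) by apply: openI => //; exact: openI.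
have {}s0 : Ck n (U0 `&` U1 `&` U2) g0 by apply: Ck_sub s0 => z [[]].
have {}s1 : Ck n (U0 `&` U1 `&` U2) g1 by apply: Ck_sub s1 => z [[]].
have {}s2 : Ck n (U0 `&` U1 `&` U2) g2 by apply: Ck_sub s2 => z [].
exists (U0 `&` U1 `&` U2), (fun y => sym2 (g0 y) (g1 y) (g2 y)); split => //.
- by move=> y Py; split; [split; [exact: PU0|exact: PU1]|exact: PU2].
- move=> i j; case: (ord2P i) => ->; case: (ord2P j) => ->.
  + by apply: eq_Ck oU _ s0 => z _; rewrite mxE.
  + by apply: eq_Ck oU _ s1 => z _; rewrite mxE.
  + by apply: eq_Ck oU _ s1 => z _; rewrite mxE.
  + by apply: eq_Ck oU _ s2 => z _; rewrite mxE.
- by move=> y; rewrite sym2_tr.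
- by move=> y Py; rewrite (sym2P (symM _ Py)) e0// e1// e2.
Qed.

Lemma csmooth_mx_upto_sym n P (Phi : R * R -> 'M[R[i]]_2) :
  csmooth_mx_upto P Phi -> (forall y, P y -> (Phi y)^T = Phi y) ->
  exists (U : set (R * R)) (A B : R * R -> 'M[R]_2),
  [/\ open U /\ P `<=` U, Ck_mx U n A /\ Ck_mx U n B,
    forall y, (A y)^T = A y, forall y, (B y)^T = B y & forall y, P y -> Phi y = cx (A y) (B y)].
Proof.
move=> sP symP.
have [|y Py|UA [A [oA PA CA sA eA]]] :=
  @smooth_upto_sym n P (fun y => map_mx (@complex.Re R) (Phi y)).
- move=> i j; have [h _] := sP i j.
  by rewrite (_ : (fun y => _) = fun y => complex.Re (Phi y i j))//; apply/funext => y; rewrite mxE.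
- by rewrite -[in RHS](symP _ Py); apply/matrixP => i j; rewrite !mxE.
have [|y Py|UB [B [oB PB CB sB eB]]] :=
  @smooth_upto_sym n P (fun y => map_mx (@complex.Im R) (Phi y)).
- move=> i j; have [_ h] := sP i j.
  by rewrite (_ : (fun y => _) = fun y => complex.Im (Phi y i j))//; apply/funext => y; rewrite mxE.
- by rewrite -[in RHS](symP _ Py); apply/matrixP => i j; rewrite !mxE.
exists (UA `&` UB), A, B; split => //.
- by split; [exact: openI|move=> y Py; split; [exact: PA|exact: PB]].
- by split=> i j; [apply: Ck_sub (CA i j) => z []|apply: Ck_sub (CB i j) => z []].
- by move=> y Py; rewrite (cx_re_im (Phi y)) eA// eB.
Qed.

Lemma ddiv_eq U (M N : R * R -> 'M[R]_2) y : open U -> Ck_mx U 2 N ->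
  (forall z, U z -> N z = M z) -> U y -> ddiv M y = ddiv N y.
Proof.
move=> oU CN NM Uy; rewrite /ddiv; apply: eq_bigr => a _; apply: eq_bigr => b _.
have eb z : U z -> partial b (fun w => N w a b) z = partial b (fun w => M w a b) z.
  move=> Uz; apply: (eq_partial _ oU Uz); last exact: Ck_diff (CN a b) Uz.
  by move=> w Uw; rewrite NM.
apply/esym; apply: (eq_partial _ oU Uy eb).
exact: Ck_diff (Ck_partial b (CN a b)) Uy.
Qed.

End SmoothMatrix.

(** * The coefficient matrix of the second equation *)

Section MixedMatrix.
Variable R : realType.
Implicit Types (A B G : 'M[R]_2).

Definition xi_tr A B G := \tr (G *m qmx A B G).
(** [root_det] and [root_tr] are the determinant and the trace of the principal square root [Q] of
    [Y = 1 - X]: [(tr Q)^2 = tr Y + 2 det Q]. *)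
Definition root_det A B G := Num.sqrt (1 - xi_tr A B G + qdet A B G).
Definition root_tr A B G := Num.sqrt (2 - xi_tr A B G + 2 * root_det A B G).
Definition mixed_mx A B G := (root_tr A B G)^-1 *:
  ((1 + root_det A B G) *: G - G *m qmx A B G *m G).

(** The eigenvalue bound is available on the polygon only. It implies these two open conditions,
    which persist nearby and keep both square roots smooth. *)
Definition xi_admissible A B G :=
  0 < 1 - xi_tr A B G + qdet A B G /\ 0 < 2 - xi_tr A B G + 2 * root_det A B G.

Lemma root_detE A B G : xi_admissible A B G ->
  0 < root_det A B G /\ root_det A B G ^+ 2 = 1 - xi_tr A B G + qdet A B G.
Proof. by move=> [h _]; rewrite sqrtr_gt0 h sqr_sqrtr// ltW. Qed.

Lemma root_trE A B G : xi_admissible A B G ->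
  0 < root_tr A B G /\ root_tr A B G ^+ 2 = 2 - xi_tr A B G + 2 * root_det A B G.
Proof. by move=> [_ h]; rewrite sqrtr_gt0 h sqr_sqrtr// ltW. Qed.

Lemma mixed_mx_sym A B G : G^T = G -> A^T = A -> B^T = B ->
  (mixed_mx A B G)^T = mixed_mx A B G.
Proof.
move=> sG sA sB; have sS : (qmx A B G)^T = qmx A B G.
  by rewrite /qmx linearD /= !trmx_mul sA sB sG !mulmxA.
by rewrite /mixed_mx linearZ /= linearB /= linearZ /= !trmx_mul sS sG mulmxA.
Qed.

Lemma re_mx_sqrt_xi A B G : A^T = A -> B^T = B -> xi_admissible A B G ->
  let X := cplx_mx G *m cx A B *m cplx_mx G *m conj_mx (cx A B) in
  (forall z, eigenvalue X z -> z < 1) ->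
  map_mx (@complex.Re R) (mx_sqrt (1%:M - X) *m cplx_mx G) = mixed_mx A B G.
Proof.
move=> sA sB adm X eigX; have [d0 dE] := root_detE adm; have [t0 tE] := root_trE adm.
have -> := mx_sqrtE (tr_xi G A B) (det_xi G sA sB) eigX d0 dE t0 tE.
exact: re_sqrt_mx.
Qed.

Section Smooth.
Variables (U : set (R * R)) (n : nat) (A B G : R * R -> 'M[R]_2).
Hypotheses (oU : open U) (CA : Ck_mx U n A) (CB : Ck_mx U n B) (CG : Ck_mx U n G).

Lemma Ck_qmx : Ck_mx U n (fun z => qmx (A z) (B z) (G z)).
Proof.
exact (Ck_mxD oU (Ck_mxM oU (Ck_mxM oU CA CG) CA) (Ck_mxM oU (Ck_mxM oU CB CG) CB)).
Qed.

Lemma Ck_xi_tr : Ck n U (fun z => xi_tr (A z) (B z) (G z)).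
Proof.
have H := Ck_mxM oU CG Ck_qmx.
by apply: eq_Ck oU _ (CkD oU (H ord0 ord0) (H i1 i1)) => z _; rewrite /xi_tr tr2.
Qed.

Lemma Ck_qdet : Ck n U (fun z => qdet (A z) (B z) (G z)).
Proof.
have Cdet : Ck n U (fun z => \det (G z)).
  apply: eq_Ck oU _ (CkB oU (CkM oU (CG ord0 ord0) (CG i1 i1)) (CkM oU (CG ord0 i1) (CG i1 ord0))).
  by move=> z _; rewrite det2.
have Csq (f : R * R -> R) : Ck n U f -> Ck n U (fun z => f z ^+ 2).
  by move=> Cf; exact (CkM oU Cf Cf).
apply: (CkM oU (Csq _ Cdet)); apply: (CkD oU); apply: (Csq _).
  apply: (CkB oU).
    exact (CkB oU (CkM oU (CA ord0 ord0) (CA i1 i1)) (CkM oU (CB ord0 ord0) (CB i1 i1))).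
  exact (CkB oU (Csq _ (CA ord0 i1)) (Csq _ (CB ord0 i1))).
apply: (CkB oU).
  exact (CkD oU (CkM oU (CA ord0 ord0) (CB i1 i1)) (CkM oU (CB ord0 ord0) (CA i1 i1))).
exact (CkM oU (CkM oU (Ck_cst n U 2) (CA ord0 i1)) (CB ord0 i1)).
Qed.

(** The domain is cut out in two stages, because the second inequality involves [root_det], which is
    smooth only where the first one holds. *)
Lemma admissible_domain : exists V, [/\ open V,
  forall z, V z <-> (U z /\ xi_admissible (A z) (B z) (G z)),
  Ck n V (fun z => root_det (A z) (B z) (G z)) & Ck n V (fun z => (root_tr (A z) (B z) (G z))^-1)].
Proof.
have C1 : Ck n U (fun z => 1 - xi_tr (A z) (B z) (G z) + qdet (A z) (B z) (G z)).
  exact (CkD oU (CkB oU (Ck_cst n U 1) Ck_xi_tr) Ck_qdet).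
have oV1 := open_Ck_gt0 oU C1.
set V1 := [set z | _] in oV1.
have V1U : V1 `<=` U by move=> z [].
have Cd : Ck n V1 (fun z => root_det (A z) (B z) (G z)).
  by apply: (Ck_sqrt oV1); [move=> y []|exact: Ck_sub V1U C1].
have C2 : Ck n V1 (fun z => 2 - xi_tr (A z) (B z) (G z) + 2 * root_det (A z) (B z) (G z)).
  exact (CkD oV1 (CkB oV1 (Ck_cst n V1 2) (Ck_sub V1U Ck_xi_tr)) (CkM oV1 (Ck_cst n V1 2) Cd)).
have oV := open_Ck_gt0 oV1 C2.
set V := [set z | _] in oV.
have VV1 : V `<=` V1 by move=> z [].
exists V; split => //.
- by move=> z; split=> [[[h1 h2] h3]|[h1 [h2 h3]]].
- exact: Ck_sub VV1 Cd.
- have pos y : V y -> 0 < 2 - xi_tr (A y) (B y) (G y) + 2 * root_det (A y) (B y) (G y) by case.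
  apply: (CkV oV); last exact: (Ck_sqrt oV pos (Ck_sub VV1 C2)).
  by move=> y /pos h; rewrite gt_eqF// sqrtr_gt0.
Qed.

End Smooth.

Lemma row2_eq0_det G (n0 n1 : R) : (n0, n1) != (0, 0) :> R * R ->
  n0 * G ord0 ord0 + n1 * G i1 ord0 = 0 -> n0 * G ord0 i1 + n1 * G i1 i1 = 0 -> \det G = 0.
Proof.
rewrite det2; move: (G ord0 ord0) (G i1 ord0) (G ord0 i1) (G i1 i1) => a c b e n00 h0 h1.
have e0 : n0 * (a * e - b * c) = 0.
  rewrite (_ : _ * _ = (n0 * a + n1 * c) * e - (n0 * b + n1 * e) * c); last by ring.
  by rewrite h0 h1 !mul0r subrr.
have e1 : n1 * (a * e - b * c) = 0.
  rewrite (_ : _ * _ = (n0 * b + n1 * e) * a - (n0 * a + n1 * c) * b); last by ring.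
  by rewrite h0 h1 !mul0r subrr.
apply: contraNeq n00 => D0; rewrite xpair_eqE.
by move/eqP: e0; move/eqP: e1; rewrite !mulf_eq0 (negbTE D0) !orbF => -> ->.
Qed.

(* On a side [det G = 0], so the square root has the eigenvalues [root_det] and [1]
   and the first-order normalisation of [G] along the side is inherited by [mixed_mx]. *)
Lemma root_tr_degenerate A B G : xi_admissible A B G -> \det G = 0 ->
  root_tr A B G = 1 + root_det A B G.
Proof.
move=> adm G0; have [d0 dE] := root_detE adm; have [t0 tE] := root_trE adm.
apply/eqP; rewrite -(@eqrXn2 _ 2)//; [|exact: ltW|by rewrite addr_ge0// ltW].
rewrite tE sqrrD dE /qdet G0 expr1n expr0n /= mul0r addr0 mul1r mulr_natl.
by apply/eqP; ring.
Qed.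

End MixedMatrix.

Section Boundary.
Variables (R : realType) (p : polygon R).
Implicit Types (r : 'I_(nsides p)) (y z : R * R).

(** Both terms of [mixed_mx] have [G] on the left, so a factor [l] of [n *m G] comes out of the
    whole matrix. *)
Lemma row_mixed_mx (A B G : 'M[R]_2) (n W : 'rV[R]_2) (l : R) : n *m G = l *: W ->
  n *m mixed_mx A B G =
  l *: ((root_tr A B G)^-1 *: ((1 + root_det A B G) *: W - W *m qmx A B G *m G)).
Proof.
move=> nG; rewrite /mixed_mx -scalemxAr mulmxBr -scalemxAr !mulmxA nG -!scalemxAl.
by rewrite [RHS]scalerA mulrC -scalerA [in RHS]scalerBr [in RHS]scalerA mulrC -scalerA.
Qed.

(** Differentiating [nu_a m^{ab} = ell_r om^b] where [ell r] vanishes, only the derivative of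
    [ell r], namely [nu_b], survives. *)
Lemma side_divergence r (M : R * R -> 'M[R]_2) (om : R * R -> 'rV[R]_2) y :
  (forall z b, \sum_(a < 2) coo a (nu r) * M z a b = ell r z * om z 0 b) ->
  (forall a b, differentiable (fun z => M z a b) y) ->
  (forall b, differentiable (fun z => om z 0 b) y) -> ell r y = 0 ->
  \sum_(a < 2) coo a (nu r) * \sum_(b < 2) partial b (fun z => M z a b) y =
  \sum_(b < 2) om y 0 b * coo b (nu r).
Proof.
move=> nM dM dom ly.
under eq_bigr do rewrite mulr_sumr.
rewrite exchange_big /=; apply: eq_bigr => b _.
have dc a : differentiable (fun z => coo a (nu r) * M z a b) y.
  by apply: diffM'; [exact: differentiable_cst|exact: dM].
have [_ eS] := @partial_sum _ _ (index_enum _) (fun (a : 'I_2) z => coo a (nu r) * M z a b) b y dc.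
transitivity (partial b (fun z => \sum_(a < 2) coo a (nu r) * M z a b) y).
  rewrite eS; apply: eq_bigr => a _.
  rewrite partialM; [|exact: differentiable_cst|exact: dM].
  by rewrite partial_cst ?mulr0 ?mul0r ?addr0 ?add0r // mulrC.
rewrite (_ : (fun z => _) = fun z => ell r z * om z 0 b); last by apply/funext => z; exact: nM.
rewrite partialM; [|exact: diff_ell|exact: dom].
by rewrite partial_ell ly !mul0r ?mulr0 ?addr0 ?add0r.
Qed.

End Boundary.

Lemma mulmx_cancel2 (F : comRingType) n (g h a b : 'M[F]_n) : g *m h = 1%:M ->
  g *m a *m g *m h *m (g *m b *m g) *m h = g *m a *m g *m b.
Proof.
move=> gh; rewrite -(mulmxA (g *m a) g h) gh mulmx1 !mulmxA.
by rewrite -(mulmxA _ g h) gh mulmx1.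
Qed.

(** * The hypotheses of Green's formula for the coefficient matrix *)

Section Reduction.
Variables (R : realType) (p : polygon R) (u : R * R -> R) (Phi xi : R * R -> 'M[R[i]]_2).
Notation P := (region p).
Notation Po := (interior (region p)).
Implicit Types (r : 'I_(nsides p)) (y z : R * R).
Hypothesis nu0 : forall r, @nu R p r != (0, 0) :> R * R.
Variables (V : set (R * R)) (A B G : R * R -> 'M[R]_2) (w : 'I_(nsides p) -> 'I_2 -> R * R -> R).
Hypotheses (oV : open V) (PV : P `<=` V).
Hypotheses (CA : Ck_mx V 2 A) (CB : Ck_mx V 2 B) (CG : Ck_mx V 2 G) (Cw : forall r a, Ck 2 V (w r a)).
Hypotheses (sA : forall y, (A y)^T = A y) (sB : forall y, (B y)^T = B y) (sG : forall y, (G y)^T = G y).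
Hypothesis adm : forall y, V y -> xi_admissible (A y) (B y) (G y).
Hypothesis Cd : Ck 2 V (fun z => root_det (A z) (B z) (G z)).
Hypothesis Ct : Ck 2 V (fun z => (root_tr (A z) (B z) (G z))^-1).
Hypothesis nG : forall r y a,
  coo ord0 (nu r) * G y ord0 a + coo i1 (nu r) * G y i1 a = ell r y * w r a y.
Hypothesis nw : forall r y, V y -> ell r y = 0 ->
  coo ord0 (nu r) * w r ord0 y + coo i1 (nu r) * w r i1 y = 1.

Let m z := mixed_mx (A z) (B z) (G z).
Let W r z : 'rV[R]_2 := \row_a w r a z.
Let nrow r : 'rV[R]_2 := \row_a coo a (@nu R p r).
Let om r z := (root_tr (A z) (B z) (G z))^-1 *:
  ((1 + root_det (A z) (B z) (G z)) *: W r z - W r z *m qmx (A z) (B z) (G z) *m G z).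

Let nrowG r z : nrow r *m G z = ell r z *: W r z.
Proof. by apply/rowP => a; rewrite !mxE sum_ord2 !mxE nG. Qed.

Let nrow_m r z b : \sum_(a < 2) coo a (nu r) * m z a b = ell r z * om r z 0 b.
Proof.
have /(congr1 (fun M : 'rV[R]_2 => M 0 b)) := row_mixed_mx (A z) (B z) (nrowG r z).
rewrite [LHS]mxE [X in _ = X -> _]mxE => <-.
by apply: eq_bigr => a _; rewrite [nrow _ _ _]mxE.
Qed.

Let C1d : Ck 2 V (fun z => 1 + root_det (A z) (B z) (G z)).
Proof. exact (CkD oV (Ck_cst 2 V 1) Cd). Qed.

Lemma Ck_mixed_mx : Ck_mx V 2 m.
Proof.
have CS := Ck_qmx oV CA CB CG.
exact (Ck_mxZ oV Ct (Ck_mxB oV (Ck_mxZ oV C1d CG) (Ck_mxM oV (Ck_mxM oV CG CS) CG))).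
Qed.

Let Com r : Ck_mx V 2 (om r).
Proof.
have CW : Ck_mx V 2 (W r).
  by move=> i a; apply: eq_Ck oV _ (Cw r a) => z _; rewrite mxE.
have CS := Ck_qmx oV CA CB CG.
exact (Ck_mxZ oV Ct (Ck_mxB oV (Ck_mxZ oV C1d CW) (Ck_mxM oV (Ck_mxM oV CW CS) CG))).
Qed.

Lemma mixed_side0 r y : side r y -> forall b, \sum_(a < 2) coo a (nu r) * m y a b = 0.
Proof. by move=> [_ ly] b; rewrite nrow_m ly mul0r. Qed.

Lemma mixed_side1 r y : side r y ->
  \sum_(a < 2) coo a (nu r) * \sum_(b < 2) partial b (fun z => m z a b) y = 1.
Proof.
move=> [Py ly]; have Vy := PV Py.
rewrite (@side_divergence _ _ r m (om r) y)//; last 2 first.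
- by move=> a b; exact: Ck_diff (Ck_mixed_mx a b) Vy.
- by move=> b; exact: Ck_diff (Com r 0 b) Vy.
have nG0 : nrow r *m G y = 0 by rewrite nrowG ly scale0r.
(* By symmetry [G] also annihilates the normal from the right, which removes the quadratic term of
   [om]. *)
have Gn0 : G y *m (nrow r)^T = 0 by rewrite -[G y]sG -trmx_mul nG0 trmx0.
have Wn : W r y *m (nrow r)^T = 1%:M.
  apply/matrixP => i j; rewrite !mxE sum_ord2 !mxE (ord1 i) (ord1 j) eqxx /= -(nw Vy ly).
  by rewrite mulrC [X in _ + X]mulrC.
have G0 : \det (G y) = 0.
  apply: (@row2_eq0_det _ _ (nu r).1 (nu r).2).
  - by rewrite -surjective_pairing.
  - by have := nG r y ord0; rewrite ly mul0r.
  - by have := nG r y i1; rewrite ly mul0r.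
have omn : om r y *m (nrow r)^T = 1%:M.
  rewrite /om -scalemxAl mulmxBl -scalemxAl -!mulmxA Gn0 !mulmx0 subr0 Wn scalerA.
  rewrite (root_tr_degenerate (adm Vy) G0) mulVf ?scale1r//.
  by have [d0 _] := root_detE (adm Vy); rewrite gt_eqF// addr_gt0.
have : (om r y *m (nrow r)^T) 0 0 = 1 by rewrite omn mxE.
rewrite mxE => <-.
by apply: eq_bigr => b _; congr (_ * _); rewrite !mxE.
Qed.

Hypothesis GP : forall y, Po y -> [/\ hessian u y *m G y = 1%:M,
  0 < G y ord0 ord0, 0 < G y i1 i1 & 0 < \det (G y)].

Lemma mixed_posdef y : Po y ->
  [/\ 0 < m y ord0 ord0, 0 < m y i1 i1 & 0 < m y ord0 ord0 * m y i1 i1 - m y ord0 i1 ^+ 2].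
Proof.
move=> Iy; have ay := adm (PV (interior_subset Iy)).
have [_ G0 G2 D0] := GP Iy; have [d0 dE] := root_detE ay; have [t0 _] := root_trE ay.
have [_ h] := ay.
by apply: (mixed_mx_posdef (sG y) (sA y) (sB y) G0 G2 D0 d0 _ dE h); rewrite invr_gt0.
Qed.

Lemma invmx_hessian y : Po y -> invmx (hessian u y) = G y /\
  invmx (cplx_mx (hessian u y)) = cplx_mx (G y).
Proof.
move=> /GP[HG _ _ _].
have key (F : comUnitRingType) (M N : 'M[F]_2) : M *m N = 1%:M -> invmx M = N.
  by move=> MN; have [uM _] := mulmx1_unit MN; rewrite -[LHS]mulmx1 -MN mulKmx.
split; apply: key => //.
by rewrite -map_mxM HG map_mx1.
Qed.

Hypothesis PhiE : forall y, P y -> Phi y = cx (A y) (B y).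
Hypothesis xiE : forall y, Po y -> xi y = invmx (cplx_mx (hessian u y)) *m Phi y
  *m invmx (cplx_mx (hessian u y)).
Hypothesis eig : forall y, P y -> forall z : R[i],
  eigenvalue (cplx_mx (G y) *m Phi y *m cplx_mx (G y) *m conj_mx (Phi y)) z -> z < 1.
Variable C : R.
Hypothesis sol : forall y, Po y ->
  cddiv (fun z => let H := cplx_mx (hessian u z) in
    mx_sqrt (1%:M - xi z *m H *m conj_mx (xi z) *m H) *m invmx H) y = real_complex R (- C).

Lemma mixed_ddiv y : Po y -> ddiv m y = - C.
Proof.
move=> Iy; have oPo : open Po by exact: open_interior.
(* The right-hand side is real, and the real part of the left-hand side involves only [m]. *)
have /(congr1 (@complex.Re R)) /= <- := sol Iy.
have PoV : Po `<=` V by move=> z /interior_subset; exact: PV.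
apply/esym; apply: (ddiv_eq oPo _ _ Iy) => [a b|z Iz].
  exact: Ck_sub PoV (Ck_mixed_mx a b).
have Pz := interior_subset Iz; have [_ HG] := invmx_hessian Iz.
have [HGz _ _ _] := GP Iz.
set H := cplx_mx (hessian u z).
have GH : cplx_mx (G z) *m H = 1%:M.
  by apply: mulmx1C; rewrite -map_mxM HGz map_mx1.
have conjG : conj_mx (cplx_mx (G z)) = cplx_mx (G z).
  by apply/matrixP => i j; rewrite !mxE; apply/eqP; rewrite eq_complex /= oppr0 !eqxx.
(* Substituting [xi = G Phi G] cancels each Hessian against a [G], leaving an expression that is
   smooth up to the boundary. *)
have -> : xi z *m H *m conj_mx (xi z) *m H =
    cplx_mx (G z) *m Phi z *m cplx_mx (G z) *m conj_mx (Phi z).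
  have conjM (M N : 'M[R[i]]_2) : conj_mx (M *m N) = conj_mx M *m conj_mx N by exact: map_mxM.
  by rewrite (xiE Iz) HG -/H !conjM conjG; exact: mulmx_cancel2.
have ez := eig Pz.
rewrite HG PhiE// in ez *.
by rewrite (re_mx_sqrt_xi (sA z) (sB z) (adm (PoV _ Iz)) ez).
Qed.

End Reduction.

Theorem corollary4p2p7 (R : realType) (p : polygon R)
    (xi Phi : R * R -> 'M[R[i]]_2) (u : R * R -> R)
    (Hdelzant : delzant p)
    (Hu : guillemin p u)
    (HPhi_smooth : csmooth_mx_upto (region p) Phi)
    (HPhi_sym : forall y, region p y -> (Phi y)^T = Phi y)
    (Hxi : forall y, interior (region p) y ->
       xi y = invmx (cplx_mx (hessian u y)) *m Phi y
                *m invmx (cplx_mx (hessian u y)))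
    (Heig : eigenvalues_lt1 p u Phi)
    (Hsol : toric_hcsck p u xi)
    (f : R * R -> R)
    (Hf_convex : convex_function (region p) f)
    (Hf_cont : {within region p, continuous f})
    (Hf_smooth : smooth_on (interior (region p)) f) :
  let L := boundary_integral p f
           - \int[@plane_measure R]_(y in region p) (top_const p * f y) in
  0 <= L /\ (L = 0 <-> affine_on (region p) f).
Proof.
have [cP [y0 Iy0] _ cop dl] := Hdelzant.
have nu0 (r : 'I_(nsides p)) : nu r != (0, 0) :> R * R.
  apply/eqP => -[/eqP h1 /eqP h2]; have := cop r.
  by move: h1 h2; rewrite !intr_eq0 => /eqP -> /eqP ->.
have crossP (r s : 'I_(nsides p)) y : r != s -> side r y -> side s y ->
    (nu r).1 * (nu s).2 - (nu r).2 * (nu s).1 != 0 :> R.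
  move=> rs ry sy; have := dl r s rs (ex_intro _ y (conj ry sy)).
  rewrite /nu /= -!intrM -intrB intr_eq0; apply: contra_eq_neq => ->.
  by rewrite normr0 eq_sym oner_eq0.
have [U [G [w [[oU PU] [CG sG] Cw [nG nw] GP]]]] := inv_hessian_extension cP nu0 Iy0 Hu.
have [UA [A [B [[oA PA] [CA CB] sA sB PhiE]]]] := csmooth_mx_upto_sym 2 HPhi_smooth HPhi_sym.
have oUA : open (U `&` UA) by exact: openI.
have sub1 : U `&` UA `<=` U by move=> z [].
have sub2 : U `&` UA `<=` UA by move=> z [].
have {}CG : Ck_mx (U `&` UA) 2 G by move=> i j; exact: Ck_sub sub1 (CG i j).
have {}CA : Ck_mx (U `&` UA) 2 A by move=> i j; exact: Ck_sub sub2 (CA i j).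
have {}CB : Ck_mx (U `&` UA) 2 B by move=> i j; exact: Ck_sub sub2 (CB i j).
have [V [oV VE Cd Ct]] := admissible_domain oUA CA CB CG.
have VU : V `<=` U `&` UA by move=> z /VE[].
have PUA y : region p y -> (U `&` UA) y by move=> Py; split; [exact: PU|exact: PA].
(* The eigenvalue condition is stated with the boundary limit of the inverse Hessian; that limit is
   the value of the smooth extension. *)
have closE y : region p y -> inv_hessian_closure p u y = G y.
  move=> Py; apply: (inv_hessian_closureE nu0 Iy0 Py (PUA _ Py) CG) => z Iz.
  by have [] := invmx_hessian GP Iz.
have eig y : region p y -> forall z : R[i],
    eigenvalue (cplx_mx (G y) *m Phi y *m cplx_mx (G y) *m conj_mx (Phi y)) z -> z < 1.
  by move=> Py z ez; apply: (Heig y Py); rewrite /xi_norm_mx closE.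
(* The eigenvalue bound on the closed polygon, boundary included, is what makes [V] a neighbourhood
   of all of it. *)
have PV : region p `<=` V.
  move=> y Py; apply/VE; split; first exact: PUA.
  have := eig y Py; rewrite PhiE// => ez.
  have [h1 h2] := eigenvalues_lt1_real (tr_xi (G y) (A y) (B y)) (det_xi (G y) (sA y) (sB y)) ez.
  by split=> //; rewrite ltr_wpDr// mulr_ge0// sqrtr_ge0.
have adm y : V y -> xi_admissible (A y) (B y) (G y) by move=> /VE[].
have {}CG : Ck_mx V 2 G by move=> i j; exact: Ck_sub VU (CG i j).
have {}CA : Ck_mx V 2 A by move=> i j; exact: Ck_sub VU (CA i j).
have {}CB : Ck_mx V 2 B by move=> i j; exact: Ck_sub VU (CB i j).
have {}Cw r a : Ck 2 V (w r a) by apply: Ck_sub (Cw r a) => z /VU[].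
have {}nw (r : 'I_(nsides p)) y : V y -> ell r y = 0 ->
    coo ord0 (nu r) * w r ord0 y + coo i1 (nu r) * w r i1 y = 1.
  by move=> /VU[Uy _]; exact: nw.
have [_ sol] := Hsol.
have Cm := Ck_mixed_mx oV CA CB CG Cd Ct.
have msym y : (mixed_mx (A y) (B y) (G y))^T = mixed_mx (A y) (B y) (G y).
  exact: mixed_mx_sym.
exact: (futaki_positive cP nu0 crossP Iy0 oV PV Cm msym
  (mixed_side0 A B nG) (mixed_side1 nu0 oV PV CA CB CG Cw sG adm Cd Ct nG nw)
  (mixed_ddiv oV PV CA CB CG sA sB adm Cd Ct GP PhiE Hxi eig sol)
  (mixed_posdef PV sA sB sG adm GP) Hf_convex Hf_cont Hf_smooth).
Qed.
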